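(* Let $\gamma>0$, $0\le\mu_a<1$, $0\le\mu_b<2$, and put $i=1$ if $0\le\mu_b<1$ and $i=2$ if $1\le\mu_b<2$. Let $T_i(t)$, $t\ge 0$, be the $C_0$-semigroup of contractions generated by the operator $\mathcal A_i$ on the Hilbert space $\mathcal H_i$ (both defined in the context). Then there is a constant $C>0$ such that $$\|T_i(t)U_0\|_{\mathcal H}\le C\,t^{-\frac{2-\mu_a}{2}}\,\|U_0\|_{\mathcal D(\mathcal A_i)}\qquad\text{for all } t>0 \text{ and all } U_0\in\mathcal D(\mathcal A_i),$$ where $\|U_0\|_{\mathcal D(\mathcal A_i)}$ is the graph norm of $\mathcal A_i$.
   Context: Setting: $a(x)=x^{\mu_a}$ on $[0,1]$ and $b(x)=(x+1)^{\mu_b}$ on $[-1,0]$. The operators below are those of the first-order formulation, with $U=(u,u_t,w,w_t)$ and $\frac{d}{dt}U=\mathcal A_iU$, of the coupled degenerate wave system $u_{tt}-(a u_x)_x=0$ on $(0,1)$, $w_{tt}-(b w_x)_x=0$ on $(-1,0)$, with $u(0,t)=w(0,t)$, $\lim_{x\to0^+}(au_x)(x,t)=(bw_x)(0,t)$, $\gamma u(1,t)+u_t(1,t)+u_x(1,t)=0$, and $w(-1,t)=0$ if $\mu_b<1$, $\lim_{x\to-1^+}(bw_x)(x,t)=0$ if $\mu_b\ge1$. Functions are complex valued and $'$ denotes the derivative in $x$. Weighted spaces: for $(\alpha,x_0,\ell)=(a,0,1)$ or $(b,-1,0)$, $V^1_\alpha(x_0,\ell)=\{u\in L^2(x_0,\ell):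 u \text{ is locally absolutely continuous in }(x_0,\ell],\ \sqrt{\alpha}\,u'\in L^2(x_0,\ell)\}$, $V^2_\alpha(x_0,\ell)=\{u\in V^1_\alpha(x_0,\ell): \alpha u'\in H^1(x_0,\ell)\}$. If $0\le\mu_b<1$, $W_b^1(-1,0)=\{w\in V_b^1(-1,0): w(-1)=0\}$; if $1\le\mu_b<2$, $W_b^1(-1,0)=V_b^1(-1,0)$. Also $W_b^2(-1,0)=V_b^2(-1,0)\cap W_b^1(-1,0)$. Values at an endpoint where the weight degenerates weakly (exponent $<1$), e.g. $u(0)$ or $w(-1)$, are understood as the limits, which exist. Energy spaces: $\mathcal H_1=\{(u,v,w,y)\in V_a^1(0,1)\times L^2(0,1)\times W_b^1(-1,0)\times L^2(-1,0): u(0)=w(0)\}$ (used when $0\le\mu_b<1$), $\mathcal H_2=\{(u,v,w,y)\in V_a^1(0,1)\times L^2(0,1)\times V_b^1(-1,0)\times L^2(-1,0): u(0)=w(0)\}$ (used when $1\le\mu_b<2$), both with the norm (and the associated inner product) $$\|(u,v,w,y)\|_{\mathcal H}^2=\|v\|_{L^2(0,1)}^2+\|y\|_{L^2(-1,0)}^2+\|\sqrt a\,u'\|_{L^2(0,1)}^2+\|\sqrt b\,w'\|_{L^2(-1,0)}^2+\gamma a(1)|u(1)|^2 .$$ Operators: $\mathcal A_i(u,v,w,y)=(v,(au')',y,(bw')')$, where $\mathcal D(\mathcal A_1)$ is the set of $(u,v,w,y)\in\mathcal H_1$ with $u\in V_a^2(0,1)$, $v\in V_a^1(0,1)$, $w\in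 W_b^2(-1,0)$, $y\in W_b^1(-1,0)$, $v(0)=y(0)$, $\gamma u(1)+u'(1)+v(1)=0$, $\lim_{x\to0^+}(au')(x)=(bw')(0)$; $\mathcal D(\mathcal A_2)$ is the set of $(u,v,w,y)\in\mathcal H_2$ with $u\in V_a^2(0,1)$, $v\in V_a^1(0,1)$, $w\in V_b^2(-1,0)$, $y\in V_b^1(-1,0)$, $v(0)=y(0)$, $\gamma u(1)+u'(1)+v(1)=0$, $\lim_{x\to0^+}(au')(x)=(bw')(0)$. The graph norm is $\|U\|_{\mathcal D(\mathcal A_i)}=\|U\|_{\mathcal H}+\|\mathcal A_iU\|_{\mathcal H}$. *)

(* Defs.v *)
From mathcomp Require Import all_boot all_order all_algebra.
From mathcomp Require Import complex.
From mathcomp Require Import all_classical all_reals all_analysis.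

Set Implicit Arguments.
Unset Strict Implicit.
Unset Printing Implicit Defensive.

Import Order.TTheory GRing.Theory Num.Theory.
Import numFieldNormedType.Exports.

Local Open Scope classical_set_scope.
Local Open Scope ring_scope.
Local Open Scope complex_scope.

(* Vectors of a Hilbert space are handled through representatives: X is a
   module of representatives, H the set of those that define a vector, and N
   a seminorm on H; U and V define the same vector iff N (U - V) = 0.
   An operator of the Hilbert space is a map on representatives; by linearity
   modulo N and contractivity, it respects this identification. *)
Section Semigroups.
Context {R : realType} {X : lmodType R[i]}.
Implicit Types (H D : set X) (N : X -> R) (T : R -> X -> X) (A : X -> X).

Definition eqN N (U V : X) : Prop := N (U - V) = 0.

Record C0_contraction_semigroup H N T : Prop := {
  semigroup_stable : forall t U, 0 <= t -> H U -> H (T t U) ;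
  semigroup_linear : forall t (c : R[i]) U V, 0 <= t -> H U -> H V ->
    eqN N (T t (c *: U + V)) (c *: T t U + T t V) ;
  semigroup0 : forall U, H U -> eqN N (T 0 U) U ;
  semigroupD : forall s t U, 0 <= s -> 0 <= t -> H U ->
    eqN N (T (s + t) U) (T s (T t U)) ;
  semigroup_continuous : forall U, H U ->
    N (T h U - U) @[h --> (0 : R)^'+] --> (0 : R) ;
  semigroup_contraction : forall t U, 0 <= t -> H U -> N (T t U) <= N U }.

(* The graph of the infinitesimal generator of T is the graph of A on D. *)
Definition generated_by H N D A T : Prop :=
  forall U F, H U -> H F ->
    (N (h^-1%:C *: (T h U - U) - F) @[h --> (0 : R)^'+] --> (0 : R)) <->
    (exists U', [/\ D U', eqN N U U' & eqN N F (A U')]).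

Definition graph_norm N A (U : X) : R := N U + N (A U).

End Semigroups.

Section FunctionSpaces.
Context {R : realType}.
Implicit Types (f u : R -> R[i]^o) (p q : R) (alpha : R -> R).

Definition normc (z : R[i]) : R := complex.Re `|z|.

(* Only used at points where f is differentiable, possibly up to a null set. *)
Definition cderive f : R -> R[i]^o :=
  fun x => derive1 (fun y => complex.Re (f y)) x
    +i* derive1 (fun y => complex.Im (f y)) x.

Definition wmul alpha f : R -> R[i]^o := fun x => (alpha x)%:C * f x.

(* These limits are only taken where they exist, e.g. because the weight is
   weakly degenerate at x; otherwise lim is a junk value. *)
Definition rlim f (x : R) : R[i]^o := lim (f y @[y --> x^'+]).
Definition llim f (x : R) : R[i]^o := lim (f y @[y --> x^'-]).

Definition sqnormL2 p q f : R :=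
  \int[lebesgue_measure]_(x in `]p, q[) (normc (f x) ^+ 2).

Definition L2 p q f : Prop :=
  [/\ measurable_fun `]p, q[ (fun x => complex.Re (f x)),
      measurable_fun `]p, q[ (fun x => complex.Im (f x)) &
      (\int[lebesgue_measure]_(x in `]p, q[) (normc (f x) ^+ 2)%:E < +oo)%E].

Definition abs_continuous p q f : Prop :=
  forall e, 0 < e -> exists2 d : R, 0 < d &
    forall (n : nat) (s t : 'I_n -> R),
      (forall i, [/\ p <= s i, s i <= t i & t i <= q]) ->
      trivIset setT (fun i => `]s i, t i[%classic) ->
      \sum_(i < n) (t i - s i) < d ->
      \sum_(i < n) normc (f (t i) - f (s i)) < e.

Definition loc_abs_continuous p q f : Prop :=
  forall c, p < c <= q -> abs_continuous c q f.

(* On a bounded interval, H^1 consists of the functions that agree almost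
   everywhere with an absolutely continuous g such that g' is in L^2. *)
Definition H1 p q f : Prop :=
  L2 p q f /\
  exists g : R -> R[i]^o,
    [/\ abs_continuous p q g,
        {ae lebesgue_measure, forall x, p < x < q -> f x = g x} &
        L2 p q (cderive g)].

Definition V1 alpha p q u : Prop :=
  [/\ L2 p q u, loc_abs_continuous p q u &
      L2 p q (wmul (fun x => Num.sqrt (alpha x)) (cderive u))].

Definition V2 alpha p q u : Prop :=
  V1 alpha p q u /\ H1 p q (wmul alpha (cderive u)).

End FunctionSpaces.

Section DegenerateWaves.
Context {R : realType}.
Variables gamma mua mub : R.

Definition wa (x : R) : R := x `^ mua.
Definition wb (x : R) : R := (x + 1) `^ mub.

Definition Va1 := V1 wa 0 1.
Definition Va2 := V2 wa 0 1.
Definition Vb1 := V1 wb (-1) 0.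
Definition Vb2 := V2 wb (-1) 0.

Definition Wb1 (w : R -> R[i]^o) : Prop :=
  if mub < 1 then Vb1 w /\ rlim w (-1) = 0 else Vb1 w.
Definition Wb2 (w : R -> R[i]^o) : Prop := Vb2 w /\ Wb1 w.

(* Representatives of (u, v, w, y): u and v matter on ]0, 1] only, and w and y
   on ]-1, 0] only; the values of u and w there are those of the locally
   absolutely continuous representative. *)
Definition state : Type :=
  ((R -> R[i]^o) * (R -> R[i]^o) * (R -> R[i]^o) * (R -> R[i]^o))%type.
Definition energy_norm (U : state) : R :=
  let: (u, v, w, y) := U in
  Num.sqrt (sqnormL2 0 1 v + sqnormL2 (-1) 0 y
    + sqnormL2 0 1 (wmul (fun x => Num.sqrt (wa x)) (cderive u))
    + sqnormL2 (-1) 0 (wmul (fun x => Num.sqrt (wb x)) (cderive w))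
    + gamma * wa 1 * normc (u 1) ^+ 2).

Definition energy_space1 : set state := [set U | let: (u, v, w, y) := U in
  [/\ Va1 u, L2 0 1 v, Wb1 w, L2 (-1) 0 y & rlim u 0 = w 0]].
Definition energy_space2 : set state := [set U | let: (u, v, w, y) := U in
  [/\ Va1 u, L2 0 1 v, Vb1 w, L2 (-1) 0 y & rlim u 0 = w 0]].

Definition wave_op (U : state) : state :=
  let: (u, v, w, y) := U in
  (v, cderive (wmul wa (cderive u)), y, cderive (wmul wb (cderive w))).

(* u'(1) and (b w')(0) are read as the one-sided limits, i.e. the values at
   the endpoint of the continuous representatives. *)
Definition boundary_conditions (U : state) : Prop :=
  let: (u, v, w, y) := U in
  [/\ rlim v 0 = y 0,
      gamma%:C * u 1 + llim (cderive u) 1 + v 1 = 0 &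
      rlim (wmul wa (cderive u)) 0 = llim (wmul wb (cderive w)) 0].

Definition domain1 : set state := [set U | let: (u, v, w, y) := U in
  [/\ energy_space1 U, [/\ Va2 u, Va1 v, Wb2 w & Wb1 y]
    & boundary_conditions U]].
Definition domain2 : set state := [set U | let: (u, v, w, y) := U in
  [/\ energy_space2 U, [/\ Va2 u, Va1 v, Vb2 w & Vb1 y]
    & boundary_conditions U]].

Definition energy_space : set state :=
  if mub < 1 then energy_space1 else energy_space2.
Definition domain : set state := if mub < 1 then domain1 else domain2.

End DegenerateWaves.

(* Main.v *)
Require Import Defs.
From HB Require Import structures.
From mathcomp Require Import all_boot all_order all_algebra.
From mathcomp Require Import complex ring lra.
From mathcomp Require Import all_classical all_reals all_analysis measurable_realfun.

(** The energy identity only dissipates |v(1)|^2, so decay is extracted from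
    quadratic Lyapunov forms, applied to real and imaginary parts separately.
    The multiplier (x + 1) w' on (-1, 0), the static profile (phi, psi) of the
    coupled operator, and the multiplier x u' shifted so as to absorb the
    boundary term gamma u(1), give for every h in (0, 1] a form B0 of size 1 / h
    whose derivative is at most - c N(U)^2 plus h^(1 - mua) times the local
    energy of A U on (0, 1): the traces at the degenerate interface cost a
    Hardy-type loss, split at the scale h. The plain multiplier x u' gives a
    form B1 of size h^(1 - mua) whose derivative at A U pays for that remainder.
    Since B1 is only differentiable along A U through difference quotients, both
    are integrated along the semigroup, which yields
    t N(T(2t) U)^2 <= C (N(T(t) U)^2 / h + h^(1 - mua) (N(U)^2 + N(A U)^2)).
    Choosing h proportional to 1 / t and iterating dyadically gives
    N(T(t) U)^2 = O(t^(- (2 - mua))). *)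

Set Implicit Arguments.
Unset Strict Implicit.
Unset Printing Implicit Defensive.

Import Order.TTheory GRing.Theory Num.Theory.
Import numFieldNormedType.Exports.

Local Open Scope classical_set_scope.
Local Open Scope ring_scope.

(** * Absolutely continuous real functions *)

Section AbsoluteContinuity.
Context {R : realType}.
Implicit Types (f g : R -> R) (p q x y : R).

(** The obstacle is the interface. The multiplier on [(-1, 0)] leaves [(v0^2 + P0^2) / 2] at 0,
    where the weight of [(0, 1)] degenerates and the multiplier [x u'] produces no boundary term.
    These traces are bounded by [1 / h] times norms of [v] and of the shifted flux, plus
    [h^(1 - mua)] times norms of [x^(mua / 2) v'] and [P'], which are components of [A U] and not of
    [U]. The [1 / h] is paid by [K2 / h] times the multiplier on [(0, 1)]. At that size a boundary
    term [gamma^2 u(1)^2] could not be absorbed; hence the shifted flux, whose value at 1 is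
    [- v(1)]. The part [gamma u(1)^2] of the energy is dissipated by [u(1)] times the moment against
    [(phi, psi)], a moment whose derivative is [- lambda u(1)]. The second form may leave a term in
    [u(1)^2]: it is put into the remainder form [S], where at [A U] it reads [v(1)^2], and a large
    multiple of the energy, whose dissipation is exactly in [v(1)^2], pays for it. With [h] of order
    [1 / t], the quotient of the sizes [h^(1 - mua)] and [1 / h] is of order [t^(- (2 - mua))], the
    decay of the squared norm. *)

Definition interval_family p q (I : finType) (s t : I -> R) : Prop :=
  (forall i, [/\ p <= s i, s i <= t i & t i <= q]) /\
  trivIset setT (fun i => `]s i, t i[%classic).

(** Families are indexed by an arbitrary [finType] and not by ['I_n], so that a family can be
    refined to pairs (interval, subinterval) without renumbering. *)
Definition real_ac p q f : Prop :=
  forall e : R, 0 < e -> exists2 d : R, 0 < d &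
    forall (I : finType) (s t : I -> R), interval_family p q s t ->
      \sum_i (t i - s i) < d -> \sum_i `|f (t i) - f (s i)| < e.

Lemma real_acS p q p' q' f : p <= p' -> q' <= q ->
  real_ac p q f -> real_ac p' q' f.
Proof.
move=> pp' qq' fac e /fac[d d0 H]; exists d => // I s t [st tI]; apply: H.
split=> // i; have [ps sit tq] := st i.
by split=> //; [exact: le_trans ps|exact: le_trans tq qq'].
Qed.

Lemma real_ac_modulus p q f e : real_ac p q f -> 0 < e -> exists2 d : R, 0 < d &
  forall x y, p <= x -> x <= y -> y <= q -> y - x < d -> `|f y - f x| < e.
Proof.
move=> fac /fac[d d0 H]; exists d => // x y px xy yq xyd.
have := H 'I_1 (fun=> x) (fun=> y); rewrite !big_ord1; apply=> //.
by split => // i j _ _ _; rewrite (ord1 i) (ord1 j).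
Qed.

Lemma real_ac_lipschitz p q f k :
  (forall x y, p <= x -> x <= y -> y <= q -> `|f y - f x| <= k * (y - x)) ->
  real_ac p q f.
Proof.
move=> fk e e0; have k1 : 0 < `|k| + 1 by rewrite ltr_wpDl.
exists (e / (`|k| + 1)); first exact: divr_gt0.
move=> I s t [st _]; rewrite ltr_pdivlMr// => H.
apply: le_lt_trans H; rewrite mulr_suml; apply: ler_sum => i _.
have [ps sit tq] := st i; apply: le_trans (fk _ _ ps sit tq) _.
rewrite mulrC ler_wpM2l ?subr_ge0//.
by rewrite (le_trans (ler_norm _))// lerDl.
Qed.

Lemma real_acD p q f g : real_ac p q f -> real_ac p q g ->
  real_ac p q (fun x => f x + g x).
Proof.
move=> fac gac e e0; have e20 : 0 < e / 2 by rewrite divr_gt0.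
have [d d0 H] := fac _ e20; have [d' d'0 H'] := gac _ e20.
exists (Num.min d d'); first by rewrite lt_min d0.
move=> I s t st; rewrite lt_min => /andP[sd sd'].
rewrite [e]splitr; apply: le_lt_trans (ltrD (H _ _ _ st sd) (H' _ _ _ st sd')).
rewrite -big_split/=; apply: ler_sum => i _.
by rewrite (le_trans _ (ler_normD _ _))// opprD addrACA.
Qed.

Lemma real_ac_comparison p q f g k :
  (forall x y, p <= x -> x <= y -> y <= q ->
    `|g y - g x| <= k * `|f y - f x|) ->
  real_ac p q f -> real_ac p q g.
Proof.
move=> fg fac e e0; have k1 : 0 < `|k| + 1 by rewrite ltr_wpDl.
have [|d d0 H] := fac (e / (`|k| + 1)); first exact: divr_gt0.
exists d => // I s t st sd; have := H _ _ _ st sd; rewrite ltr_pdivlMr//.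
apply: le_lt_trans; rewrite mulr_suml; apply: ler_sum => i _.
have [ps sit tq] := st.1 i; apply: le_trans (fg _ _ ps sit tq) _.
by rewrite mulrC ler_wpM2l// (le_trans (ler_norm _))// lerDl.
Qed.

Lemma real_acZ p q f k : real_ac p q f -> real_ac p q (fun x => k * f x).
Proof.
apply: (real_ac_comparison (k := `|k|)) => x y _ _ _.
by rewrite -mulrBr normrM.
Qed.

(** Finitely many steps shorter than the modulus [d] of [e = 1] reach any point of [[p, q]], and [f]
    changes by less than 1 on each. *)
Lemma real_ac_bounded p q f : p <= q -> real_ac p q f ->
  exists2 M, 0 < M & forall x, p <= x <= q -> `|f x| <= M.
Proof.
move=> pq fac; have [d d0 H] := real_ac_modulus fac ltr01.
suff bnd n x : p <= x <= q -> x - p < n%:R * d ->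
    `|f x| <= `|f p| + n%:R.
  set n := (Num.bound ((q - p) / d)).
  exists (`|f p| + n%:R + 1); first by rewrite ltr_wpDl// addr_ge0.
  move=> x xpq; rewrite (le_trans (bnd n _ xpq _)) ?lerDl//.
  rewrite -ltr_pdivrMr//; apply: le_lt_trans (archi_boundP _); last first.
    by rewrite divr_ge0 ?subr_ge0// ltW.
  by rewrite ler_pM2r ?invr_gt0// lerB//; case/andP: xpq.
elim: n x => [|n ih] x /andP[px xq].
  by rewrite mul0r subr_lt0 ltNge px.
move=> xn; have [xd|xd] := ltP (x - d / 2) p.
  have xpd : x - p < d by lra.
  rewrite -(subrK (f p) (f x)) (le_trans (ler_normD _ _))// addrC lerD//.
  rewrite (ltW (lt_le_trans (H _ _ (lexx p) px xq xpd) _))//.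
  by rewrite ler1n.
have [xd'|xd'] := ltP (x - p) d.
  rewrite -(subrK (f p) (f x)) (le_trans (ler_normD _ _))// addrC lerD//.
  rewrite (ltW (lt_le_trans (H _ _ (lexx p) px xq xd') _))//.
  by rewrite ler1n.
have [xn'|xn'] := ltP (x - p) (n%:R * d).
  by rewrite (le_trans (ih _ _ xn'))// ?px// lerD2l ler_nat.
(* The midpoint of [x - d] and [p + n d]: beyond the first, so the last step is shorter than [d];
   below the second, so the induction hypothesis applies. *)
pose z := (p + n%:R * d + x - d) / 2.
have zx : z <= x by rewrite /z; rewrite -natr1 in xn; lra.
have pz : p <= z by rewrite /z; lra.
have zxd : x - z < d by rewrite /z; lra.
have zn : z - p < n%:R * d by rewrite /z; rewrite -natr1 in xn; lra.
rewrite -(subrK (f z) (f x)) (le_trans (ler_normD _ _))// addrC -natr1 addrA.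
rewrite lerD// ?ih ?pz ?(le_trans zx)//.
exact: ltW (H _ _ pz zx xq zxd).
Qed.

Lemma real_acM p q f g : p <= q -> real_ac p q f -> real_ac p q g ->
  real_ac p q (fun x => f x * g x).
Proof.
move=> pq fac gac; have [M M0 fM] := real_ac_bounded pq fac.
have [M' M'0 gM] := real_ac_bounded pq gac.
move=> e e0; have e20 : 0 < e / 2 by rewrite divr_gt0.
have [d d0 H] := fac _ (divr_gt0 e20 M'0).
have [d' d'0 H'] := gac _ (divr_gt0 e20 M0).
exists (Num.min d d'); first by rewrite lt_min d0.
move=> I s t st; rewrite lt_min => /andP[sd sd'].
have := H _ _ _ st sd; rewrite ltr_pdivlMr// => h1.
have := H' _ _ _ st sd'; rewrite ltr_pdivlMr// => h2.
rewrite [e]splitr; apply: le_lt_trans (ltrD h1 h2).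
rewrite !mulr_suml -big_split/=; apply: ler_sum => i _.
have [ps sit tq] := st.1 i.
rewrite (_ : _ - _ = (f (t i) - f (s i)) * g (t i)
  + (g (t i) - g (s i)) * f (s i)); last ring.
by rewrite (le_trans (ler_normD _ _))// !normrM lerD// ler_wpM2l//
  ?gM ?fM// ?ps ?tq ?(le_trans sit)// (le_trans ps).
Qed.

(** The subintervals of all partitions [l i] form one interval family of the same total length,
    indexed by a sigma type, so a single use of the modulus [d] bounds the sum of the variations. *)
Lemma variation_family_lt p q f e d (I : finType) (s t : I -> R)
    (l : I -> seq R) :
  (forall (J : finType) (u v : J -> R), interval_family p q u v ->
    \sum_j (v j - u j) < d -> \sum_j `|f (v j) - f (u j)| < e) ->
  interval_family p q s t -> (forall i, itv_partition (s i) (t i) (l i)) ->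
  \sum_i (t i - s i) < d ->
  \sum_i variation (s i) (t i) f (l i) < e.
Proof.
move=> H [st stI] lP std.
pose J := {i : I & 'I_(size (l i))}.
pose pt i (j : nat) := nth (t i) (s i :: l i) j.
pose u (k : J) := pt (tag k) (tagged k).
pose v (k : J) := pt (tag k) (tagged k).+1.
have sumE (F : R -> R) : \sum_i \sum_(0 <= j < size (l i))
    (F (pt i j.+1) - F (pt i j)) = \sum_i (F (t i) - F (s i)).
  apply: eq_bigr => i _; rewrite telescope_sumr//; congr (F _ - _).
  exact: itv_partition_nth_size.
have -> : \sum_i variation (s i) (t i) f (l i) = \sum_(k : J) `|f (v k) - f (u k)|.
  under eq_bigr do rewrite /variation big_mkord.
  by rewrite (sig_big_dep xpredT (fun=> xpredT) (fun i (j : 'I_(size (l i))) =>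
    `|f (pt i j.+1) - f (pt i j)|)).
apply: H; last first.
  apply: le_lt_trans std; rewrite -(sumE id).
  under [leRHS]eq_bigr do rewrite big_mkord.
  by rewrite (sig_big_dep xpredT (fun=> xpredT) (fun i (j : 'I_(size (l i))) =>
    pt i j.+1 - pt i j)).
have pt_lt i (j k : nat) : (j < k)%N -> (k <= size (l i))%N -> pt i j < pt i k.
  move=> jk kl; rewrite /pt lt_sorted_ltn_nth ?inE/= ?ltnS//.
    by have [] := lP i.
  exact: leq_trans (ltnW jk) kl.
have pt_ge i (k : nat) : (k <= size (l i))%N -> s i <= pt i k.
  by move=> kl; apply: itv_partition_nth_ge.
have pt_le i (k : nat) : (k <= size (l i))%N -> pt i k <= t i.
  by move=> kl; apply: itv_partition_nth_le.
split=> [[i j]|[i j] [i' j'] _ _ [x]]; rewrite /u /v/=.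
  have [ps sit tq] := st i; split; first by rewrite (le_trans ps)// pt_ge// ltnW.
    by rewrite ltW// pt_lt.
  by rewrite (le_trans _ tq)// pt_le.
rewrite /= !in_itv/= => -[/andP[ux xv] /andP[ux' xv']].
have ii' : i = i'.
  have sub k (m : 'I_(size (l k))) : pt k m < x -> x < pt k m.+1 -> s k < x < t k.
    move=> mx xm; rewrite (le_lt_trans (pt_ge _ _ (ltnW (ltn_ord m))))//=.
    by rewrite (lt_le_trans xm)// pt_le.
  apply: stI => //; exists x; rewrite /= !in_itv/=.
  by split; [apply: (sub i j)|apply: (sub i' j')].
subst i'; congr existT; apply: val_inj => /=.
have [jj'|j'j|//] := ltngtP (val j) (val j').
- have : pt i j.+1 <= pt i j'.
    move: jj'; rewrite leq_eqVlt => /predU1P[->//|jj'].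
    by rewrite ltW// pt_lt// ltnW.
  by rewrite leNgt (lt_trans ux' xv).
- have : pt i j'.+1 <= pt i j.
    move: j'j; rewrite leq_eqVlt => /predU1P[->//|j'j].
    by rewrite ltW// pt_lt// ltnW.
  by rewrite leNgt (lt_trans ux xv').
Qed.

Lemma real_ac_bv p q f : p <= q -> real_ac p q f -> bounded_variation p q f.
Proof.
move=> pq fac; have [d d0 H] := fac _ ltr01.
have small x y : p <= x -> x <= y -> y <= q -> y - x < d ->
    bounded_variation x y f.
  move=> px xy yq xyd; exists 1 => _ [l lP <-]; apply: ltW.
  have := @variation_family_lt p q f 1 d 'I_1 (fun=> x) (fun=> y) (fun=> l) H.
  rewrite !big_ord1; apply => //; split => // i j _ _ _.
  by rewrite (ord1 i) (ord1 j).
suff bnd n x : p <= x <= q -> x - p < n%:R * (d / 2) -> bounded_variation p x f.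
  apply: (bnd (Num.bound ((q - p) / (d / 2)))); first by rewrite pq lexx.
  rewrite -ltr_pdivrMr ?divr_gt0//; apply: archi_boundP.
  by rewrite divr_ge0 ?subr_ge0// ltW// divr_gt0.
elim: n x => [|n ih] x /andP[px xq].
  by rewrite mul0r subr_lt0 ltNge px.
move=> xn; have [xd|xd] := ltP (x - p) d; first exact: small.
pose z := x - d / 2.
have pz : p <= z by rewrite /z; lra.
have zx : z <= x by rewrite /z; lra.
apply/bounded_variationP => //; rewrite (total_variationD _ pz zx) fin_numD.
apply/andP; split; apply/bounded_variationP => //.
  by apply: ih; rewrite ?pz ?(le_trans zx)// /z; rewrite -natr1 in xn; lra.
by apply: small => //; rewrite /z; lra.
Qed.

Definition variation_fun p f x : R := fine (total_variation p x f).

Lemma variation_funB p q f x y : p <= x -> x <= y -> y <= q ->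
  real_ac p q f ->
  (variation_fun p f y - variation_fun p f x)%:E = total_variation x y f.
Proof.
move=> px xy yq fac; have pq := le_trans px (le_trans xy yq).
have fin u v : p <= u -> u <= v -> v <= q -> total_variation u v f \is a fin_num.
  move=> pu uv vq; apply/bounded_variationP => //.
  by apply: real_ac_bv => //; apply: real_acS fac.
rewrite /variation_fun EFinB !fineK ?fin//; last 2 first.
- exact: le_trans xy yq.
- exact: le_trans px xy.
rewrite (total_variationD f px xy) addeAC subee ?add0e//.
by apply: fin => //; exact: le_trans xy yq.
Qed.

Lemma variation_fun_ge p q f x y : p <= x -> x <= y -> y <= q ->
  real_ac p q f -> `|f y - f x| <= variation_fun p f y - variation_fun p f x.
Proof.
move=> px xy yq fac; rewrite -lee_fin (variation_funB px xy yq fac).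
exact: total_variation_ge.
Qed.

(** Each increment of the variation function is nearly attained on a partition;
    [variation_family_lt] bounds all these partition sums with the modulus of [f] itself. *)
Lemma real_ac_variation_fun p q f : real_ac p q f ->
  real_ac p q (variation_fun p f).
Proof.
move=> fac e e0; have e20 : 0 < e / 2 by rewrite divr_gt0.
have [d d0 H] := fac _ e20; exists d => // I s t st std.
(* A slack of [e / 2 / n] per interval adds up to at most [e / 2]; the [+ 1] keeps [n] positive for
   an empty family. *)
have [sP _] := st; pose n : R := #|I|%:R + 1.
have n0 : 0 < n by rewrite ltr_wpDl.
have ex i : exists2 l, itv_partition (s i) (t i) l &
    `|variation_fun p f (t i) - variation_fun p f (s i)| <=
      variation (s i) (t i) f l + e / 2 / n.
  have [ps sit tq] := sP i.
  have VE := variation_funB ps sit tq fac.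
  have [|_ [_ [l lP <-] <-]] := @ub_ereal_sup_adherent _
    [set x%:E | x in variations (s i) (t i) f] _ (divr_gt0 e20 n0).
    by rewrite -/(total_variation (s i) (t i) f) -VE.
  rewrite -/(total_variation (s i) (t i) f) -VE -EFinB lte_fin.
  move=> lt; exists l => //; rewrite ger0_norm.
    by rewrite -lerBlDr ltW.
  by rewrite -lee_fin VE total_variation_ge0.
have /choice[l lP] : forall i, exists l, itv_partition (s i) (t i) l /\
    `|variation_fun p f (t i) - variation_fun p f (s i)| <=
      variation (s i) (t i) f l + e / 2 / n.
  by move=> i; have [l ? ?] := ex i; exists l.
apply: (@le_lt_trans _ _ (\sum_i (variation (s i) (t i) f (l i) + e / 2 / n))).
  by apply: ler_sum => i _; have [] := lP i.
rewrite big_split/= sumr_const [ltRHS]splitr ltr_leD//.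
  by apply: (variation_family_lt (H)) std => // i; have [] := lP i.
rewrite -[leLHS]mulr_natr -mulrA ger_pMr// mulrC ler_pdivrMr// mul1r.
by rewrite /n lerDl.
Qed.

End AbsoluteContinuity.

(** * Absolutely continuous functions as integrals of their derivatives *)

Section AbsolutelyContinuousDensity.
Context {R : realType}.
Notation mu := (@lebesgue_measure R).
Implicit Types (f g F : R -> R) (p q x y : R).

Lemma lebesgue_stieltjes_itvoc (G : cumulative R R) x y : x <= y ->
  lebesgue_stieltjes_measure G `]x, y] = (G y - G x)%:E.
Proof.
move=> xy; rewrite /lebesgue_stieltjes_measure /measure_extension/=.
by rewrite measurable_mu_extE/= ?wlength_itv_bnd//; exact: is_ocitv.
Qed.

(* Outer regularity reduces this to an open set of small measure, which is a
   disjoint union of open intervals. *)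
Lemma real_ac_dominates (G : cumulative R R) p q : p <= q -> real_ac p q G ->
  forall A, measurable A -> mu A = 0%E ->
    lebesgue_stieltjes_measure G (A `&` `]p, q[) = 0%E.
Proof.
move=> pq Gac A mA A0; pose nu := lebesgue_stieltjes_measure G.
apply/eqP; rewrite eq_le measure_ge0 andbT.
apply/lee_addgt0Pr => e e0; rewrite add0e.
have [d d0 H] := Gac _ e0.
have [|U [oU AU Ud]] := lebesgue_regularity_outer mA _ d0.
  by rewrite [X in (X < _)%E](_ : _ = 0%E).
pose U' := U `&` `]p, q[.
have oU' : open U' by apply: openI => //; exact: interval_open.
have mU : measurable U by exact: open_measurable.
have mU' : measurable U' by exact: open_measurable.
have U'd : (mu U' < d%:E)%E.
  apply: le_lt_trans Ud; rewrite -[leRHS]add0e -[X in (X + _)%E]A0.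
  rewrite [leLHS](_ : _ = mu ((U' `&` A) `|` (U' `\` A))); last first.
    by rewrite setUIDK.
  apply: (le_trans (measureU2 _ _ _)); [exact: measurableI|exact: measurableD|].
  apply: leeD; apply: le_measure; rewrite ?inE; do ?[exact: measurableI|
    exact: measurableD].
  - by [].
  - by apply: subIsetr.
  - by move=> x [[]].
pose I := open_disjoint_itv oU'.
have mI k : measurable (I k).
  by apply: open_measurable; exact: open_disjoint_itv_open.
have tI : trivIset setT I by exact: open_disjoint_itv_trivIset.
have UI : U' = \bigcup_k I k by exact: open_disjoint_itv_bigcup.
have IU k : I k `<=` `]p, q[.
  by move=> x Ix; have : U' x by [rewrite UI; exists k]; case.
have ex k : exists st : R * R,
    [/\ p <= st.1, st.1 <= st.2, st.2 <= q & I k = `]st.1, st.2[%classic].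
  have [Ik0|/set0P[z Iz]] := eqVneq (I k) set0.
    by exists (p, p); rewrite Ik0 set_itvoo0//.
  have lb : has_lbound (I k).
    by exists p => x /IU; rewrite /= in_itv/= => /andP[/ltW].
  have ub : has_ubound (I k).
    by exists q => x /IU; rewrite /= in_itv/= => /andP[_ /ltW].
  have iI : is_interval (I k) by exact: open_disjoint_itv_is_interval.
  have := interval_bounded_interior iI lb ub.
  rewrite (interior_id (I k)).1; last exact: open_disjoint_itv_open.
  move=> IE; exists (inf (I k), sup (I k)); split => /=.
  - apply: lb_le_inf; first by exists z.
    by move=> x /IU; rewrite /= in_itv/= => /andP[/ltW].
  - apply: (@le_trans _ _ z); first exact: ge_inf.
    exact: ub_le_sup.
  - apply: ge_sup; first by exists z.
    by move=> x /IU; rewrite /= in_itv/= => /andP[_ /ltW].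
  - by rewrite [LHS]IE; apply/seteqP; split => x /=; rewrite in_itv.
have {ex}/choice[st stP] := ex.
(* Absolute continuity speaks of finite families only, so the bound is proved for partial sums over
   the components of [U'] and passed to the limit. *)
have nuU' : (nu U' <= e%:E)%E.
  rewrite UI [leLHS](measure_bigcup (lebesgue_stieltjes_measure G) setT I (fun k _ => mI k) tI).
  apply: lime_le.
    by apply: is_cvg_nneseries => n _ _; exact: measure_ge0.
  near=> n; under eq_bigl do rewrite in_setT.
  apply: (@le_trans _ _ (\sum_(0 <= k < n) (G (st k).2 - G (st k).1)%:E)%E).
    apply: lee_sum => k _; have [ps st' tq Ik] := stP k.
    rewrite -lebesgue_stieltjes_itvoc// Ik le_measure ?inE//.
    by apply: subset_itvW.
  rewrite sumEFin lee_fin big_mkord.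
  have fam : interval_family p q (fun k : 'I_n => (st k).1) (fun k => (st k).2).
    split=> [k|i j _ _]; first by have [] := stP k.
    have [_ _ _ <-] := stP i; have [_ _ _ <-] := stP j.
    by move=> /(tI _ _ Logic.I Logic.I)/val_inj.
  have std : \sum_(k < n) ((st k).2 - (st k).1) < d.
    rewrite -lte_fin; apply: le_lt_trans U'd.
    rewrite UI [leRHS](measure_bigcup mu setT I (fun k _ => mI k) tI).
    apply: (le_trans _ (nneseries_lim_ge n (fun k _ _ => measure_ge0 mu (I k)))).
    rewrite big_mkord -sumEFin; under [leRHS]eq_bigl do rewrite in_setT.
    apply: lee_sum => k _; have [ps st' tq ->] := stP k.
    rewrite [leRHS]lebesgue_measure_itv/= lte_fin; case: ifPn => [//|].
    by rewrite -leNgt => ts; rewrite lee_fin subr_le0.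
  apply: (le_trans _ (ltW (H _ _ _ fam std))).
  by apply: ler_sum => k _; exact: ler_norm.
apply: le_trans nuU'; apply: le_measure; rewrite ?inE//.
  by apply: measurableI.
by move=> x [Ax px]; split => //; exact: AU.
Unshelve. all: by end_near. Qed.

(** Clamping the argument to [[p, q]] extends [f] by constants, which gives the Stieltjes
    construction a function on the whole line. Clamped intervals may collapse but stay disjoint. *)
Lemma real_ac_extend p q f : p <= q -> real_ac p q f ->
  forall p' q', real_ac p' q' (fun x => f (Num.max p (Num.min x q))).
Proof.
move=> pq fac p' q' e /fac[d d0 H]; exists d => // I s t [st tI] std.
pose c x := Num.max p (Num.min x q).
have cle x y : x <= y -> c x <= c y.
  by move=> xy; rewrite /c ge_max le_max lexx/= le_max le_min !ge_min xy !lexx/= !orbT.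
have cpq x : p <= c x <= q.
  by rewrite /c le_max lexx/= ge_max pq ge_min lexx orbT.
have cin x y z : c x < z -> z < c y -> x < z < y.
  have /andP[pcx _] := cpq x; have /andP[_ cyq] := cpq y.
  move=> xz zy; have zq := lt_le_trans zy cyq; have pz := le_lt_trans pcx xz.
  apply/andP; split.
    move: xz; rewrite /c gt_max gt_min => /andP[_ /orP[//|qz]].
    by move: (lt_trans zq qz); rewrite ltxx.
  move: zy; rewrite /c lt_max lt_min => /orP[zp|/andP[]//].
  by move: (lt_trans zp pz); rewrite ltxx.
apply: (H I (c \o s) (c \o t)) => [|/=].
  split=> [i/=|i j _ _ [x]].
    have [_ sit _] := st i; have /andP[? _] := cpq (s i).
    by have /andP[_ ?] := cpq (t i); split => //; exact: cle.
  rewrite /= !in_itv/= => -[/andP[s1 t1] /andP[s2 t2]]; apply: tI => //.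
  by exists x; rewrite /= !in_itv/= !cin.
apply: le_lt_trans std; apply: ler_sum => i _; have [_ sit _] := st i.
rewrite /c; case: (leP p (Num.min (t i) q)) => h1;
  case: (leP p (Num.min (s i) q)) => h2;
  move: h1 h2; case: (leP (t i) q) => h3; case: (leP (s i) q) => h4; lra.
Qed.

(** The density is the Radon-Nikodym derivative of the Stieltjes measure of the clamped [F], which
    Lebesgue measure dominates by [real_ac_dominates]. *)
Lemma nondecreasing_ac_density p q F : p <= q -> real_ac p q F ->
  (forall x y, p <= x -> x <= y -> y <= q -> F x <= F y) ->
  exists g, [/\ measurable_fun setT g, mu.-integrable setT (EFin \o g) &
    forall x, p <= x -> x <= q ->
      (F x - F p)%:E = (\int[mu]_(t in `]p, x]) (g t)%:E)%E].
Proof.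
move=> pq Fac Fnd; pose G0 x := F (Num.max p (Num.min x q)).
have G0ac : forall p' q', real_ac p' q' G0 by exact: real_ac_extend.
have G0E x : p <= x -> x <= q -> G0 x = F x.
  by move=> px xq; rewrite /G0 (min_idPl xq) (max_idPr px).
have G0nd : nondecreasing G0.
  move=> x y xy; apply: Fnd.
  - by rewrite le_max lexx.
  - by rewrite ge_max le_max lexx/= le_max le_min !ge_min xy !lexx/= !orbT.
  - by rewrite ge_max pq ge_min lexx orbT.
have G0rc : right_continuous G0.
  move=> x; apply/cvgrPdist_lt => e e0.
  have [d d0 H] := real_ac_modulus (G0ac x (x + 1)) e0.
  near=> y; rewrite distrC; apply: H => //.
    by near: y; apply: nbhs_right_le; rewrite ltrDl.
  by rewrite ltrBlDl; near: y; apply: nbhs_right_lt; rewrite ltrDl.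
pose G : cumulative R R := HB.pack G0 (isCumulative.Build R _ R G0 G0nd G0rc).
have Gac : real_ac (p - 1) (q + 1) G by exact: G0ac.
pose nu := lebesgue_stieltjes_measure G.
(* Restriction to a bounded interval makes the measure finite; the unit margins keep []p, x]] inside
   it even when [x = q]. *)
have mD : measurable (`]p - 1, q + 1[%classic : set R) by [].
have pq1 : p - 1 <= q + 1 by lra.
have finD : (nu `](p - 1)%R, (q + 1)%R[%classic < +oo)%E.
  apply: (@le_lt_trans _ _ (nu `](p - 1)%R, (q + 1)%R]%classic)%E).
    by apply: le_measure; rewrite ?inE//; exact: subset_itvW.
  by rewrite /nu lebesgue_stieltjes_itvoc ?ltry.
pose rho : {finite_measure set (measurableTypeR R) -> \bar R} :=
  mfrestr (f := lebesgue_stieltjes_measure G) mD finD.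
have dom : rho `<< mu.
  apply/null_content_dominatesP => A mA A0.
  by rewrite /rho/= /mfrestr /mrestr/=; exact: real_ac_dominates.
have [h [h0 hfin hint hE]] := radon_nikodym_sigma_finite dom.
have hg : EFin \o (fine \o h) = h by apply/funext => x /=; rewrite fineK.
exists (fine \o h); split.
- by apply/measurable_EFinP; rewrite hg; exact: measurable_int hint.
- by rewrite hg.
- move=> x px xq; rewrite -(G0E x)// -(G0E p)//.
  have := lebesgue_stieltjes_itvoc G px => <-.
  under eq_integral do rewrite fineK//.
  rewrite -hE// /rho/= /mfrestr/= /mrestr; congr (lebesgue_stieltjes_measure G _).
  apply/seteqP; split=> [y/=|y []//]; rewrite !in_itv/= => /andP[py yx].
  by rewrite py yx; split=> //; apply/andP; split; lra.
Unshelve. all: by end_near. Qed.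

(** [f] is the difference of the nondecreasing absolutely continuous functions [V] and [W = V - f],
    each of which has a density; Lebesgue differentiation identifies the difference of the densities
    with the derivative almost everywhere. *)
Lemma real_ac_density p q f : p < q -> real_ac p q f ->
  exists g, [/\ measurable_fun setT g, mu.-integrable setT (EFin \o g),
    forall x, p <= x -> x <= q -> f x - f p = \int[mu]_(t in `]p, x]) g t &
    {ae mu, forall x, p < x < q -> is_derive x 1 f (g x)}].
Proof.
move=> pq fac; pose V := variation_fun p f.
have Vac : real_ac p q V by exact: real_ac_variation_fun.
have VE x y (px : p <= x) (xy : x <= y) (yq : y <= q) :=
  variation_fun_ge px xy yq fac.
have Vnd x y : p <= x -> x <= y -> y <= q -> V x <= V y.
  move=> px xy yq; rewrite -subr_ge0; exact: le_trans (VE _ _ px xy yq).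
pose W x := V x - f x.
have Wac : real_ac p q W.
  apply: (real_ac_comparison (f := V) (k := 2)) Vac => x y px xy yq.
  have := VE _ _ px xy yq; have := Vnd _ _ px xy yq; rewrite /W -/V => h.
  rewrite [X in _ * X]ger0_norm ?subr_ge0// !ler_norml => /andP[h1 h2].
  by apply/andP; split; lra.
have Wnd x y : p <= x -> x <= y -> y <= q -> W x <= W y.
  move=> px xy yq; have := VE _ _ px xy yq; rewrite /W -/V ler_norml.
  by move=> /andP[_ ?]; lra.
have [g [mg ig gE]] := nondecreasing_ac_density (ltW pq) Vac Vnd.
have [h [mh ih hE]] := nondecreasing_ac_density (ltW pq) Wac Wnd.
have igh : mu.-integrable setT (EFin \o (g \- h)).
  rewrite (_ : EFin \o _ = (EFin \o g) \- (EFin \o h))%E; last first.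
    by apply/funext => x /=; rewrite EFinB.
  exact: integrableB.
have fE x : p <= x -> x <= q ->
    f x - f p = \int[mu]_(t in `]p, x]) (g \- h) t.
  move=> px xq; rewrite RintegralB//; try exact: integrableS ig;
    try exact: integrableS ih.
  by rewrite /Rintegral -gE// -hE//= /W; lra.
exists (g \- h); split => //; first exact: measurable_funB.
have loc : locally_integrable setT (g \- h).
  exact: open_integrable_locally openT igh.
have /(FTC1 (a := BRight p)) : forall y, mu.-integrable `]p, y] (EFin \o (g \- h)).
  by move=> y; apply: integrableS igh.
move=> /(_ loc); apply: (@filterS _ _ (ae_filter_ringOfSetsType mu)) => x H /andP[px xq].
have /H[] : (BRight p < BRight x)%O by rewrite bnd_simp.
set F := (fun y : R => \int[mu]_(t in `]p, y]) _) => dF FE.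
rewrite -FE.
have nE : \forall y \near x, F y + f p = f y.
  near=> y; rewrite /F -fE; [by rewrite subrK| |].
    by apply: ltW; near: y; exact: lt_nbhsr.
  by apply: ltW; near: y; exact: lt_nbhsl.
suff : is_derive x 1 (fun y => F y + f p) (derive1 F x).
  exact: near_eq_is_derive.
rewrite derive1E -[X in is_derive _ _ _ X]addr0; apply: is_deriveD.
by apply: DeriveDef.
Unshelve. all: by end_near. Qed.

End AbsolutelyContinuousDensity.

(** * Real integrals and square-integrable functions on an interval *)

(** The discriminant bound, which yields Cauchy-Schwarz both for [ip] and for the energy form. *)
Lemma nonneg_quadratic (R : realFieldType) (A B C : R) :
  (forall t, 0 <= A + 2 * t * B + t ^+ 2 * C) -> 0 <= A -> 0 <= C ->
  B ^+ 2 <= A * C.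
Proof.
move=> key A0 C0; have [C1|Cn] := ltP 0 C.
  have := key (- B / C); rewrite -(ler_pM2r C1) mul0r.
  rewrite (_ : (_ + _ + _) * C = A * C - B ^+ 2); last first.
    by field; rewrite gt_eqF.
  by rewrite subr_ge0.
have CE : C = 0 by apply/eqP; rewrite eq_le C0 Cn.
rewrite CE mulr0; have [->|B0] := eqVneq B 0; first by rewrite expr0n.
(* With [C = 0] the expression is affine in [t], and this [t] gives it the value -1. *)
have := key (- (A + 1) / (2 * B)); rewrite CE mulr0 addr0.
rewrite (_ : A + _ = -1); last by field.
by rewrite ler0N1.
Qed.

Section IntervalIntegrals.
Context {R : realType}.
Notation mu := (@lebesgue_measure R).
Implicit Types (f g h : R -> R) (p q x y : R).

Definition rint p q f : R := \int[mu]_(x in `]p, q[) f x.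

Definition rintegrable p q f : Prop := mu.-integrable `]p, q[ (EFin \o f).

Definition mfun p q f : Prop := measurable_fun (`]p, q[%classic : set R) f.

Lemma mfun_ext p q f g : (forall x, p < x < q -> f x = g x) ->
  mfun p q f -> mfun p q g.
Proof.
move=> fg; apply: eq_measurable_fun => x; rewrite inE/= in_itv/=; exact: fg.
Qed.

Lemma mfunD p q f g : mfun p q f -> mfun p q g -> mfun p q (fun x => f x + g x).
Proof. exact: measurable_funD. Qed.

Lemma mfunM p q f g : mfun p q f -> mfun p q g -> mfun p q (fun x => f x * g x).
Proof. exact: measurable_funM. Qed.

Lemma mfun_cst p q (c : R) : mfun p q (fun=> c).
Proof. exact: measurable_cst. Qed.

Lemma mfun_continuous p q f : (forall x, p < x < q -> {for x, continuous f}) ->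
  mfun p q f.
Proof.
move=> fc; apply: open_continuous_measurable_fun; first exact: interval_open.
by move=> x; rewrite inE/= in_itv/=; exact: fc.
Qed.

Lemma mfunS p q p' q' f : p <= p' -> q' <= q -> mfun p q f -> mfun p' q' f.
Proof.
move=> pp qq; apply: measurable_funS => // x /=; rewrite !in_itv/=.
by move=> /andP[px xq]; rewrite (le_lt_trans pp)//= (lt_le_trans xq).
Qed.

Lemma rintegrable_le p q f g : mfun p q f ->
  (forall x, p < x < q -> `|f x| <= g x) -> rintegrable p q g ->
  rintegrable p q f.
Proof.
move=> mf fg; apply: le_integrable => //; first exact/measurable_EFinP.
move=> x /=; rewrite in_itv/= => xpq.
by rewrite lee_fin (le_trans (fg _ xpq))// ler_norm.
Qed.

Lemma rintegrable_ext p q f g : (forall x, p < x < q -> f x = g x) ->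
  rintegrable p q f -> rintegrable p q g.
Proof.
move=> fg; apply: eq_integrable => // x; rewrite inE/= in_itv/= => xpq.
by rewrite fg.
Qed.

Lemma rintegrableS p q p' q' f : p <= p' -> q' <= q ->
  rintegrable p q f -> rintegrable p' q' f.
Proof.
move=> pp qq; apply: integrableS => // x /=; rewrite !in_itv/=.
by move=> /andP[px xq]; rewrite (le_lt_trans pp)//= (lt_le_trans xq).
Qed.

Lemma rintegrableD p q f g : rintegrable p q f -> rintegrable p q g ->
  rintegrable p q (fun x => f x + g x).
Proof.
move=> fi gi; rewrite /rintegrable.
rewrite (_ : EFin \o _ = (EFin \o f) \+ (EFin \o g))%E; last exact/funext.
exact: integrableD.
Qed.

Lemma rintegrableZ p q k f : rintegrable p q f ->
  rintegrable p q (fun x => k * f x).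
Proof. by move=> fi; apply: (integrableZl _ k fi). Qed.

Lemma rintegrable_norm p q f : rintegrable p q f ->
  rintegrable p q (fun x => `|f x|).
Proof. by move=> fi; apply: (integrable_norm fi). Qed.

Lemma rintegrable_cst p q c : rintegrable p q (fun=> c).
Proof.
apply/integrableP; split; first exact: measurable_cst.
rewrite /= integral_cst//= lebesgue_measure_itv/=.
by case: ifP => _; rewrite ?mule0 -?EFinB -?EFinM ltry.
Qed.

Lemma rintD p q f g : rintegrable p q f -> rintegrable p q g ->
  rint p q (fun x => f x + g x) = rint p q f + rint p q g.
Proof. by move=> fi gi; exact: RintegralD. Qed.

Lemma rintZ p q k f : rintegrable p q f ->
  rint p q (fun x => k * f x) = k * rint p q f.
Proof. by move=> fi; exact: RintegralZl. Qed.

Lemma rint_ge0 p q f : (forall x, p < x < q -> 0 <= f x) -> 0 <= rint p q f.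
Proof.
by move=> f0; apply: Rintegral_ge0 => x /=; rewrite in_itv/=; exact: f0.
Qed.

Lemma le_rint p q f g : rintegrable p q f -> rintegrable p q g ->
  (forall x, p < x < q -> f x <= g x) -> rint p q f <= rint p q g.
Proof.
move=> fi gi fg; apply: le_Rintegral => // x /=; rewrite in_itv/=; exact: fg.
Qed.

Lemma rint_ext p q f g : (forall x, p < x < q -> f x = g x) ->
  rint p q f = rint p q g.
Proof.
by move=> fg; apply: eq_Rintegral => x; rewrite inE/= in_itv/=; exact: fg.
Qed.

Lemma rint_cst p q c : p <= q -> rint p q (fun=> c) = c * (q - p).
Proof.
move=> pq; rewrite /rint Rintegral_cst//= lebesgue_measure_itv/= lte_fin.
by case: ltP => //= qp; congr (_ * _); lra.
Qed.

Lemma rint_empty p q f : q <= p -> rint p q f = 0.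
Proof.
by move=> qp; rewrite /rint set_itv_ge ?Rintegral_set0// bnd_simp -leNgt.
Qed.

Lemma rintegrable_ae p q f g : mfun p q g ->
  {ae mu, forall x, p < x < q -> f x = g x} ->
  rintegrable p q f -> rintegrable p q g /\ rint p q f = rint p q g.
Proof.
move=> mg fg /[dup] fi /integrableP[mf foo].
have fge : ae_eq mu `]p, q[%classic (EFin \o f) (EFin \o g).
  apply: (@filterS _ _ (ae_filter_ringOfSetsType mu)) fg => x fgx /=.
  by rewrite in_itv/= => /fgx ->.
have mg' : measurable_fun `]p, q[ (EFin \o g) by exact/measurable_EFinP.
split; last first.
  by rewrite /rint /Rintegral; congr fine; apply: ae_eq_integral mf mg' fge.
apply/integrableP; split => //; apply: le_lt_trans foo.
rewrite (@ge0_ae_eq_integral _ _ _ mu `]p, q[%classic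
  (abse \o (EFin \o g)) (abse \o (EFin \o f)))//.
- exact: measurableT_comp mg'.
- exact: measurableT_comp mf.
- by move=> x _; exact: abse_ge0.
- by move=> x _; exact: abse_ge0.
- by apply: (@filterS _ _ (ae_filter_ringOfSetsType mu)) fge => x fgx /= /fgx/= [->].
Qed.

Lemma rint_split p q x f : p <= x -> x <= q -> rintegrable p q f ->
  rint p q f = rint p x f + rint x q f.
Proof.
rewrite le_eqVlt => /predU1P[->|px]; first by rewrite (@rint_empty x x) ?add0r.
rewrite le_eqVlt => /predU1P[->|xq]; first by rewrite (@rint_empty q q) ?addr0.
move=> fi; have fxq : rintegrable x q f by exact: rintegrableS (ltW px) _ fi.
have fpx : rintegrable p x f by exact: rintegrableS _ (ltW xq) fi.
rewrite {1}/rint (@itv_bndbnd_setU _ _ _ (BLeft x)) ?bnd_simp ?ltW//.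
rewrite Rintegral_setU//=.
- by congr (_ + _); rewrite [RHS]/rint -Rintegral_itv_obnd_cbnd.
- by rewrite -itv_bndbnd_setU// bnd_simp ltW.
- apply/disj_set2P; rewrite -subset0 => z/=; rewrite !in_itv/=.
  by move=> [/andP[_ zx] /andP[]]; rewrite leNgt zx.
Qed.

Lemma rint_subset p q p' q' f : p <= p' -> p' <= q' -> q' <= q ->
  rintegrable p q f -> (forall x, p < x < q -> 0 <= f x) ->
  rint p' q' f <= rint p q f.
Proof.
move=> pp pq qq fi f0.
rewrite (rint_split pp (le_trans pq qq) fi).
rewrite (rint_split pq qq (rintegrableS pp (lexx q) fi)).
rewrite addrCA lerDl addr_ge0// rint_ge0// => x /andP[px xq]; apply: f0.
  by rewrite px (lt_le_trans xq)// (le_trans pq).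
by rewrite xq andbT (le_lt_trans _ px)// (le_trans pp).
Qed.

Definition l2 p q f : Prop := mfun p q f /\ rintegrable p q (fun x => f x ^+ 2).

Definition ip p q f g : R := rint p q (fun x => f x * g x).

Lemma l2_ip p q f g : l2 p q f -> l2 p q g ->
  rintegrable p q (fun x => f x * g x).
Proof.
move=> [mf fi] [mg gi]; apply: (rintegrable_le _ _ (rintegrableD fi gi)).
  exact: mfunM.
move=> x _; rewrite normrM -(real_normK (num_real (f x))).
rewrite -(real_normK (num_real (g x))).
by have := sqr_ge0 (`|f x| - `|g x|); nra.
Qed.

Lemma l2D p q f g : l2 p q f -> l2 p q g -> l2 p q (fun x => f x + g x).
Proof.
move=> f2 g2; have [mf fi] := f2; have [mg gi] := g2; split; first exact: mfunD.
apply: rintegrable_ext (rintegrableD (rintegrableD fi gi)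
  (rintegrableZ 2 (l2_ip f2 g2))) => x _ /=; ring.
Qed.

Lemma l2Z p q k f : l2 p q f -> l2 p q (fun x => k * f x).
Proof.
move=> [mf fi]; split; first by apply: mfunM => //; exact: mfun_cst.
by apply: rintegrable_ext (rintegrableZ (k ^+ 2) fi) => x _; rewrite exprMn.
Qed.

Lemma l2M p q k f c : mfun p q k -> (forall x, p < x < q -> `|k x| <= c) ->
  l2 p q f -> l2 p q (fun x => k x * f x).
Proof.
move=> mk kc [mf fi]; split; first exact: mfunM.
apply: (rintegrable_le _ _ (rintegrableZ (c ^+ 2) fi)).
  by rewrite /mfun; apply: measurable_funX; exact: mfunM.
move=> x /kc xc; rewrite ger0_norm ?sqr_ge0// exprMn ler_wpM2r ?sqr_ge0//.
by rewrite -(real_normK (num_real (k x))) lerXn2r// nnegrE (le_trans _ xc).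
Qed.

Lemma l2_ext p q f g : (forall x, p < x < q -> f x = g x) ->
  l2 p q f -> l2 p q g.
Proof.
move=> fg [mf fi]; split; first exact: mfun_ext mf.
by apply: rintegrable_ext fi => x /fg ->.
Qed.

Lemma l2_ae p q f g : mfun p q g ->
  {ae mu, forall x, p < x < q -> f x = g x} -> l2 p q f -> l2 p q g.
Proof.
move=> mg fg [mf fi]; split => //.
have [] := @rintegrable_ae p q (fun x => f x ^+ 2) (fun x => g x ^+ 2) _ _ fi => //.
  exact: measurable_funX.
by apply: (@filterS _ _ (ae_filter_ringOfSetsType mu)) fg => x fgx /fgx ->.
Qed.

Lemma l2S p q p' q' f : p <= p' -> q' <= q -> l2 p q f -> l2 p' q' f.
Proof.
by move=> pp qq [mf fi]; split; [exact: mfunS mf|exact: rintegrableS fi].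
Qed.

Lemma l2_bounded p q f c : mfun p q f -> (forall x, p < x < q -> `|f x| <= c) ->
  l2 p q f.
Proof.
move=> mf fc; split => //; apply: (rintegrable_le _ _ (rintegrable_cst _ _ (c ^+ 2))).
  exact: measurable_funX.
move=> x /fc xc; rewrite ger0_norm ?sqr_ge0//.
by rewrite -(real_normK (num_real (f x))) lerXn2r// nnegrE (le_trans _ xc).
Qed.

Lemma l2_cst p q c : l2 p q (fun=> c).
Proof. by apply: (l2_bounded (c := `|c|)) => //; exact: mfun_cst. Qed.

Lemma l2_rintegrable p q f : l2 p q f -> rintegrable p q f.
Proof.
move=> f2; apply: rintegrable_ext (l2_ip f2 (l2_cst p q 1)) => x _.
by rewrite mulr1.
Qed.

Lemma ipC p q f g : ip p q f g = ip p q g f.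
Proof. by apply: rint_ext => x _; rewrite mulrC. Qed.

Lemma ipDl p q f g h : l2 p q f -> l2 p q g -> l2 p q h ->
  ip p q (fun x => f x + g x) h = ip p q f h + ip p q g h.
Proof.
move=> f2 g2 h2; rewrite /ip -rintD; try exact: l2_ip.
by apply: rint_ext => x _; rewrite mulrDl.
Qed.

Lemma ipZl p q k f h : l2 p q f -> l2 p q h ->
  ip p q (fun x => k * f x) h = k * ip p q f h.
Proof.
move=> f2 h2; rewrite /ip -rintZ; last exact: l2_ip.
by apply: rint_ext => x _; rewrite mulrA.
Qed.

Lemma ip_ge0 p q f : 0 <= ip p q f f.
Proof. by apply: rint_ge0 => x _; rewrite -expr2 sqr_ge0. Qed.

Lemma ip_ae p q f g f' g' : l2 p q f -> l2 p q g -> mfun p q f' -> mfun p q g' ->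
  {ae mu, forall x, p < x < q -> f x = f' x} ->
  {ae mu, forall x, p < x < q -> g x = g' x} -> ip p q f g = ip p q f' g'.
Proof.
move=> f2 g2 mf' mg' ff' gg'.
have [] := @rintegrable_ae p q (fun x => f x * g x) (fun x => f' x * g' x) _ _
  (l2_ip f2 g2) => //; first exact: mfunM.
apply: (@filterS2 _ _ (ae_filter_ringOfSetsType mu)) ff' gg' => x fx gx xpq.
by rewrite fx ?gx.
Qed.

Lemma ip_cauchy_schwarz p q f g : l2 p q f -> l2 p q g ->
  ip p q f g ^+ 2 <= ip p q f f * ip p q g g.
Proof.
move=> f2 g2; have key t :
    0 <= ip p q f f + 2 * t * ip p q f g + t ^+ 2 * ip p q g g.
  have tg2 := l2Z t g2; have := ip_ge0 p q (fun x => f x + t * g x).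
  rewrite ipDl ?ipZl//; do ?exact: l2D.
  rewrite ![ip p q _ (fun x => _ + _)]ipC !ipDl// !ipZl// (ipC _ _ g f).
  by move=> h; apply: le_trans h _; rewrite le_eqVlt; apply/orP; left; apply/eqP; ring.
exact: (nonneg_quadratic key (ip_ge0 _ _ _) (ip_ge0 _ _ _)).
Qed.

End IntervalIntegrals.

(** * Primitives that are absolutely continuous up to the right endpoint *)

Section Primitives.
Context {R : realType}.
Notation mu := (@lebesgue_measure R).
Implicit Types (f g h : R -> R) (p q x y : R).

(** Nothing is asked at [p], where the weights degenerate: [f] may lack a limit there and [g] may
    fail to be integrable up to [p]. This matches the local absolute continuity on []p, q]] in the
    weighted spaces. *)
Definition primitive p q f g : Prop :=
  [/\ mfun p q g, forall c, p < c -> c <= q -> real_ac c q f &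
      {ae mu, forall x, p < x < q -> is_derive x 1 f (g x)}].

(** On [[x, y]] both [g] and the density supplied by [real_ac_density] are derivatives of [f] almost
    everywhere, hence they agree almost everywhere. *)
Lemma primitive_incr p q f g x y : primitive p q f g -> p < x -> x < y -> y <= q ->
  rintegrable x y g /\ f y - f x = rint x y g.
Proof.
move=> [mg fac dfg] px xy yq.
have fxy : real_ac x y f.
  by apply: real_acS (fac x px _) => //; exact: le_trans (ltW xy) yq.
have [h [mh ih fE dfh]] := real_ac_density xy fxy.
have hi : rintegrable x y h by apply: integrableS ih.
have gh : {ae mu, forall z, x < z < y -> h z = g z}.
  apply: (@filterS2 _ _ (ae_filter_ringOfSetsType mu)) dfg dfh.
  move=> z dg dh /[dup] zxy /dh{}dh.
  have /dg{}dg : p < z < q.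
    by case/andP: zxy => xz zy; rewrite (lt_trans px)//= (lt_le_trans zy).
  by rewrite -(@derive_val _ _ _ _ _ _ _ dg) -(@derive_val _ _ _ _ _ _ _ dh).
have [gi rE] := rintegrable_ae (mfunS (ltW px) yq mg) gh hi.
split => //; rewrite (fE y (ltW xy) (lexx y)) -rE /rint Rintegral_itv_bndo_bndc//.
Qed.

Lemma primitive_rint p q f g x y : primitive p q f g -> p < x -> x <= y ->
  y <= q -> f y - f x = rint x y g.
Proof.
move=> fg px; rewrite le_eqVlt => /predU1P[->|xy] yq.
  by rewrite subrr rint_empty.
by have [] := primitive_incr fg px xy yq.
Qed.

Lemma primitive_continuous p q f g x : primitive p q f g -> p < x -> x < q ->
  {for x, continuous f}.
Proof.
move=> [_ fac _] px xq.
pose c := (p + x) / 2; have pc : p < c by rewrite /c; lra.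
have cx : c < x by rewrite /c; lra.
have cac := fac c pc (ltW (lt_trans cx xq)).
apply/cvgrPdist_lt => e e0; have [d d0 H] := real_ac_modulus cac e0.
near=> y; have cy : c < y by near: y; exact: lt_nbhsr.
have yq : y < q by near: y; exact: lt_nbhsl.
have : `|x - y| < d by near: y; exact: cvgr_dist_lt.
rewrite ltr_norml => /andP[h1 h2].
have [xy|yx] := leP x y.
  by rewrite distrC; apply: H; [exact: ltW|by []|exact: ltW|lra].
by apply: H; [exact: ltW|exact: ltW|exact: ltW|lra].
Unshelve. all: by end_near. Qed.

Lemma primitive_mfun p q f g : primitive p q f g -> mfun p q f.
Proof.
move=> fg; apply: mfun_continuous => x /andP[px xq].
exact: primitive_continuous fg px xq.
Qed.

Lemma primitiveS p q p' q' f g : p <= p' -> q' <= q -> primitive p q f g ->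
  primitive p' q' f g.
Proof.
move=> pp qq [mg fac dfg]; split; first exact: mfunS mg.
  move=> c pc cq; apply: real_acS (fac c (le_lt_trans pp pc) (le_trans cq qq)) => //.
apply: (@filterS _ _ (ae_filter_ringOfSetsType mu)) dfg => x H /andP[px xq].
by apply: H; rewrite (le_lt_trans pp)//= (lt_le_trans xq).
Qed.

Lemma primitiveD p q f g f' g' : primitive p q f g -> primitive p q f' g' ->
  primitive p q (fun x => f x + f' x) (fun x => g x + g' x).
Proof.
move=> [mg fac dfg] [mg' fac' dfg']; split; first exact: mfunD.
  by move=> c pc cq; apply: real_acD; [exact: fac|exact: fac'].
apply: (@filterS2 _ _ (ae_filter_ringOfSetsType mu)) dfg dfg'.
by move=> x H H' /[dup] /H{}H /H'{}H'; exact: is_deriveD.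
Qed.

Lemma primitive_cst p q c : primitive p q (fun=> c) (fun=> 0).
Proof.
split; first exact: mfun_cst.
  move=> d _ _; apply: (real_ac_lipschitz (k := 0)) => x y _ _ _.
  by rewrite subrr normr0 mul0r.
by apply: aeW => x _; exact: is_derive_cst.
Qed.

Lemma primitiveM p q f g f' g' : primitive p q f g -> primitive p q f' g' ->
  primitive p q (fun x => f x * f' x) (fun x => g x * f' x + f x * g' x).
Proof.
move=> fg fg'; have mf := primitive_mfun fg; have mf' := primitive_mfun fg'.
have [mg fac dfg] := fg; have [mg' fac' dfg'] := fg'; split.
- by apply: mfunD; exact: mfunM.
- by move=> c pc cq; apply: real_acM => //; [exact: fac|exact: fac'].
- apply: (@filterS2 _ _ (ae_filter_ringOfSetsType mu)) dfg dfg'.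
  move=> x H H' /[dup] /H{}H /H'{}H'.
  have -> : g x * f' x + f x * g' x = f x *: g' x + f' x *: g x.
    by rewrite /GRing.scale/= addrC [X in _ + X]mulrC.
  exact: is_deriveM.
Qed.

Lemma primitiveZ p q k f g : primitive p q f g ->
  primitive p q (fun x => k * f x) (fun x => k * g x).
Proof.
move=> [mg fac dfg]; split; first by apply: mfunM => //; exact: mfun_cst.
  by move=> c pc cq; apply: real_acZ; exact: fac.
apply: (@filterS _ _ (ae_filter_ringOfSetsType mu)) dfg => x H /H{}H.
exact: is_deriveZ.
Qed.

Lemma primitive_ae p q f g f' g' : mfun p q g' ->
  (forall x, p < x <= q -> f x = f' x) ->
  {ae mu, forall x, p < x < q -> g x = g' x} ->
  primitive p q f g -> primitive p q f' g'.
Proof.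
move=> mg' ff' gg' [mg fac dfg]; split => // [c pc cq|].
  apply: (real_ac_comparison (k := 1)) (fac c pc cq) => x y cx xy yq.
  by rewrite mul1r !ff' ?(lt_le_trans pc)//= ?(le_trans xy)// (le_trans cx).
apply: (@filterS2 _ _ (ae_filter_ringOfSetsType mu)) gg' dfg => x gx H.
move=> /[dup] /gx{}gx /[dup] /andP[px xq] /H; rewrite gx.
apply: near_eq_is_derive; near=> y; apply: ff'.
apply/andP; split; first by near: y; exact: lt_nbhsr.
by apply: ltW; near: y; exact: lt_nbhsl.
Unshelve. all: by end_near. Qed.

Lemma primitive_ext p q f g f' g' :
  (forall x, p < x <= q -> f x = f' x) -> (forall x, p < x < q -> g x = g' x) ->
  primitive p q f g -> primitive p q f' g'.
Proof.
move=> ff' gg' fg; have [mg _ _] := fg.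
by apply: primitive_ae fg => //; [exact: mfun_ext mg|exact: aeW].
Qed.

Lemma primitive_C1 p q f g : mfun p q g ->
  (forall x, p < x -> is_derive x 1 f (g x)) ->
  (forall c, p < c -> exists k, forall x, c <= x -> x <= q -> `|g x| <= k) ->
  primitive p q f g.
Proof.
move=> mg dfg bg; split => //; last by apply: aeW => x /andP[px _]; exact: dfg.
move=> c pc cq; have [k gk] := bg c pc.
apply: (real_ac_lipschitz (k := k)) => x y cx xy yq.
have [| |z zxy ->] := @MVT_segment _ f g x y xy.
- move=> z; rewrite in_itv/= => /andP[xz _]; apply: dfg.
  by rewrite (lt_trans pc)// (le_lt_trans cx).
- apply: derivable_within_continuous => z; rewrite in_itv/= => /andP[xz _].
  have pz : p < z by rewrite (lt_le_trans pc)// (le_trans cx).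
  exact: (@ex_derive _ _ _ _ _ _ _ (dfg z pz)).
- rewrite normrM (ger0_norm (_ : 0 <= y - x)) ?subr_ge0// ler_wpM2r ?subr_ge0//.
  move: zxy; rewrite in_itv/= => /andP[xz zy].
  by apply: gk; [exact: le_trans cx xz|exact: le_trans zy yq].
Qed.

Lemma rint_cvg0 p q g : p < q -> rintegrable p q g ->
  rint p y g @[y --> p^'+] --> 0.
Proof.
move=> pq gi; apply/cvgrPdist_lt => e e0.
pose g' x := if (p < x) && (x < q) then g x else 0.
have gg' x : p < x < q -> g x = g' x by rewrite /g' => ->.
have g'i : mu.-integrable `[p, q] (EFin \o g').
  have gi' : mu.-integrable `]p, q[ (EFin \o g') by exact: rintegrable_ext gi.
  have -> : EFin \o g' = ((EFin \o g') \_ `]p, q[)%E.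
    apply/funext => x; rewrite patchE; case: ifPn => //.
    by rewrite notin_setE/= in_itv/= /g' => /negP/negbTE ->.
  apply: (integrableS measurableT) => //.
  have mi : measurable (`]p, q[%classic : set (measurableTypeR R)) by [].
  have /= [H _] := @integrable_mkcond _ _ _ mu _ (EFin \o g') mi.
  exact: H gi'.
have := parameterized_integral_near_left pq e0 g'i.
move=> H; near=> y; rewrite sub0r normrN.
have py : p < y by near: y; exact: nbhs_right_gt.
have yq : y < q by near: y; exact: nbhs_right_lt.
have : p <= y -> `|\int[mu]_(t in `[p, y]) g' t| < e.
  near: y; rewrite near_withinE.
  by apply: filterS H => z Hz _; exact: Hz.
move=> /(_ (ltW py)); rewrite -Rintegral_itv_obnd_cbnd; last first.
  apply: integrableS g'i => // z /=; rewrite !in_itv/=.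
  by move=> /andP[/ltW-> /le_trans->]//; exact: ltW.
rewrite -Rintegral_itv_bndo_bndc; last first.
  apply: integrableS g'i => // z /=; rewrite !in_itv/= => /andP[/ltW-> zy]/=.
  by rewrite ltW// (lt_trans zy).
rewrite -/(rint p y g') (@rint_ext _ p y g g')// => x /andP[px xy].
by apply: gg'; rewrite px (lt_trans xy).
Unshelve. all: by end_near. Qed.

Lemma primitive_cvg p q f g : p < q -> primitive p q f g -> rintegrable p q g ->
  f y @[y --> p^'+] --> f q - rint p q g.
Proof.
move=> pq fg gi.
have : (f q - rint p q g) + rint p y g @[y --> p^'+] --> (f q - rint p q g) + 0.
  by apply: cvgD; [exact: cvg_cst|exact: rint_cvg0 gi].
rewrite addr0; apply: cvg_trans; apply: near_eq_cvg; near=> y.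
have py : p < y by near: y; exact: nbhs_right_gt.
have yq : y <= q by near: y; exact: nbhs_right_le.
rewrite -[f y](subKr (f q)) (primitive_rint fg py yq (lexx q)).
by rewrite (rint_split (ltW py) yq gi); ring.
Unshelve. all: by end_near. Qed.

(** Monotone convergence along [[p + 1 / (n + 1), q[], where the integral of [g] is an increment of
    [f] and so at most [|f q| + c]. *)
Lemma primitive_rintegrable p q f g (c : R) : p < q -> primitive p q f g ->
  (forall x, p < x < q -> 0 <= g x) -> (forall x, p < x < q -> `|f x| <= c) ->
  rintegrable p q g.
Proof.
move=> pq fg g0 fc; have [mg _ _] := fg.
apply/integrableP; split; first exact/measurable_EFinP.
have -> : (\int[mu]_(x in `]p, q[) `|(EFin \o g) x| =
    \int[mu]_(x in `]p, q[) (g x)%:E)%E.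
  apply: eq_integral => x; rewrite inE/= in_itv/= => xpq.
  by rewrite ger0_norm// g0.
rewrite itv_open_bnd_bigcup.
have sub n x : `[p + n.+1%:R^-1, q[%classic x -> p < x < q.
  rewrite /= in_itv/= => /andP[px ->]; rewrite andbT (lt_le_trans _ px)//.
  by rewrite ltrDl invr_gt0.
pose F n : set R := `[p + n.+1%:R^-1, q[%classic.
have cv : (\int[mu]_(x in F n) (g x)%:E @[n --> \oo] -->
    \int[mu]_(x in \bigcup_n F n) (g x)%:E)%E.
  apply: ge0_nondecreasing_set_cvg_integral.
  - move=> n m nm; apply/subsetPset => x; rewrite /F/= !in_itv/= => /andP[px ->].
    rewrite andbT (le_trans _ px)// lerD2l lef_pV2 ?posrE// ler_nat ltnS//.
  - by move=> n; exact: measurable_itv.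
  - move=> n; apply/measurable_EFinP; apply: measurable_funS mg => //.
    by move=> x /sub; rewrite /= in_itv.
  - by move=> n x /sub/g0; rewrite lee_fin.
rewrite -(cvg_lim _ cv)//; apply: (@le_lt_trans _ _ (`|f q| + c)%:E); last exact: ltry.
apply: lime_le; first by apply/cvg_ex; eexists; exact: cv.
near=> n; pose x := p + n.+1%:R^-1.
have px : p < x by rewrite /x ltrDl invr_gt0.
have xq : x < q.
  rewrite /x -ltrBrDl; near: n.
  have q0 : 0 < q - p by rewrite subr_gt0.
  exact: near_infty_natSinv_lt (PosNum q0).
pose x' := (p + x) / 2.
have px' : p < x' by rewrite /x'; lra.
have x'x : x' < x by rewrite /x'; lra.
have [gi _] := primitive_incr fg px' (lt_trans x'x xq) (lexx q).
have gi' : mu.-integrable `[x, q[ (EFin \o g).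
  apply: integrableS gi => //; move=> z /=; rewrite !in_itv/= => /andP[xz ->].
  by rewrite (lt_le_trans x'x).
rewrite -[leLHS]fineK; last exact: integrable_fin_num gi'.
rewrite -/(Rintegral mu `[x, q[ g) -Rintegral_itv_obnd_cbnd; last first.
  by apply: rintegrableS gi => //; exact: ltW.
rewrite -/(rint x q g) -(primitive_rint fg px (ltW xq) (lexx q)) lee_fin.
have := fc x; rewrite px xq => /(_ isT); have := ler_norm (f q).
rewrite ler_norml => h /andP[h1 h2]; lra.
Unshelve. all: by end_near. Qed.

End Primitives.

(** * Power weights *)

Section PowerWeights.
Context {R : realType}.
Notation mu := (@lebesgue_measure R).
Implicit Types (f g h : R -> R) (p q x y s : R).

(* Otherwise |f| / (x - p) >= c / (x - p) near p, whose integral over the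
   upper half of ]p, y[ is at least c / 2, whatever y. *)
Lemma cvg_quotient_integrable p q f l : p < q -> f x @[x --> p^'+] --> l ->
  rintegrable p q (fun x => f x / (x - p)) -> l = 0.
Proof.
move=> pq fl fi; apply/eqP; apply: contraT => l0.
have {}l0 : 0 < `|l| by rewrite normr_gt0.
have hi := rintegrable_norm fi; have h0 := rint_cvg0 pq hi.
have l80 : 0 < `|l| / 8 by rewrite divr_gt0.
have l20 : 0 < `|l| / 2 by rewrite divr_gt0.
have fl' : \forall x \near p^'+, `|l - f x| < `|l| / 2 by exact: cvgr_dist_lt.
have [d /= d0 fd] := fl'.
pose h x := `|f x / (x - p)|.
move/cvgrPdist_lt: h0 => /(_ _ l80) h0.
near p^'+ => y.
have py : p < y by near: y; exact: nbhs_right_gt.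
have yq : y < q by near: y; exact: nbhs_right_lt.
have yd : y < p + d by near: y; apply: nbhs_right_lt; rewrite ltrDl.
have hy : `|0 - rint p y h| < `|l| / 8.
  by near: y.
have yp : 0 < y - p by rewrite subr_gt0.
pose c := (p + y) / 2.
have pc : p <= c by rewrite /c; lra.
have cy : c <= y by rewrite /c; lra.
have hiy : rintegrable p y h by apply: rintegrableS hi; [|exact: ltW].
have lb : rint c y (fun=> `|l| / 2 / (y - p)) <= rint c y h.
  apply: le_rint; [exact: rintegrable_cst|exact: rintegrableS hiy|].
  move=> x /andP[cx xy]; have px : p < x by exact: le_lt_trans pc cx.
  have xp : 0 < x - p by rewrite subr_gt0.
  rewrite /h normrM normfV (gtr0_norm xp).
  apply: (@le_trans _ _ (`|l| / 2 / (x - p))).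
    by rewrite ler_wpM2l ?(ltW l20)// lef_pV2 ?posrE// lerD2r ltW.
  rewrite ler_wpM2r ?invr_ge0 ?(ltW xp)//.
  have : `|l - f x| < `|l| / 2.
    by apply: fd => //=; rewrite ltr0_norm ?subr_lt0// opprB; lra.
  have := ler_normD (l - f x) (f x); rewrite subrK => h1 h2; lra.
have := rint_subset pc cy (lexx y) hiy (fun x _ => normr_ge0 _).
move: lb; rewrite rint_cst// => lb ub.
have : `|l| / 2 / (y - p) * (y - c) = `|l| / 4.
  by rewrite /c; field; rewrite gt_eqF.
move: hy; rewrite sub0r normrN => hy; have := ler_norm (rint p y h).
move: lb ub hy; rewrite /h => lb ub hy h1 h2; lra.
Unshelve. all: by end_near. Qed.

(** Integrability of [g] gives [f] a limit at [p], and integrability of [f / (x - p)] forces that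
    limit to be 0. Boundary terms at degenerate endpoints vanish in this way without any pointwise
    information there. *)
Lemma primitive_zero p q f g : p < q -> primitive p q f g ->
  rintegrable p q g -> rintegrable p q (fun x => f x / (x - p)) ->
  f q = rint p q g.
Proof.
move=> pq fg gi fi; have cv := primitive_cvg pq fg gi.
by apply/eqP; rewrite -subr_eq0; apply/eqP; exact: cvg_quotient_integrable cv fi.
Qed.

Definition pw p s x : R := (x - p) `^ s.

Lemma pw_gt0 p s x : p < x -> 0 < pw p s x.
Proof. by move=> px; apply: powR_gt0; rewrite subr_gt0. Qed.

Lemma pwD p s t x : p < x -> pw p (s + t) x = pw p s x * pw p t x.
Proof. by move=> px; rewrite /pw powRD// (gt_eqF (_ : 0 < x - p)) ?subr_gt0 ?implybT. Qed.

Lemma pw0 p x : pw p 0 x = 1.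
Proof. by rewrite /pw powRr0. Qed.

Lemma pw1 p x : p < x -> pw p 1 x = x - p.
Proof. by move=> px; rewrite /pw powRr1// subr_ge0 ltW. Qed.

Lemma pw_sqr p s x : p < x -> pw p s x ^+ 2 = pw p (s * 2) x.
Proof. by move=> px; rewrite expr2 -pwD//; congr pw; ring. Qed.

Lemma le_pw p s x y : 0 <= s -> p < x -> x <= y -> pw p s x <= pw p s y.
Proof.
move=> s0 px xy; apply: ge0_ler_powR => //; rewrite ?nnegrE ?subr_ge0 ?lerD2r//.
  exact: ltW.
exact: le_trans (ltW px) xy.
Qed.

Lemma pwN p s x : p < x -> pw p (- s) x = (pw p s x)^-1.
Proof. by move=> px; rewrite /pw powRN. Qed.

Lemma ge_pw p s x y : s <= 0 -> p < x -> x <= y -> pw p s y <= pw p s x.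
Proof.
move=> s0 px xy; have py := lt_le_trans px xy; rewrite -[s]opprK !(pwN (- s))//.
by rewrite lef_pV2 ?posrE ?pw_gt0// le_pw// oppr_ge0.
Qed.

Lemma pw_bounded p q s x : 0 <= s -> p < x < q -> `|pw p s x| <= pw p s q.
Proof.
move=> s0 /andP[px xq]; rewrite gtr0_norm ?pw_gt0//.
by apply: le_pw => //; exact: ltW.
Qed.

Lemma is_derive_pw p s x : p < x ->
  is_derive x 1 (pw p s) (s * pw p (s - 1) x).
Proof.
move=> px; have xp : 0 < x - p by rewrite subr_gt0.
have H := @is_derive1_powR R s _ xp.
have G : is_derive x 1 (fun y : R => y - p) (1 - 0).
  exact: is_deriveB.
have := @is_derive1_comp R (fun y => y `^ s) (fun y => y - p) x _ _ H G.
by rewrite subr0 mulr1.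
Qed.

Lemma pw_continuous p s x : p < x -> {for x, continuous (pw p s)}.
Proof.
move=> px; apply: differentiable_continuous; apply/derivable1_diffP.
exact: (@ex_derive _ _ _ _ _ _ _ (is_derive_pw s px)).
Qed.

Lemma mfun_pw p q s : mfun p q (pw p s).
Proof. by apply: mfun_continuous => x /andP[px _]; exact: pw_continuous. Qed.

Lemma primitive_pw p q s :
  primitive p q (pw p s) (fun x => s * pw p (s - 1) x).
Proof.
apply: primitive_C1.
- by apply: mfunM; [exact: mfun_cst|exact: mfun_pw].
- by move=> x px; exact: is_derive_pw.
- move=> c pc; exists (`|s| * (pw p (s - 1) c + pw p (s - 1) q)) => x cx xq.
  have px : p < x by exact: lt_le_trans pc cx.
  rewrite normrM ler_wpM2l// gtr0_norm ?pw_gt0//.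
  have [s1|s1] := leP 0 (s - 1).
    by rewrite (le_trans (le_pw s1 px xq))// lerDr ltW// pw_gt0.
  rewrite (le_trans (ge_pw (ltW s1) pc cx))// lerDl ltW// pw_gt0//.
  exact: lt_le_trans px xq.
Qed.

Lemma rintegrable_pw p q s : p < q -> -1 < s -> rintegrable p q (pw p s).
Proof.
move=> pq s1; have s10 : 0 < s + 1 by lra.
have fg := primitive_pw p q (s + 1).
have := @primitive_rintegrable R p q _ _ (pw p (s + 1) q) pq fg.
have -> : s + 1 - 1 = s by ring.
move=> H; have {}H : rintegrable p q (fun x => (s + 1) * pw p s x).
  apply: H => x xpq; last by apply: pw_bounded => //; exact: ltW.
  by rewrite mulr_ge0 ?(ltW s10)// ltW// pw_gt0//; case/andP: xpq.
apply: rintegrable_ext (rintegrableZ (s + 1)^-1 H) => x _ /=.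
by rewrite mulKf// gt_eqF.
Qed.

Lemma rint_pw p q s : p < q -> -1 < s ->
  rint p q (pw p s) = pw p (s + 1) q / (s + 1).
Proof.
move=> pq s1; have s10 : 0 < s + 1 by lra.
have fg := primitive_pw p q (s + 1).
rewrite (primitive_zero pq fg).
- have -> : s + 1 - 1 = s by ring.
  rewrite rintZ; last exact: rintegrable_pw.
  by rewrite [RHS]mulrC mulKf ?gt_eqF.
- have -> : s + 1 - 1 = s by ring.
  by apply: rintegrableZ; exact: rintegrable_pw.
- apply: rintegrable_ext (rintegrable_pw pq s1) => x /andP[px _].
  by rewrite pwD// pw1// mulfK// subr_eq0 gt_eqF.
Qed.

Lemma l2_pw p q s : p < q -> - 2^-1 < s -> l2 p q (pw p s).
Proof.
move=> pq s1; split; first exact: mfun_pw.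
apply: rintegrable_ext (@rintegrable_pw p q (s * 2) pq _).
  by move=> x /andP[px _]; rewrite pw_sqr.
by lra.
Qed.

End PowerWeights.

(** * Integral identities for degenerate weights *)

Section DegenerateIdentities.
Context {R : realType}.
Notation mu := (@lebesgue_measure R).
Implicit Types (f g h P v w : R -> R) (p q x y s m : R).

Definition pwM p s f x : R := pw p s x * f x.

(** With [s = 1 - m / 2] and [g = pwM p (m / 2) h] this is the integral of [(x - p) f h], the weight
    being split so that both factors are in L^2. *)
Definition wip p q s f g : R := ip p q (pwM p s f) g.

Lemma l2_pwM p q s f : 0 <= s -> l2 p q f -> l2 p q (pwM p s f).
Proof. by move=> s0; apply: l2M; [exact: mfun_pw|move=> x; exact: pw_bounded]. Qed.

Lemma pwMM p s t f x : p < x -> pwM p s (pwM p t f) x = pwM p (s + t) f x.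
Proof. by move=> px; rewrite /pwM mulrA -pwD. Qed.

Lemma pwM0 p f : pwM p 0 f = f.
Proof. by apply/funext => x; rewrite /pwM pw0 mul1r. Qed.

Lemma l2_pwM_inv p q s f : p < q -> 0 <= s -> l2 p q (pwM p (- s) f) -> l2 p q f.
Proof.
move=> pq s0 /(l2_pwM s0); apply: l2_ext => x /andP[px _].
by rewrite pwMM// subrr pwM0.
Qed.

(** Integrates the derivative of [(x - p) v^2]. The boundary term at [p] vanishes by
    [primitive_zero], because dividing by [x - p] gives the integrable [v^2]; the one at [q] has
    weight 1 because the interval has length 1. *)
Lemma kinetic_rellich p q m v dv : q = p + 1 -> m <= 2 ->
  primitive p q v dv -> l2 p q v -> l2 p q (pwM p (m / 2) dv) ->
  wip p q (1 - m / 2) v (pwM p (m / 2) dv) = v q ^+ 2 / 2 - ip p q v v / 2.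
Proof.
move=> qE m2 vdv v2 dv2; have pq : p < q by lra.
have m20 : 0 <= 1 - m / 2 by lra.
have i1 := l2_ip v2 v2; have i2 := l2_ip (l2_pwM m20 v2) dv2.
have pr := primitiveM (primitiveM vdv vdv) (primitive_pw p q 1).
pose g x := v x * v x + 2 * (pwM p (1 - m / 2) v x * pwM p (m / 2) dv x).
have gE x : p < x < q -> (dv x * v x + v x * dv x) * pw p 1 x +
    v x * v x * (1 * pw p (1 - 1) x) = g x.
  move=> /andP[px _]; rewrite /g /pwM subrr pw0.
  have -> : pw p 1 x = pw p (1 - m / 2) x * pw p (m / 2) x.
    by rewrite -pwD//; congr pw; ring.
  ring.
have gi : rintegrable p q g by apply: rintegrableD => //; exact: rintegrableZ.
have := primitive_zero pq (primitive_ext (fun x _ => erefl) gE pr) gi.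
rewrite {1}/g rintD ?rintZ//; last exact: rintegrableZ.
rewrite -/(wip _ _ _ _ _) -/(ip _ _ _ _) /pw.
have -> : (q - p) `^ 1 = 1 by rewrite qE (_ : p + 1 - p = 1) ?powR1//; ring.
rewrite mulr1 => H; rewrite expr2 H; first by rewrite /wip /ip; lra.
apply: rintegrable_ext i1 => x /andP[px _].
by rewrite powRr1 ?mulfK ?subr_eq0 ?gt_eqF// subr_ge0 ltW.
Qed.

(** Integrates the derivative of [(x - p)^(1 - m) P^2]; for a flux [P = (x - p)^m u'] the left side
    is the multiplier integral of [(x - p) u' P']. Dividing by [x - p] gives the integrable
    [(x - p)^(- m) P^2], so [primitive_zero] applies even when [m > 1] and the weight blows up at
    [p]. *)
Lemma potential_rellich p q m P dP : q = p + 1 -> m <= 2 ->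
  primitive p q P dP -> l2 p q dP -> l2 p q (pwM p (- (m / 2)) P) ->
  wip p q (1 - m / 2) dP (pwM p (- (m / 2)) P) =
    P q ^+ 2 / 2 - (1 - m) / 2
      * ip p q (pwM p (- (m / 2)) P) (pwM p (- (m / 2)) P).
Proof.
move=> qE m2 PdP dP2 P2; have pq : p < q by lra.
have m20 : 0 <= 1 - m / 2 by lra.
have i1 := l2_ip P2 P2; have i2 := l2_ip (l2_pwM m20 dP2) P2.
have pr := primitiveM (primitiveM PdP PdP) (primitive_pw p q (1 - m)).
pose g x := (1 - m) * (pwM p (- (m / 2)) P x * pwM p (- (m / 2)) P x)
  + 2 * (pwM p (1 - m / 2) dP x * pwM p (- (m / 2)) P x).
have gE x : p < x < q -> (dP x * P x + P x * dP x) * pw p (1 - m) x +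
    P x * P x * ((1 - m) * pw p (1 - m - 1) x) = g x.
  move=> /andP[px _]; rewrite /g /pwM.
  have -> : pw p (1 - m) x = pw p (1 - m / 2) x * pw p (- (m / 2)) x.
    by rewrite -pwD//; congr pw; field.
  have -> : pw p (1 - m - 1) x = pw p (- (m / 2)) x * pw p (- (m / 2)) x.
    by rewrite -pwD//; congr pw; field.
  ring.
have gi : rintegrable p q g by apply: rintegrableD; exact: rintegrableZ.
have := primitive_zero pq (primitive_ext (fun x _ => erefl) gE pr) gi.
rewrite {1}/g rintD ?rintZ//; do ?exact: rintegrableZ.
rewrite -/(wip _ _ _ _ _) -/(ip _ _ _ _).
have -> : pw p (1 - m) q = 1 by rewrite /pw qE (_ : p + 1 - p = 1) ?powR1//; ring.
rewrite mulr1 => H; rewrite expr2 H; first by rewrite /wip /ip; lra.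
apply: rintegrable_ext i1 => x /andP[px _].
have xp : x - p != 0 by rewrite subr_eq0 gt_eqF.
rewrite (_ : 1 - m = - (m / 2) + - (m / 2) + 1); last by field.
rewrite !pwD// pw1// /pwM; field; exact: xp.
Qed.

(** The derivative of [P v] is integrable, so the product has a limit at [p]. Only the product is
    claimed to converge: under strong degeneracy [v] alone may have no trace. *)
Lemma green_cvg p q m P dP v dv : p < q -> primitive p q P dP ->
  primitive p q v dv -> l2 p q dP -> l2 p q v ->
  l2 p q (pwM p (- (m / 2)) P) -> l2 p q (pwM p (m / 2) dv) ->
  P y * v y @[y --> p^'+] --> P q * v q - (ip p q dP v +
    ip p q (pwM p (- (m / 2)) P) (pwM p (m / 2) dv)).
Proof.
move=> pq PdP vdv dP2 v2 P2 dv2.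
have i1 := l2_ip dP2 v2; have i2 := l2_ip P2 dv2.
have pr := primitiveM PdP vdv.
have gE x : p < x < q -> dP x * v x + P x * dv x =
    dP x * v x + pwM p (- (m / 2)) P x * pwM p (m / 2) dv x.
  move=> /andP[px _]; rewrite /pwM mulrACA -pwD// addNr pw0; ring.
have := primitive_cvg pq (primitive_ext (fun x _ => erefl) gE pr)
  (rintegrableD i1 i2).
by rewrite rintD.
Qed.

Lemma green_traces p q m P dP v dv (P0 v0 : R) : p < q -> primitive p q P dP ->
  primitive p q v dv -> l2 p q dP -> l2 p q v ->
  l2 p q (pwM p (- (m / 2)) P) -> l2 p q (pwM p (m / 2) dv) ->
  P y @[y --> p^'+] --> P0 -> v y @[y --> p^'+] --> v0 ->
  ip p q dP v + ip p q (pwM p (- (m / 2)) P) (pwM p (m / 2) dv) =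
    P q * v q - P0 * v0.
Proof.
move=> pq PdP vdv dP2 v2 P2 dv2 PP0 vv0.
have H := green_cvg pq PdP vdv dP2 v2 P2 dv2.
have H' : P y * v y @[y --> p^'+] --> P0 * v0 by exact: cvgM.
have -> : P0 * v0 = P q * v q - (ip p q dP v +
  ip p q (pwM p (- (m / 2)) P) (pwM p (m / 2) dv)) by exact: (cvg_unique _ H' H).
by ring.
Qed.

(* P tends to 0 at p because P^2 / (x - p) is integrable, hence
   P^2 <= C (x - p) and (P v)^2 / (x - p) is integrable. *)
Lemma green_strong p q m P dP v dv : p < q -> 1 <= m ->
  primitive p q P dP ->
  primitive p q v dv -> l2 p q dP -> l2 p q v ->
  l2 p q (pwM p (- (m / 2)) P) -> l2 p q (pwM p (m / 2) dv) ->
  ip p q dP v + ip p q (pwM p (- (m / 2)) P) (pwM p (m / 2) dv) = P q * v q.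
Proof.
move=> pq m1 PdP vdv dP2 v2 P2 dv2.
have H := green_cvg pq PdP vdv dP2 v2 P2 dv2.
suff L0 : P q * v q - (ip p q dP v +
    ip p q (pwM p (- (m / 2)) P) (pwM p (m / 2) dv)) = 0 by lra.
move: (_ - _) H => L H.
have mP := primitive_mfun PdP; have mv := primitive_mfun vdv.
have dPi := l2_rintegrable dP2; have PL := primitive_cvg pq PdP dPi.
have m12 : 0 <= m - 1 by lra.
have minv : mfun p q (fun x => (x - p)^-1).
  have := @mfun_pw R p q (- 1); apply: mfun_ext => x /andP[px _].
  by rewrite pwN ?pw1.
have P0 : P q - rint p q dP = 0.
  apply/eqP; rewrite -[_ == 0]sqrf_eq0; apply/eqP.
  apply: (cvg_quotient_integrable (f := fun x => P x * P x)) pq _ _.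
    exact: cvgM.
  apply: (@rintegrable_le _ _ _ _ (fun x => pw p (m - 1) q * pwM p (- (m / 2)) P x ^+ 2)).
  - by apply: mfunM => //; exact: mfunM.
  - move=> x /[dup] xpq /andP[px xq]; have xp : 0 < x - p by rewrite subr_gt0.
    rewrite -expr2 normrM ger0_norm ?sqr_ge0// normfV gtr0_norm//.
    rewrite (_ : P x ^+ 2 / (x - p) = pw p (m - 1) x * pwM p (- (m / 2)) P x ^+ 2).
      by rewrite ler_wpM2r ?sqr_ge0// le_pw// ltW.
    rewrite /pwM exprMn pw_sqr// mulrA -pwD//.
    have -> : m - 1 + - (m / 2) * 2 = - 1 by field.
    by rewrite pwN// pw1// mulrC.
  - by apply: rintegrableZ; have [] := P2.
pose A := ip p q dP dP.
have PA x : p < x -> x < q -> P x ^+ 2 <= A * (x - p).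
  move=> px xq; have dPx := l2S (lexx p) (ltW xq) dP2.
  have -> : P x = ip p x dP (fun=> 1).
    have -> : ip p x dP (fun=> 1) = rint p x dP.
      by apply: rint_ext => y _; rewrite mulr1.
    have := primitive_rint PdP px (ltW xq) (lexx q).
    have := rint_split (ltW px) (ltW xq) dPi; lra.
  apply: le_trans (ip_cauchy_schwarz dPx (l2_cst p x 1)) _.
  rewrite [X in _ * X](_ : _ = x - p); last first.
    by rewrite /ip mulr1 rint_cst ?mul1r// ltW.
  rewrite ler_wpM2r ?subr_ge0 ?(ltW px)//.
  apply: rint_subset => //; [exact: ltW|exact: ltW|exact: (l2_ip dP2 dP2)|].
  by move=> y _; rewrite -expr2 sqr_ge0.
apply/eqP; rewrite -[_ == 0]sqrf_eq0; apply/eqP.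
apply: (cvg_quotient_integrable (f := fun x => (P x * v x) * (P x * v x))) pq _ _.
  exact: cvgM.
apply: (@rintegrable_le _ _ _ _ (fun x => A * v x ^+ 2)).
- by apply: mfunM => //; apply: mfunM; exact: mfunM.
- move=> x /andP[px xq]; have xp : 0 < x - p by rewrite subr_gt0.
  rewrite -expr2 normrM ger0_norm ?sqr_ge0// normfV gtr0_norm//.
  rewrite ler_pdivrMr// exprMn [leRHS]mulrAC ler_wpM2r ?sqr_ge0//; exact: PA.
- by apply: rintegrableZ; have [] := v2.
Qed.

(** [df] is the product of [(x - p)^(- (m / 2))], square integrable exactly because [m < 1], and of
    the weighted derivative. *)
Lemma weak_rintegrable p q m f df : p < q -> m < 1 -> primitive p q f df ->
  l2 p q (pwM p (m / 2) df) -> rintegrable p q df.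
Proof.
move=> pq m1 fdf df2; have s : - 2^-1 < - (m / 2) by lra.
apply: rintegrable_ext (l2_ip (l2_pw pq s) df2) => x /andP[px _].
by rewrite /pwM mulrA -pwD// addNr pw0 mul1r.
Qed.

Lemma weak_cvg p q m f df : p < q -> m < 1 -> primitive p q f df ->
  l2 p q (pwM p (m / 2) df) -> f y @[y --> p^'+] --> f q - rint p q df.
Proof.
move=> pq m1 fdf df2; apply: primitive_cvg => //.
exact: weak_rintegrable pq m1 fdf df2.
Qed.

Lemma weak_rint p q m f df (f0 : R) : p < q -> m < 1 -> primitive p q f df ->
  l2 p q (pwM p (m / 2) df) -> f y @[y --> p^'+] --> f0 ->
  forall y, p < y -> y <= q -> f y - f0 = rint p y df.
Proof.
move=> pq m1 fdf df2 ff0 y py yq.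
have fdfy := primitiveS (lexx p) yq fdf; have df2y := l2S (lexx p) yq df2.
have -> : f0 = f y - rint p y df.
  exact: (cvg_unique _ ff0 (weak_cvg py m1 fdfy df2y)).
by rewrite subKr.
Qed.

(** Cauchy-Schwarz on []p, y[], where [(x - p)^(- m)] has integral [(y - p)^(1 - m) / (1 - m)]. This
    is the origin of the exponent [1 - mua]. *)
Lemma weighted_increment p q m f df (f0 : R) : q = p + 1 -> 0 <= m < 1 ->
  primitive p q f df ->
  l2 p q (pwM p (m / 2) df) -> f y @[y --> p^'+] --> f0 ->
  forall y, p < y -> y <= q -> (f y - f0) ^+ 2 <=
    pw p (1 - m) y / (1 - m) * ip p q (pwM p (m / 2) df) (pwM p (m / 2) df).
Proof.
move=> qE /andP[m0 m1] fdf df2 ff0 y py yq; have pq : p < q by lra.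
have s : - 2^-1 < - (m / 2) by lra.
have df2y := l2S (lexx p) yq df2.
rewrite (weak_rint pq m1 fdf df2 ff0)//.
have -> : rint p y df = ip p y (pw p (- (m / 2))) (pwM p (m / 2) df).
  apply: rint_ext => x /andP[px _].
  by rewrite /pwM mulrA -pwD// addNr pw0 mul1r.
apply: le_trans (ip_cauchy_schwarz (l2_pw py s) df2y) _.
have -> : ip p y (pw p (- (m / 2))) (pw p (- (m / 2))) = pw p (1 - m) y / (1 - m).
  have -> : 1 - m = - m + 1 by ring.
  rewrite -rint_pw//; last by lra.
  apply: rint_ext => x /andP[px _].
  by rewrite -pwD//; congr pw; field.
rewrite ler_wpM2l ?divr_ge0 ?(ltW (pw_gt0 _ py)) ?subr_ge0 ?(ltW m1)//.
apply: rint_subset => //; [exact: ltW|exact: l2_ip|].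
by move=> x _; rewrite -expr2 sqr_ge0.
Qed.

(** Averages [f0^2 <= 2 f^2 + 2 (f - f0)^2] over []p, p + h[]: the average of [f^2] costs [1 / h],
    and [weighted_increment] bounds the second term by a multiple of [h^(1 - m)]. *)
Lemma trace_bound p q m f df (f0 h : R) : q = p + 1 -> 0 <= m < 1 -> 0 < h <= 1 ->
  primitive p q f df -> l2 p q f ->
  l2 p q (pwM p (m / 2) df) -> f y @[y --> p^'+] --> f0 ->
  f0 ^+ 2 <= 2 / h * ip p q f f +
    2 * (h `^ (1 - m) / (1 - m)) * ip p q (pwM p (m / 2) df) (pwM p (m / 2) df).
Proof.
move=> qE m01 /andP[h0 h1] fdf f2 df2 ff0; have pq : p < q by lra.
have /andP[m0 m1] := m01.
have inc := weighted_increment qE m01 fdf df2 ff0.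
move: (ip p q (pwM _ _ _) (pwM _ _ _)) inc (ip_ge0 p q (pwM p (m / 2) df)).
move=> A inc A0; pose y := p + h.
have py : p < y by rewrite /y; lra.
have yq : y <= q by rewrite /y; lra.
pose B := h `^ (1 - m) / (1 - m) * A.
have bnd x : p < x < y -> f0 ^+ 2 <= 2 * f x ^+ 2 + 2 * B.
  move=> /andP[px xy]; have := inc x px (ltW (lt_le_trans xy yq)).
  have : pw p (1 - m) x / (1 - m) * A <= B.
    rewrite ler_wpM2r// ler_wpM2r ?invr_ge0 ?subr_ge0 ?(ltW m1)//.
    have := @le_pw R p (1 - m) x y _ px (ltW xy).
    by rewrite {2}/pw (_ : y - p = h); [apply; lra|rewrite /y; ring].
  (* This square is exactly [2 f^2 + 2 (f - f0)^2 - f0^2]. *)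
  by have := sqr_ge0 (2 * f x - f0); nra.
have f2y := l2S (lexx p) yq f2.
have := le_rint (rintegrable_cst p y _)
  (rintegrableD (rintegrableZ 2 f2y.2) (rintegrable_cst p y (2 * B))) bnd.
rewrite rintD ?rintZ//; do ?[exact: rintegrableZ f2y.2|exact: rintegrable_cst|exact: f2y.2].
rewrite !rint_cst ?(ltW py)// (_ : y - p = h); last by rewrite /y; ring.
have : rint p y (fun x => f x ^+ 2) <= ip p q f f.
  have -> : ip p q f f = rint p q (fun x => f x ^+ 2) by exact: rint_ext.
  apply: rint_subset => //; [exact: ltW|exact: f2.2|].
  by move=> x _; rewrite sqr_ge0.
move=> le1 le2; rewrite -(ler_pM2r h0) (_ : (_ + _) * h = 2 * ip p q f f + 2 * B * h).
  by rewrite expr2 /B; lra.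
by rewrite /B; field; rewrite !gt_eqF ?subr_gt0.
Qed.

(** A Hardy-type inequality valid up to [m < 2], hence without a trace at [p]. The increment from
    [x] to [q] is bounded pointwise by [B x], of order [(x - p)^(- (m / 2))], which is integrable
    over the whole range of [m]. *)
Lemma degenerate_l2_bound p q m f df : q = p + 1 -> 0 <= m < 2 ->
  primitive p q f df -> l2 p q f -> l2 p q (pwM p (m / 2) df) ->
  ip p q f f <= 2 * f q ^+ 2 +
    2 / (1 - m / 2) ^+ 2 * ip p q (pwM p (m / 2) df) (pwM p (m / 2) df).
Proof.
move=> qE /andP[m0 m2] fdf f2 df2; have pq : p < q by lra.
set A := ip p q (pwM _ _ _) _.
have m20 : 0 < 1 - m / 2 by lra.
have s1 : -1 < - (m / 2) by lra.
have rpw : rint p q (pw p (- (m / 2))) = (1 - m / 2)^-1.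
  rewrite rint_pw// {1}/pw (_ : q - p = 1) ?powR1 ?div1r; last by rewrite qE; ring.
  by congr (_^-1); ring.
have ipw : rintegrable p q (pw p (- (m / 2))) by exact: rintegrable_pw.
pose B x := pw p (- (m / 2)) x / (1 - m / 2) * A.
have A0 : 0 <= A by exact: ip_ge0.
have inc x : p < x < q -> (f q - f x) ^+ 2 <= B x.
  move=> /andP[px xq]; rewrite (primitive_rint fdf px (ltW xq) (lexx q)).
  have df2x := l2S (ltW px) (lexx q) df2.
  have px2 : l2 x q (pw p (- (m / 2))).
    apply: (l2_bounded (c := pw p (- (m / 2)) x)).
      by apply: mfunS (@mfun_pw R p q _) => //; exact: ltW.
    move=> y /andP[xy yq]; rewrite gtr0_norm ?pw_gt0 ?(lt_trans px)//.
    by apply: ge_pw (ltW xy) => //; rewrite oppr_le0 divr_ge0.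
  have -> : rint x q df = ip x q (pw p (- (m / 2))) (pwM p (m / 2) df).
    apply: rint_ext => y /andP[xy _].
    by rewrite /pwM mulrA -pwD ?(lt_trans px)// addNr pw0 mul1r.
  apply: le_trans (ip_cauchy_schwarz px2 df2x) _; apply: ler_pM.
  - exact: ip_ge0.
  - exact: ip_ge0.
  - have ipwx : rintegrable x q (pw p (- (m / 2))) by exact: rintegrableS (ltW px) _ ipw.
    (* One of the two half powers is frozen at its largest value, at [x]; the other stays integrable
       up to [p]. Each of the two integrations gives one factor [1 / (1 - m / 2)]. *)
    apply: (@le_trans _ _ (rint x q (fun y => pw p (- (m / 2)) x * pw p (- (m / 2)) y))).
      apply: le_rint; [exact: l2_ip|exact: rintegrableZ|].
      move=> y /andP[xy yq]; have py := lt_trans px xy.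
      rewrite ler_wpM2r ?(ltW (pw_gt0 _ py))//.
      by apply: ge_pw (ltW xy) => //; rewrite oppr_le0 divr_ge0.
    rewrite rintZ// ler_wpM2l ?(ltW (pw_gt0 _ px))// -rpw.
    apply: rint_subset => //; [exact: ltW|exact: ltW|].
    by move=> y /andP[py _]; rewrite ltW// pw_gt0.
  - apply: rint_subset => //; [exact: ltW|exact: ltW|exact: l2_ip|].
    by move=> y _; rewrite -expr2 sqr_ge0.
have iB : rintegrable p q B.
  apply: rintegrable_ext (rintegrableZ (A / (1 - m / 2)) ipw) => x _.
  by rewrite /B; ring.
have : ip p q f f <= rint p q (fun x => 2 * f q ^+ 2 + 2 * B x).
  apply: le_rint; [exact: l2_ip|
    by apply: rintegrableD; [exact: rintegrable_cst|exact: rintegrableZ]|].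
  move=> x /inc; have := sqr_ge0 (2 * f q - f x); nra.
rewrite rintD; [|exact: rintegrable_cst|exact: rintegrableZ].
rewrite (rint_cst _ (ltW pq)) rintZ// (_ : q - p = 1); last by rewrite qE; ring.
have -> : rint p q B = A / (1 - m / 2) * rint p q (pw p (- (m / 2))).
  by rewrite -rintZ//; apply: rint_ext => x _; rewrite /B; ring.
rewrite rpw.
rewrite mulr1 => /le_trans; apply; rewrite le_eqVlt; apply/orP; left; apply/eqP.
by field; rewrite gt_eqF//; lra.
Qed.

End DegenerateIdentities.

(** * Measurability of the pointwise derivative *)

Section DerivativeMeasurable.
Context {R : realType}.
Implicit Types (f : R -> R) (p q x : R).

Let linear_near f (k : nat) (c r x : R) : Prop :=
  `|f (x + r) - f x - c * r| <= `|r| * k.+1%:R^-1.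

(* Differentiability at a point of continuity is tested on rational increments
   and rational slopes; f may be arbitrary outside ]p, q[. *)
Let derivable_rational p q f x : (forall x, p < x < q -> {for x, continuous f}) ->
  p < x < q ->
  derivable f x 1 <-> (forall k : nat, exists c : rat, exists n : nat,
    forall r : rat, `|ratr r| < n.+1%:R^-1 :> R -> p < x + ratr r < q ->
    linear_near f k (ratr c) (ratr r) x).
Proof.
move=> fc /andP[px xq]; split.
  move=> df k; pose e : R := k.+1%:R^-1; have e0 : 0 < e by rewrite invr_gt0.
  have e20 : 0 < e / 2 by exact: divr_gt0.
  move/cvg_ex: df => [l] /cvgrPdist_lt /(_ _ e20)[d /= d0 Hd].
  have [c] := @rat_in_itvoo R (l - e / 2) (l + e / 2) ltac:(lra).
  rewrite in_itv/= => /andP[lc cl]; exists c.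
  have [n nd] : exists n : nat, n.+1%:R^-1 < d.
    exists (Num.bound d^-1); rewrite invf_plt ?posrE//.
    apply: lt_trans (archi_boundP _) _; first by rewrite invr_ge0 ltW.
    by rewrite ltr_nat.
  exists n => r rn _; rewrite /linear_near.
  have [->|r0] := eqVneq (ratr r : R) 0.
    by rewrite addr0 mulr0 subrr subr0 normr0 mul0r.
  have := Hd (ratr r); rewrite /= sub0r normrN => /(_ (lt_trans rn nd) r0).
  rewrite [_%:A]mulr1 (addrC _ x) => H.
  rewrite (_ : _ - _ - _ = ratr r *
    ((ratr r)^-1 *: (f (x + ratr r) - f x) - ratr c)); last first.
    by rewrite /GRing.scale/= mulrBr mulVKf// [ratr c * _]mulrC.
  rewrite normrM ler_wpM2l// -/e.
  move: H; rewrite ltr_norml => /andP[h1 h2].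
  by rewrite ler_norml; apply/andP; split; lra.
move=> H; apply/cauchy_cvgP; apply: cauchy_exP => e e0.
have [k ke] : exists k : nat, k.+1%:R^-1 < e.
  exists (Num.bound e^-1); rewrite invf_plt ?posrE//.
  apply: lt_trans (archi_boundP _) _; first by rewrite invr_ge0 ltW.
  by rewrite ltr_nat.
have [c [n Hcn]] := H k; exists (ratr c).
have hn0 : \forall h \near (0 : R)^', h != 0.
  by apply: (@withinT _ (nbhs (0 : R)) (fun h => h != 0)); exact: nbhs_filter.
suff : \forall h \near (0 : R)^', ball (ratr c : R) e
  (h^-1 *: ((f \o shift x) (h *: 1) - f x)) by [].
near=> h.
have h0 : h != 0 by near: h.
have hn : `|h| < n.+1%:R^-1.
  near: h; apply: dnbhs0_lt; by rewrite invr_gt0.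
have hpx : `|h| < x - p by near: h; apply: dnbhs0_lt; rewrite subr_gt0.
have hqx : `|h| < q - x by near: h; apply: dnbhs0_lt; rewrite subr_gt0.
have pxh : p < x + h < q.
  by move: hpx hqx; rewrite !ltr_norml => /andP[? ?] /andP[? ?]; apply/andP; split; lra.
suff lin : linear_near f k (ratr c) h x.
  rewrite /ball/= [_%:A]mulr1 (addrC h x).
  rewrite (_ : _ - _ = - (h^-1 * (f (x + h) - f x - ratr c * h))); last first.
    by rewrite /GRing.scale/=; field.
  rewrite normrN normrM normfV mulrC ltr_pdivrMr ?normr_gt0//.
  apply: le_lt_trans lin _.
  by rewrite [ltRHS]mulrC ltr_pM2l ?normr_gt0.
rewrite /linear_near leNgt; apply/negP => lt.
pose g t := `|f (x + t) - f x - ratr c * t| - `|t| * k.+1%:R^-1.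
have gc : g t @[t --> h] --> g h.
  have fct : f (x + t) @[t --> h] --> f (x + h).
    apply: (@cvg_comp _ _ _ (fun t => x + t) f _ (nbhs (x + h))); last exact: fc.
    by apply: cvgD; [exact: cvg_cst|exact: cvg_id].
  apply: cvgB; last by apply: cvgMl; apply: cvg_norm; exact: cvg_id.
  apply: cvg_norm; apply: cvgB; last by apply: cvgMr; exact: cvg_id.
  by apply: cvgB => //; exact: cvg_cst.
have g0 : 0 < g h by rewrite /g subr_gt0.
have nb : \forall t \near h, [/\ 0 < g t, `|t| < n.+1%:R^-1 & p < x + t < q].
  have n1 : \forall t \near h, 0 < g t by exact: (cvgr_gt _ gc _ g0).
  have n2 : \forall t \near h, `|t| < n.+1%:R^-1.
    have nc : `|t| @[t --> h] --> `|h| by apply: cvg_norm; exact: cvg_id.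
    exact: (cvgr_lt _ nc _ hn).
  have n3 : \forall t \near h, p < x + t < q.
    have := @near_in_itvoo R p q (x + h).
    rewrite in_itv/= => /(_ pxh) nI.
    have cv : x + t @[t --> h] --> x + h.
      by apply: cvgD; [exact: cvg_cst|exact: cvg_id].
    have n4 : \forall t \near h, x + t \in `]p, q[ by exact: cv _ nI.
    near=> t; have : x + t \in `]p, q[ by near: t.
    by rewrite in_itv.
  by near=> t; split; near: t.
have [y [yint [r _ ry]]] := @dense_rat R
    (interior [set t | [/\ 0 < g t, `|t| < n.+1%:R^-1 & p < x + t < q]])
  (ex_intro _ h nb) (open_interior _).
rewrite -ry in yint; have [g0r rn rpq] := interior_subset yint.
have := Hcn r rn rpq; rewrite /linear_near => le1.
by move: g0r; rewrite /g subr_gt0 ltNge le1.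
Unshelve. all: by end_near. Qed.

(** The set [D] of points of differentiability is measurable by the rational test; on it the
    derivative is the limit of the quotients with increments [1 / (n + 1)]. Extending [f] by 0 makes
    all translates globally measurable. *)
Lemma mfun_derive1 p q f : (forall x, p < x < q -> {for x, continuous f}) ->
  mfun p q (derive1 f).
Proof.
move=> fc; have mf : mfun p q f by exact: mfun_continuous.
pose I : set R := `]p, q[%classic.
have mI : measurable I by exact: measurable_itv.
pose F : R -> R := f \_ I.
have mF : measurable_fun setT F by exact: (iffLR (measurable_restrictT f mI) mf).
have FE x : p < x < q -> F x = f x.
  by move=> xpq; rewrite /F patchE mem_set//= in_itv.
have mFr (r : R) : measurable_fun setT (fun x => F (x + r)).
  apply: (measurableT_comp mF); exact: measurable_funD.
pose S k (c r : rat) : set R := [set x | linear_near F k (ratr c) (ratr r) x].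
have mS k c r : measurable (S k c r).
  rewrite /S /linear_near.
  rewrite -[X in measurable X]setTI; apply: measurable_fun_le => //.
  apply: measurableT_comp => //; apply: measurable_funB => //.
  by apply: measurable_funB => //; exact: mFr.
pose A k c n : set R := ~` \bigcup_(r in [set: rat])
  ([set x | `|ratr r| < n.+1%:R^-1 :> R /\ p < x + ratr r < q] `&` ~` S k c r).
have mA k c n : measurable (A k c n).
  apply: measurableC; apply: bigcupT_measurable_rat => r.
  apply: measurableI; last exact: measurableC.
  have [rn|rn] := pselect (`|ratr r| < n.+1%:R^-1 :> R); last first.
    by rewrite (_ : [set x | _] = set0)//; apply/seteqP; split => // x [].
  rewrite (_ : [set x | _] = `]p - ratr r, q - ratr r[%classic); first exact: measurable_itv.
  apply/seteqP; split => x /=; rewrite in_itv/= ltrBlDr ltrBrDr; first by case.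
  by move=> ->.
pose D : set R := I `&` \bigcap_k \bigcup_(c in [set: rat]) \bigcup_n A k c n.
have mD : measurable D.
  apply: measurableI => //; apply: bigcapT_measurable => k.
  by apply: bigcupT_measurable_rat => c; apply: bigcupT_measurable => n.
have DE x : p < x < q -> derivable f x 1 <-> D x.
  move=> xpq; rewrite (derivable_rational fc xpq); split.
    move=> H; split; first by rewrite /I/= in_itv.
    move=> k _; have [c [n Hc]] := H k; exists c => //; exists n => //.
    move=> [r _ [[rn xr]]]; apply; rewrite /S/= /linear_near !FE//.
    exact: Hc.
  move=> [_ H] k; have [c _ [n _ Ax]] := H k Logic.I; exists c, n => r rn xr.
  apply: contrapT => nlin; apply: Ax; exists r => //; split => //.
  by rewrite /S/= /linear_near !FE.
have ID : I = D `|` (I `\` D).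
  apply/seteqP; split => x; last by case=> [[]|[]].
  by move=> Ix; have [Dx|nD] := pselect (D x); [left|right].
rewrite /mfun -/I ID; apply/measurable_funU => //; first exact: measurableD.
split.
  pose g (n : nat) x := n.+1%:R * (F (x + n.+1%:R^-1) - F x).
  apply: (@measurable_fun_cvg _ _ _ _ g).
    move=> n; apply: measurable_funTS; apply: measurable_funM => //.
    by apply: measurable_funB => //; exact: mFr.
  move=> x /[dup] Dx [Ix _]; move: Ix; rewrite /I/= in_itv/= => xpq.
  have /cvg_ex[l dfl] := (DE x xpq).2 Dx.
  have -> : derive1 f x = l.
    rewrite derive1E; apply: cvg_lim => //.
  have /andP[px xq] := xpq.
  have : ((fun h => h^-1 *: ((f \o shift x) (h *: 1) - f x)) \o
      (fun n : nat => n.+1%:R^-1)) @ \oo --> l.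
    apply: cvg_comp dfl.
    move=> B [d /= d0 Bd]; near=> n; apply: Bd => /=; last by rewrite invr_eq0.
    rewrite sub0r normrN ger0_norm ?invr_ge0//.
    by near: n; exact: near_infty_natSinv_lt (PosNum d0).
  apply: cvg_trans; apply: near_eq_cvg; near=> n.
  rewrite /g /= invrK [_%:A]mulr1 (addrC _ x) !FE//.
  apply/andP; split; first by rewrite (lt_trans px)// ltrDl invr_gt0.
  rewrite -ltrBrDl; near: n.
  have q0 : 0 < q - x by rewrite subr_gt0.
  exact: near_infty_natSinv_lt (PosNum q0).
(* Off [D] the derivative has the default value [point], so it is constant there. *)
apply: (@eq_measurable_fun _ _ _ _ _ (cst (point : R))).
  move=> x; rewrite inE => -[Ix nD]; move: Ix; rewrite /I/= in_itv/= => xpq.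
  by rewrite derive1E /derive dvgP// => /(DE x xpq).
exact: measurable_cst.
Unshelve. all: by end_near. Qed.

End DerivativeMeasurable.

(** * Quadratic Lyapunov functionals of contraction semigroups *)

Section UniformDecrease.
Context {R : realType}.

(** The increments over a uniform mesh finer than [d] are added up. No differentiability of [phi] is
    required, but the one-sided bound must be uniform in [s]. *)
Lemma uniform_decrease (phi : R -> R) (t r : R) : 0 <= t ->
  (forall e : R, 0 < e -> exists2 d : R, 0 < d & forall h s, 0 < h -> h < d -> 0 <= s ->
    s + h <= t -> phi (s + h) - phi s <= h * (e - r)) ->
  phi t <= phi 0 - r * t.
Proof.
rewrite le_eqVlt => /predU1P[<- _|t0 H]; first by rewrite mulr0 subr0.
apply/ler_addgt0Pr => e e0; have [d d0 Hd] := H _ (divr_gt0 e0 t0).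
pose n := (Num.bound (t / d)).+1; pose h := t / n%:R.
have n0 : 0 < n%:R :> R by rewrite ltr0n.
have h0 : 0 < h by exact: divr_gt0.
have hd : h < d.
  rewrite /h ltr_pdivrMr// mulrC -ltr_pdivrMr//.
  apply: lt_trans (archi_boundP _) _; first by rewrite divr_ge0// ltW.
  by rewrite ltr_nat.
have key k : (k <= n)%N -> phi (k%:R * h) <= phi 0 + k%:R * (h * (e / t - r)).
  elim: k => [|k ih] kn; first by rewrite !mul0r addr0.
  have := ih (ltnW kn); have := Hd h (k%:R * h) h0 hd.
  rewrite mulr_ge0 ?(ltW h0)// => /(_ isT).
  have -> : k%:R * h + h = k.+1%:R * h by rewrite -natr1; ring.
  have knt : k.+1%:R * h <= t.
    by rewrite /h mulrCA ger_pMr// ler_pdivrMr// mul1r ler_nat.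
  move=> /(_ knt) h1 h2; rewrite -[k.+1%:R in leRHS]natr1; lra.
have := key n (leqnn n); have nh : n%:R * h = t.
  by rewrite /h mulrCA mulfV ?mulr1// gt_eqF.
rewrite mulrA nh; have : t * (e / t - r) = e - r * t.
  by field; rewrite gt_eqF.
lra.
Qed.

End UniformDecrease.

Section LyapunovForms.
Local Open Scope complex_scope.
Context {R : realType} {X : lmodType R[i]}.
Variables (H : set X) (N : X -> R) (T : R -> X -> X).
Implicit Types (U V W F G : X) (B S : X -> X -> R) (c t s h d e : R).

Record seminormed_module : Prop := {
  seminorm_closed : forall (c : R[i]) U V, H U -> H V -> H (c *: U + V) ;
  seminorm_ge0 : forall U, 0 <= N U ;
  seminormD : forall U V, H U -> H V -> N (U + V) <= N U + N V ;
  seminormZ : forall c U, H U -> N (c%:C *: U) = `|c| * N U }.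

(* Boundedness makes B compatible with the identification of vectors at
   distance 0. *)
Record bounded_form B : Prop := {
  form_bound : exists2 M, 0 <= M &
    forall U V, H U -> H V -> `|B U V| <= M * (N U * N V) ;
  form_linearl : forall c U V W, H U -> H V -> H W ->
    B (c%:C *: U + V) W = c * B U W + B V W ;
  form_linearr : forall c U V W, H U -> H V -> H W ->
    B W (c%:C *: U + V) = c * B W U + B W V }.

(** The graph of the generator expressed through the semigroup alone, so that it is stable under
    [T s]. By contrast [domain] is a set of representatives, in which [T s U] need only have an
    equivalent. *)
Definition generator_pair U F : Prop :=
  [/\ H U, H F &
      N (h^-1%:C *: (T h U - U) - F) @[h --> (0 : R)^'+] --> (0 : R)].

Hypothesis Hsn : seminormed_module.
Hypothesis HT : C0_contraction_semigroup H N T.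

Let H0 U : H U -> H 0.
Proof. by move=> HU; have := seminorm_closed Hsn (- 1) HU HU; rewrite scaleN1r addNr. Qed.

Let HZ (c : R[i]) U : H U -> H (c *: U).
Proof. by move=> HU; rewrite -[_ *: _]addr0; apply: (seminorm_closed Hsn) => //; exact: H0 HU. Qed.

Let HD U V : H U -> H V -> H (U + V).
Proof. by move=> HU HV; rewrite -[U]scale1r; exact: (seminorm_closed Hsn). Qed.

Let HN U : H U -> H (- U).
Proof. by move=> HU; rewrite -scaleN1r; exact: HZ. Qed.

Let HB U V : H U -> H V -> H (U - V).
Proof. by move=> HU HV; apply: HD => //; exact: HN. Qed.

Let HTt t U : 0 <= t -> H U -> H (T t U).
Proof. exact: (semigroup_stable HT). Qed.

Let N0 U : H U -> N 0 = 0.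
Proof.
by move=> HU; rewrite -(scale0r U); have := seminormZ Hsn 0 HU; rewrite normr0 mul0r.
Qed.

Let NN U : H U -> N (- U) = N U.
Proof.
move=> HU; have := seminormZ Hsn (- 1) HU; rewrite normrN1 mul1r => <-.
by rewrite rmorphN/= scaleN1r.
Qed.

Let NBC U V : H U -> H V -> N (U - V) = N (V - U).
Proof. by move=> HU HV; rewrite -(NN (HB HU HV)) opprB. Qed.

Let N_triangle U V W : H U -> H V -> H W -> N (U - W) <= N (U - V) + N (V - W).
Proof.
by move=> HU HV HW; rewrite -(subrKA V U); apply: (seminormD Hsn); exact: HB.
Qed.

Let N_eqN U V : H U -> H V -> eqN N U V -> N U = N V.
Proof.
move=> HU HV UV; apply/eqP; rewrite eq_le; apply/andP; split.
  have := seminormD Hsn (HB HU HV) HV.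
  by rewrite subrK (_ : N (U - V) = 0) ?add0r.
have := seminormD Hsn (HB HV HU) HU.
by rewrite subrK NBC// (_ : N (U - V) = 0) ?add0r.
Qed.

Let eqN_sym U V : H U -> H V -> eqN N U V -> eqN N V U.
Proof. by move=> HU HV; rewrite /eqN NBC. Qed.

Let eqN_trans U V W : H U -> H V -> H W -> eqN N U V -> eqN N V W -> eqN N U W.
Proof.
move=> HU HV HW UV VW; apply/eqP; rewrite eq_le (seminorm_ge0 Hsn) andbT.
by have := N_triangle HU HV HW; rewrite UV VW addr0.
Qed.

Let eqN_lin (c : R) U V U' V' : H U -> H V -> H U' -> H V' ->
  eqN N U U' -> eqN N V V' -> eqN N (c%:C *: U + V) (c%:C *: U' + V').
Proof.
move=> HU HV HU' HV' UU' VV'; apply/eqP; rewrite eq_le (seminorm_ge0 Hsn) andbT.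
rewrite opprD addrACA -scalerBr.
have := seminormD Hsn (HZ c%:C (HB HU HU')) (HB HV HV').
by rewrite (seminormZ Hsn) ?UU' ?VV' ?mulr0 ?addr0//; exact: HB.
Qed.

Lemma bounded_form_eqN B U V U' V' : bounded_form B ->
  H U -> H V -> H U' -> H V' -> eqN N U U' -> eqN N V V' -> B U V = B U' V'.
Proof.
move=> fB HU HV HU' HV' UU' VV'; have [M M0 BM] := form_bound fB.
have B0 W W' : H W -> H W' -> N W = 0 -> B W W' = 0 /\ B W' W = 0.
  move=> HW HW' W0; have := BM _ _ HW HW'; have := BM _ _ HW' HW.
  by rewrite W0 mul0r !mulr0 !normr_le0 => /eqP -> /eqP ->.
have := form_linearl fB 1 (HB HU HU') HU' HV; rewrite rmorph1 scale1r subrK => ->.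
have := form_linearr fB 1 (HB HV HV') HV' HU'; rewrite rmorph1 scale1r subrK => ->.
rewrite (B0 _ _ (HB HU HU') HV UU').1 (B0 _ _ (HB HV HV') HU' VV').2.
by rewrite !mulr0 !add0r.
Qed.

Lemma bounded_form_diff B M U V : bounded_form B ->
  (forall U V, H U -> H V -> `|B U V| <= M * (N U * N V)) -> H U -> H V ->
  `|B U U - B V V| <= M * (N (U - V) * (N U + N V)).
Proof.
move=> fB BM HU HV; have HUV := HB HU HV.
have := form_linearl fB 1 HUV HV HU; rewrite rmorph1 scale1r subrK mul1r => ->.
have := form_linearr fB 1 HUV HV HV; rewrite rmorph1 scale1r subrK mul1r => ->.
rewrite addrA addrK (le_trans (ler_normD _ _))// !mulrDr lerD//; first exact: BM.
by rewrite [X in M * X]mulrC; exact: BM.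
Qed.

Let generator_pair_lin (c : R) U V F G : generator_pair U F -> generator_pair V G ->
  generator_pair (c%:C *: U + V) (c%:C *: F + G).
Proof.
move=> [HU HF UF] [HV HG VG]; split; do ?exact: (seminorm_closed Hsn).
have lim : `|c| * N (h^-1%:C *: (T h U - U) - F) + N (h^-1%:C *: (T h V - V) - G)
    @[h --> (0 : R)^'+] --> (0 : R).
  rewrite -[X in _ --> X](addr0 0) -[X in _ --> X + _](mulr0 `|c|).
  by apply: cvgD => //; apply: cvgMr.
apply: (squeeze_cvgr _ (cvg_cst 0) lim); near=> h.
have h0 : 0 < h by near: h; exact: nbhs_right_gt.
have hge0 := ltW h0; rewrite (seminorm_ge0 Hsn)/=.
have HthU := HTt hge0 HU; have HthV := HTt hge0 HV.
have e1 := semigroup_linear HT c%:C hge0 HU HV.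
set A := h^-1%:C *: (T h U - U) - F; set A' := h^-1%:C *: (T h V - V) - G.
have HA : H A by apply: HB => //; apply: HZ; exact: HB.
have HA' : H A' by apply: HB => //; apply: HZ; exact: HB.
have -> : N (h^-1%:C *: (T h (c%:C *: U + V) - (c%:C *: U + V)) - (c%:C *: F + G))
    = N (c%:C *: A + A').
  have HL : H (T h (c%:C *: U + V)) by apply: HTt => //; exact: (seminorm_closed Hsn).
  have HL' : H (c%:C *: T h U + T h V) by exact: (seminorm_closed Hsn).
  have HK : H (- (h^-1%:C *: (c%:C *: U + V)) - (c%:C *: F + G)).
    by apply: HB; [apply: HN; apply: HZ|]; exact: (seminorm_closed Hsn).
  have -> : c%:C *: A + A' = h^-1%:C *: (c%:C *: T h U + T h V) +
      (- (h^-1%:C *: (c%:C *: U + V)) - (c%:C *: F + G)).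
    rewrite /A /A' !scalerBr !scalerDr !scalerA !(mulrC c%:C) -!scalerA.
    by rewrite !opprD; rewrite -!addrA; congr (_ + _);
      rewrite ?(addrCA _ (h^-1%:C *: T h V)); congr (_ + _);
      congr (_ + _); rewrite addrCA.
  rewrite scalerBr -addrA.
  apply: N_eqN; [exact: (seminorm_closed Hsn)|exact: (seminorm_closed Hsn)|].
  by apply: eqN_lin => //; rewrite /eqN subrr (N0 HU).
have := seminormD Hsn (HZ c%:C HA) HA'.
by rewrite (seminormZ Hsn).
Unshelve. all: by end_near. Qed.

Let T_Z (c : R) s U : 0 <= s -> H U -> eqN N (T s (c%:C *: U)) (c%:C *: T s U).
Proof.
move=> s0 HU; have HTU := HTt s0 HU; have H00 := H0 HU.
have T0 : eqN N (T s 0) 0.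
  have := semigroup_linear HT (- 1) s0 HU HU.
  by rewrite !scaleN1r !addNr.
have := semigroup_linear HT c%:C s0 HU H00; rewrite addr0 => e1.
have HTcU : H (T s (c%:C *: U)) by apply: HTt => //; exact: HZ.
have HT0 : H (T s 0) by exact: HTt.
apply: (eqN_trans HTcU _ _ e1); [exact: (seminorm_closed Hsn)|exact: HZ|].
rewrite -[X in eqN _ _ X]addr0; apply: eqN_lin => //.
by rewrite /eqN subrr (N0 HU).
Qed.

Let difference_quotient h U := h^-1%:C *: (T h U - U).

Let H_difference_quotient h U : 0 < h -> H U -> H (difference_quotient h U).
Proof. by move=> h0 HU; apply: HZ; apply: HB => //; apply: HTt => //; exact: ltW. Qed.

(* T commutes with the translations T h, so T s maps difference quotients to
   difference quotients. *)
Lemma semigroup_difference_quotient s h U : 0 <= s -> 0 < h -> H U ->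
  eqN N (T s (difference_quotient h U)) (difference_quotient h (T s U)).
Proof.
move=> s0 h0 HU; have hge0 := ltW h0.
have HThU := HTt hge0 HU; have HTsU := HTt s0 HU.
have HTsThU := HTt s0 HThU; have HThTsU := HTt hge0 HTsU.
have HD' := HB HThU HU.
have HTdq := HTt s0 (HZ h^-1%:C HD').
apply: (eqN_trans HTdq _ _ (T_Z h^-1 s0 HD')).
- by apply: HZ; exact: HTt.
- exact: H_difference_quotient.
rewrite /difference_quotient.
have e2 : eqN N (T s (T h U - U)) (T h (T s U) - T s U).
  have := semigroup_linear HT (- 1) s0 HU HThU.
  rewrite !scaleN1r ![- _ + _]addrC => e1.
  apply: (eqN_trans (HTt s0 HD') _ _ e1); [exact: HB|exact: HB|].
  have e3 : eqN N (T s (T h U)) (T h (T s U)).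
    have HTsh : H (T (s + h) U) by apply: HTt => //; exact: addr_ge0.
    have := semigroupD HT hge0 s0 HU; rewrite addrC => e4.
    apply: (eqN_trans _ HTsh _ _ e4) => //.
    apply: eqN_sym => //; exact: (semigroupD HT).
  by rewrite /eqN opprB addrA subrK.
have := eqN_lin h^-1 (HTt s0 HD') (H0 HU) (HB HThTsU HTsU) (H0 HU) e2.
by rewrite !addr0; apply; rewrite /eqN subrr (N0 HU).
Qed.

Lemma generator_pair_semigroup s U F : 0 <= s -> generator_pair U F ->
  generator_pair (T s U) (T s F).
Proof.
move=> s0 [HU HF UF]; split; do ?exact: HTt.
apply: (squeeze_cvgr _ (cvg_cst 0) UF); near=> h.
have h0 : 0 < h by near: h; exact: nbhs_right_gt.
rewrite (seminorm_ge0 Hsn)/= -/(difference_quotient h (T s U)).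
rewrite -/(difference_quotient h U).
have HdU := H_difference_quotient h0 HU.
have HTU := HTt s0 HU; have HTF := HTt s0 HF.
have HdTU := H_difference_quotient h0 HTU; have HTdU := HTt s0 HdU.
apply: le_trans (semigroup_contraction HT s0 (HB HdU HF)).
rewrite le_eqVlt; apply/orP; left; apply/eqP; apply/esym.
apply: N_eqN; [by apply: HTt => //; exact: HB|exact: HB|].
have := semigroup_linear HT (- 1) s0 HF HdU.
rewrite !scaleN1r ![- _ + _]addrC => e1.
apply: (eqN_trans _ _ _ e1); [by apply: HTt => //; exact: HB|exact: HB|exact: HB|].
rewrite /eqN opprB addrA subrK; exact: semigroup_difference_quotient.
Unshelve. all: by end_near. Qed.

Lemma generator_pair_difference_quotient d U F : 0 < d -> generator_pair U F ->
  generator_pair (difference_quotient d U) (difference_quotient d F).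
Proof.
move=> d0 UF; have TUF := generator_pair_semigroup (ltW d0) UF.
have UF1 := generator_pair_lin (- 1) UF TUF.
have [HU HF UF0] := UF.
have UF2 := generator_pair_lin (d^-1) UF1 (generator_pair_lin (- 1) UF UF).
move: UF2; rewrite !rmorphN !rmorph1 !scaleN1r !addNr !addr0.
by rewrite ![- _ + _]addrC.
Qed.

(** [T (s + h) U] is [T s U] plus [h] times [T s] of the difference quotient, and contractivity
    keeps the latter within [e] of [T s F]. The error thus depends on [N U] and [N F] but not on
    [s], as [uniform_decrease] demands. *)
Lemma bounded_form_step B M U F s h e : bounded_form B -> 0 <= M ->
  (forall U V, H U -> H V -> `|B U V| <= M * (N U * N V)) ->
  generator_pair U F -> 0 <= s -> 0 < h ->
  N (difference_quotient h U - F) <= e ->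
  B (T (s + h) U) (T (s + h) U) - B (T s U) (T s U) <=
    h * (B (T s U) (T s F) + B (T s F) (T s U))
    + h * (M * (2 * N U * e + h * (N F + e) ^+ 2)).
Proof.
move=> fB M0 BM [HU HF _] s0 h0 he; have hge0 := ltW h0.
have HThU := HTt hge0 HU; have HTU := HTt s0 HU; have HTF := HTt s0 HF.
have HdU := H_difference_quotient h0 HU.
pose V := T s (difference_quotient h U); have HV : H V by exact: HTt.
have TE : eqN N (T (s + h) U) (h%:C *: V + T s U).
  have HTsh : H (T (s + h) U) by apply: HTt => //; exact: addr_ge0.
  apply: (eqN_trans HTsh _ _ (semigroupD HT s0 hge0 HU)); first exact: HTt.
    exact: (seminorm_closed Hsn).
  have := semigroup_linear HT h%:C s0 HdU HU.
  rewrite {1}/difference_quotient scalerA -rmorphM/= mulfV ?gt_eqF// rmorph1.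
  by rewrite scale1r subrK.
have Ve : N (V - T s F) <= e.
  apply: le_trans _ (le_trans (semigroup_contraction HT s0 (HB HdU HF)) he).
  rewrite le_eqVlt; apply/orP; left; apply/eqP; apply/esym.
  apply: N_eqN; [by apply: HTt => //; exact: HB|exact: HB|].
  have := semigroup_linear HT (- 1) s0 HF HdU.
  by rewrite !scaleN1r ![- _ + _]addrC.
have HThsU : H (T (s + h) U) by apply: HTt => //; exact: addr_ge0.
have Hc : H (h%:C *: V + T s U) by exact: (seminorm_closed Hsn).
rewrite (bounded_form_eqN fB HThsU HThsU Hc Hc TE TE).
rewrite (form_linearl fB)// !(form_linearr fB)//.
have e0 : 0 <= e by exact: le_trans (seminorm_ge0 Hsn _) he.
have NTU := semigroup_contraction HT s0 HU.
have NTF := semigroup_contraction HT s0 HF.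
have NV : N V <= N F + e.
  have := seminormD Hsn (HB HV HTF) HTF; rewrite subrK; lra.
have HVF := HB HV HTF.
have dl : B V (T s U) - B (T s F) (T s U) <= M * (N U * e).
  have := form_linearl fB 1 HVF HTF HTU; rewrite rmorph1 scale1r subrK mul1r => ->.
  rewrite addrK (le_trans (ler_norm _))// (le_trans (BM _ _ HVF HTU))//.
  by rewrite [N (V - _) * _]mulrC ler_wpM2l// ler_pM// (seminorm_ge0 Hsn).
have dr : B (T s U) V - B (T s U) (T s F) <= M * (N U * e).
  have := form_linearr fB 1 HVF HTF HTU; rewrite rmorph1 scale1r subrK mul1r => ->.
  rewrite addrK (le_trans (ler_norm _))// (le_trans (BM _ _ HTU HVF))//.
  by rewrite ler_wpM2l// ler_pM// (seminorm_ge0 Hsn).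
have dd : B V V <= M * (N F + e) ^+ 2.
  rewrite (le_trans (ler_norm _))// (le_trans (BM _ _ HV HV))//.
  by rewrite ler_wpM2l// expr2 ler_pM// (seminorm_ge0 Hsn).
move: (B V V) (B V (T s U)) (B (T s U) V) dl dr dd => x y z dl dr dd.
have h1 := ler_wpM2l hge0 dl; have h2 := ler_wpM2l hge0 dr.
have h3 := ler_wpM2l hge0 (ler_wpM2l hge0 dd).
lra.
Qed.

Let generator_pair_near U F e : generator_pair U F -> 0 < e ->
  exists2 d : R, 0 < d & forall h, 0 < h -> h < d ->
    N (difference_quotient h U - F) <= e.
Proof.
move=> [_ _ /cvgrPdist_lt UF] e0; have [d /= d0 Hd] := UF _ e0.
exists d => // h h0 hd; have := Hd h; rewrite /= !sub0r !normrN => Hh.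
apply: ltW; apply: le_lt_trans (ler_norm _) (Hh _ h0).
by rewrite gtr0_norm.
Qed.

(* S is not controlled along T t F, because F need not be in the domain; it is
   controlled along the difference quotients of T t U, which are in the domain
   and converge to T t F uniformly in t. *)
Lemma semigroup_lyapunov c B0 B1 S : 0 <= c ->
  bounded_form B0 -> bounded_form B1 -> bounded_form S ->
  (forall U, H U -> 0 <= B0 U U) -> (forall U, H U -> 0 <= B1 U U) ->
  (forall U F, generator_pair U F ->
    B0 U F + B0 F U <= - (c * N U ^+ 2) + S F F) ->
  (forall U F, generator_pair U F -> B1 U F + B1 F U <= - S U U) ->
  forall U F t, generator_pair U F -> 0 <= t ->
    c * t * N (T t U) ^+ 2 <= B0 U U + B1 F F.
Proof.
move=> c0 fB0 fB1 fS B00 B10 dB0 dB1 U F t UF t0; have [HU HF UF0] := UF.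
have [M0 M00 BM0] := form_bound fB0; have [M1 M10 BM1] := form_bound fB1.
have [MS MS0 BMS] := form_bound fS.
(* In the second form [F] is replaced by [W]; the last term is the cost of comparing [S] at [T s F]
   and at [T s W], and it vanishes as [d] tends to 0. *)
have key d W : 0 < d -> W = difference_quotient d U ->
    c * t * N (T t U) ^+ 2 <=
      B0 U U + B1 W W + t * (MS * (N (F - W) * (N F + N W))).
  move=> d0 WE; pose G := difference_quotient d F.
  have WG : generator_pair W G by rewrite WE; exact: generator_pair_difference_quotient.
  have [HW HG _] := WG.
  set eta := MS * _; pose phi s := B0 (T s U) (T s U) + B1 (T s W) (T s W).
  pose r := c * N (T t U) ^+ 2 - eta.
  suff : phi t <= phi 0 - r * t.
    have HTU0 := HTt (lexx 0) HU; have HTW0 := HTt (lexx 0) HW.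
    have -> : phi 0 = B0 U U + B1 W W.
      rewrite /phi; congr (_ + _); apply: bounded_form_eqN => //;
      exact: (semigroup0 HT).
    have : 0 <= phi t by rewrite addr_ge0 ?B00 ?B10//; exact: HTt.
    rewrite /r; lra.
  apply: uniform_decrease => // e e0.
  (* [K e'] bounds, after division by [h], the errors of both forms over a step with [h < e']; the
     condition [e' <= 1] is what allows [N F + 1] and [N G + 1] in the squares. *)
  pose K := M0 * (2 * N U + (N F + 1) ^+ 2) + M1 * (2 * N W + (N G + 1) ^+ 2) + 1.
  have K0 : 0 < K.
    by rewrite ltr_wpDl// addr_ge0// mulr_ge0// addr_ge0 ?sqr_ge0// mulr_ge0//
      (seminorm_ge0 Hsn).
  pose e' := Num.min 1 (e / K).
  have e'0 : 0 < e' by rewrite lt_min ltr01 divr_gt0.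
  have e'1 : e' <= 1 by rewrite ge_min lexx.
  have Ke' : K * e' <= e by rewrite mulrC -ler_pdivlMr// ge_min lexx orbT.
  have [d1 d10 Hd1] := generator_pair_near UF e'0.
  have [d2 d20 Hd2] := generator_pair_near WG e'0.
  exists (Num.min e' (Num.min d1 d2)); first by rewrite lt_min e'0 lt_min d10.
  move=> h s h0; rewrite lt_min => /andP[he']; rewrite lt_min => /andP[hd1 hd2].
  move=> s0 sht.
  have st : s <= t by apply: le_trans sht; rewrite lerDl ltW.
  have HTsU := HTt s0 HU; have HTsW := HTt s0 HW; have HTsF := HTt s0 HF.
  have q0 := bounded_form_step fB0 M00 BM0 UF s0 h0 (Hd1 _ h0 hd1).
  have q1 := bounded_form_step fB1 M10 BM1 WG s0 h0 (Hd2 _ h0 hd2).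
  have p0 := dB0 _ _ (generator_pair_semigroup s0 UF).
  have p1 := dB1 _ _ (generator_pair_semigroup s0 WG).
  (* The norm is nonincreasing along the trajectory, so its final value bounds the dissipation from
     below on all of [[0, t]]; this produces the factor [t]. *)
  have NtU : N (T t U) <= N (T s U).
    have ts0 : 0 <= t - s by rewrite subr_ge0.
    have := semigroup_contraction HT ts0 HTsU; apply: le_trans.
    rewrite le_eqVlt; apply/orP; left; apply/eqP.
    apply: N_eqN; [exact: HTt|exact: HTt|].
    by have := semigroupD HT ts0 s0 HU; rewrite subrK.
  have NtU2 : N (T t U) ^+ 2 <= N (T s U) ^+ 2.
    by rewrite lerXn2r// nnegrE (seminorm_ge0 Hsn).
  have sd : S (T s F) (T s F) - S (T s W) (T s W) <= eta.
    apply: le_trans (ler_norm _) _.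
    apply: le_trans (bounded_form_diff fS BMS HTsF HTsW) _.
    rewrite ler_wpM2l// ler_pM ?(seminorm_ge0 Hsn)//.
    - by rewrite addr_ge0 ?(seminorm_ge0 Hsn).
    - apply: le_trans (semigroup_contraction HT s0 (HB HF HW)).
      rewrite le_eqVlt; apply/orP; left; apply/eqP; apply/esym.
      apply: N_eqN; [by apply: HTt => //; exact: HB|exact: HB|].
      have := semigroup_linear HT (- 1) s0 HW HF.
      by rewrite !scaleN1r ![- _ + _]addrC.
    - by rewrite lerD// (semigroup_contraction HT).
  have rest (M a b : R) : 0 <= M -> 0 <= a -> 0 <= b ->
      M * (2 * a * e' + h * (b + e') ^+ 2) <= M * (2 * a + (b + 1) ^+ 2) * e'.
    move=> Mge a0 b0; rewrite -[leRHS]mulrA ler_wpM2l// [leRHS]mulrDl lerD// [leRHS]mulrC.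
    apply: ler_pM; [exact: ltW|exact: sqr_ge0|exact: ltW|].
    by rewrite lerXn2r ?nnegrE ?addr_ge0 ?(ltW e'0)// lerD.
  have r0 := rest M0 (N U) (N F) M00 (seminorm_ge0 Hsn _) (seminorm_ge0 Hsn _).
  have r1 := rest M1 (N W) (N G) M10 (seminorm_ge0 Hsn _) (seminorm_ge0 Hsn _).
  have rr : M0 * (2 * N U * e' + h * (N F + e') ^+ 2) +
      M1 * (2 * N W * e' + h * (N G + e') ^+ 2) <= e.
    apply: le_trans Ke'; rewrite /K !mulrDl mul1r; lra.
  have cN : c * N (T t U) ^+ 2 <= c * N (T s U) ^+ 2 by rewrite ler_wpM2l.
  apply: (@le_trans _ _ (h * ((B0 (T s U) (T s F) + B0 (T s F) (T s U)) +
    (B1 (T s W) (T s G) + B1 (T s G) (T s W)) +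
    (M0 * (2 * N U * e' + h * (N F + e') ^+ 2) +
      M1 * (2 * N W * e' + h * (N G + e') ^+ 2))))).
    by rewrite /phi; lra.
  by rewrite ler_wpM2l ?(ltW h0)// /r; lra.
apply/ler_addgt0Pr => e e0.
pose K := (M1 + t * MS) * (2 * N F + 1) + 1.
have NF0 := seminorm_ge0 Hsn F.
have K0 : 0 < K.
  by rewrite ltr_wpDl// mulr_ge0// addr_ge0// mulr_ge0.
pose e' := Num.min 1 (e / K).
have e'0 : 0 < e' by rewrite lt_min ltr01 divr_gt0.
have e'1 : e' <= 1 by rewrite ge_min lexx.
have Ke' : K * e' <= e by rewrite mulrC -ler_pdivlMr// ge_min lexx orbT.
have [d1 d10 Hd1] := generator_pair_near UF e'0.
pose d := d1 / 2; have d0 : 0 < d by exact: divr_gt0.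
have dd1 : d < d1 by rewrite /d; lra.
pose W := difference_quotient d U; have le1 := key d W d0 erefl.
have HW : H W by exact: H_difference_quotient.
have WF : N (W - F) <= e' by exact: Hd1.
have NW : N W <= N F + 1.
  have := seminormD Hsn (HB HW HF) HF; rewrite subrK; lra.
have le2 : B1 W W - B1 F F <= M1 * (e' * (2 * N F + 1)).
  apply: le_trans (ler_norm _) _; apply: le_trans (bounded_form_diff fB1 BM1 HW HF) _.
  by rewrite ler_wpM2l// ler_pM ?addr_ge0 ?(seminorm_ge0 Hsn)//; lra.
have le3 : t * (MS * (N (F - W) * (N F + N W))) <= t * (MS * (e' * (2 * N F + 1))).
  rewrite ler_wpM2l// ler_wpM2l// ler_pM ?addr_ge0 ?(seminorm_ge0 Hsn)//; last lra.
  by rewrite NBC.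
have : M1 * (e' * (2 * N F + 1)) + t * (MS * (e' * (2 * N F + 1))) <= e.
  apply: le_trans Ke'; rewrite /K mulrDl mul1r; lra.
lra.
Qed.

End LyapunovForms.

(** * Polynomial decay from a family of Lyapunov forms *)

Section PolynomialDecay.
Context {R : realType}.

(* Dyadic iteration with h = 1 / (eta t): t^p E(t) is at most halved, up to a
   constant, when t is doubled. *)
Lemma dyadic_decay (p C : R) : 1 <= p -> 0 < C -> exists2 B : R, 0 < B &
  forall (E : R -> R) (G : R),
    (forall t, 0 < t -> 0 <= E t <= G) ->
    (forall t h, 0 < t -> 0 < h <= 1 ->
      t * E (2 * t) <= C * (E t / h + h `^ (p - 1) * G)) ->
    forall t, 0 < t -> E t <= B * t `^ (- p) * G.
Proof.
move=> p1 C0; have p0 : 0 < p by lra.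
(* With [h = t0 / s] the recursion from [s] to [2 s] multiplies [s^p E(s)] by [2^p C / t0]; this
   [t0] makes the factor at most 1/2. *)
pose t0 := C * 2 `^ p * 2 + 1.
have P2 : 0 < 2 `^ p :> R by exact: powR_gt0.
have t01 : 1 <= t0 by rewrite /t0 lerDr !mulr_ge0 ?(ltW C0) ?(ltW P2).
have t00 : 0 < t0 by lra.
pose K := 2 `^ p * C * t0 `^ (p - 1).
have K0 : 0 < K by rewrite !mulr_gt0// powR_gt0.
pose B := (2 * t0) `^ p + 2 * K.
have B0 : 0 < B.
  by apply: addr_gt0; [apply: powR_gt0; exact: mulr_gt0|exact: mulr_gt0].
exists B => // E G EG HE.
suff bnd n t : 0 < t -> t <= 2 ^+ n * (2 * t0) -> t `^ p * E t <= B * G.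
  move=> t t_gt0; have tp : 0 < t `^ p by exact: powR_gt0.
  have := bnd (Num.bound t) t t_gt0.
  rewrite powRN mulrAC ler_pdivlMr// [E t * _]mulrC; apply.
  apply: (le_trans (ltW (archi_boundP (ltW t_gt0)))).
  have : (Num.bound t)%:R <= 2 ^+ Num.bound t :> R.
    by rewrite -natrX ler_nat ltnW// ltn_expl.
  have : 0 <= 2 ^+ Num.bound t :> R by rewrite exprn_ge0.
  by move: (2 ^+ _) => x x0 xb; nra.
have small u : 0 < u -> u <= 2 * t0 -> u `^ p * E u <= B * G.
  move=> t_gt0 tle; have /andP[Et0 EtG] := EG u t_gt0.
  apply: ler_pM; [exact: powR_ge0|exact: Et0| |exact: EtG].
  have : u `^ p <= (2 * t0) `^ p.
    by apply: ge0_ler_powR => //; rewrite ?nnegrE; lra.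
  by rewrite /B; lra.
elim: n t => [|n ih] t t_gt0.
  by rewrite expr0 mul1r; exact: small.
have [tle _|tgt tle] := leP t (2 * t0); first exact: small.
pose s := t / 2; have s0 : 0 < s by rewrite /s; lra.
have ts : t = 2 * s by rewrite /s; lra.
have sle : s <= 2 ^+ n * (2 * t0).
  by move: tle; rewrite exprS -mulrA ts ler_pM2l.
have /andP[Es0 EsG] := EG s s0.
have G0 : 0 <= G := le_trans Es0 EsG.
have IH := ih s s0 sle.
pose h := t0 / s; have h0 : 0 < h by exact: divr_gt0.
have h1 : h <= 1 by rewrite /h ler_pdivrMr// mul1r; lra.
have := HE s h s0; rewrite h0 h1 => /(_ isT) Hs.
have sp : s `^ p = s `^ (p - 1) * s.
  have -> : s `^ p = s `^ (p - 1 + 1) by rewrite subrK.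
  rewrite powRD; first by rewrite powRr1// ltW.
  by rewrite (gt_eqF s0) implybT.
have hs : s `^ (p - 1) * h `^ (p - 1) = t0 `^ (p - 1).
  rewrite -powRM ?(ltW s0) ?(ltW h0)//; congr (_ `^ _).
  by rewrite /h mulrC divfK// gt_eqF.
have sp0 : 0 <= s `^ (p - 1) by exact: powR_ge0.
have : 2 `^ p * s `^ (p - 1) * (s * E (2 * s)) <=
    2 `^ p * s `^ (p - 1) * (C * (E s / h + h `^ (p - 1) * G)).
  by rewrite ler_wpM2l// mulr_ge0// ltW.
have -> : 2 `^ p * s `^ (p - 1) * (s * E (2 * s)) = t `^ p * E t.
  by rewrite ts (powRM _ (ler0n _ 2) (ltW s0)) sp; ring.
have -> : 2 `^ p * s `^ (p - 1) * (C * (E s / h + h `^ (p - 1) * G)) =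
    2 `^ p * C / t0 * (s `^ p * E s) + K * G.
  rewrite /K -hs sp /h; field.
  by rewrite !gt_eqF.
have q : 2 `^ p * C / t0 <= 1 / 2.
  by rewrite ler_pdivrMr// /t0; lra.
have : 2 `^ p * C / t0 * (s `^ p * E s) <= 1 / 2 * (B * G).
  apply: ler_pM => //; last by rewrite mulr_ge0// powR_ge0.
  by rewrite divr_ge0 ?mulr_ge0 ?ltW.
have : 2 * K * G <= B * G.
  by rewrite ler_wpM2r// /B lerDr powR_ge0.
lra.
Qed.

End PolynomialDecay.

Section SemigroupDecay.
Local Open Scope complex_scope.
Context {R : realType} {X : lmodType R[i]}.
Variables (H : set X) (N : X -> R) (T : R -> X -> X).
Hypothesis Hsn : seminormed_module H N.
Hypothesis HT : C0_contraction_semigroup H N T.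

(** [semigroup_lyapunov] is run from time [s] to time [2 s], that is, from [T s U] over a duration
    [s]. The first form then costs the current [N (T s U)^2], which the iteration improves, and the
    second only the fixed [N F^2]. *)
Lemma semigroup_decay (p c C : R) : 1 <= p -> 0 < c -> 0 < C ->
  (forall h, 0 < h <= 1 -> exists B0 B1 S : X -> X -> R,
    [/\ bounded_form H N B0, bounded_form H N B1 & bounded_form H N S] /\
    [/\ (forall U, H U -> 0 <= B0 U U <= C / h * N U ^+ 2),
     (forall U, H U -> 0 <= B1 U U <= C * h `^ (p - 1) * N U ^+ 2),
     (forall U F, generator_pair H N T U F ->
       B0 U F + B0 F U <= - (c * N U ^+ 2) + S F F) &
     (forall U F, generator_pair H N T U F -> B1 U F + B1 F U <= - S U U)]) ->
  exists2 B, 0 < B & forall U F t, generator_pair H N T U F -> 0 < t ->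
    N (T t U) ^+ 2 <= B * t `^ (- p) * (N U ^+ 2 + N F ^+ 2).
Proof.
move=> p1 c0 C0 forms.
have [B B0 HB] := dyadic_decay p1 (divr_gt0 C0 c0).
exists B => // U F t UF t0; have [HU HF _] := UF.
apply: (HB (fun t => N (T t U) ^+ 2)) => // [s s0|s h s0 h01].
  rewrite sqr_ge0/= ler_wpDr ?sqr_ge0//.
  by rewrite lerXn2r ?nnegrE ?(seminorm_ge0 Hsn)// (semigroup_contraction HT)// ltW.
have [B0' [B1' [S [[f0 f1 fS] [b0 b1 d0 d1]]]]] := forms _ h01.
have /andP[h0 h1] := h01.
have sge := ltW s0; have HTsU := semigroup_stable HT sge HU.
have HTsF := semigroup_stable HT sge HF.
have n0 V : H V -> 0 <= B0' V V by move=> /b0/andP[].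
have n1 V : H V -> 0 <= B1' V V by move=> /b1/andP[].
have UFs := generator_pair_semigroup Hsn HT sge UF.
have := semigroup_lyapunov Hsn HT (ltW c0) f0 f1 fS n0 n1 d0 d1 UFs sge.
have -> : N (T s (T s U)) = N (T (2 * s) U).
  have ss : 2 * s = s + s by ring.
  have Hss : H (T (s + s) U) by apply: (semigroup_stable HT) => //; rewrite addr_ge0.
  rewrite ss; apply/eqP; rewrite eq_le; apply/andP; split.
    have HTT := semigroup_stable HT sge HTsU.
    have e := semigroupD HT sge sge HU.
    have H1 : H (T s (T s U) - T (s + s) U).
      by rewrite addrC -scaleN1r; exact: (seminorm_closed Hsn).
    have := seminormD Hsn H1 Hss; rewrite subrK.
    have := seminormZ Hsn (- 1) H1; rewrite rmorphN rmorph1 scaleN1r opprB e.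
    by rewrite normrN1 mul1r => <-; rewrite add0r.
  have HTT := semigroup_stable HT sge HTsU.
  have e := semigroupD HT sge sge HU.
  have H1 : H (T (s + s) U - T s (T s U)).
    by rewrite addrC -scaleN1r; exact: (seminorm_closed Hsn).
  by have := seminormD Hsn H1 HTT; rewrite subrK e add0r.
have /andP[_ u0] := b0 _ HTsU; have /andP[_ u1] := b1 _ HTsF => le1.
have NF : N (T s F) ^+ 2 <= N U ^+ 2 + N F ^+ 2.
  rewrite ler_wpDl ?sqr_ge0// lerXn2r ?nnegrE ?(seminorm_ge0 Hsn)//.
  exact: (semigroup_contraction HT).
have u2 : C * h `^ (p - 1) * N (T s F) ^+ 2 <=
    C * h `^ (p - 1) * (N U ^+ 2 + N F ^+ 2).
  by rewrite ler_wpM2l// mulr_ge0 ?powR_ge0 ?(ltW C0).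
rewrite -(ler_pM2l c0) mulrA; apply: le_trans le1 _.
have -> : c * (C / c * (N (T s U) ^+ 2 / h + h `^ (p - 1) * (N U ^+ 2 + N F ^+ 2)))
  = C / h * N (T s U) ^+ 2 + C * h `^ (p - 1) * (N U ^+ 2 + N F ^+ 2).
  by field; rewrite !gt_eqF.
lra.
Qed.

End SemigroupDecay.

Section CombineMultipliers.
Context {R : realType}.

(* The constants of the first multiplier inequality, by completing squares. *)
Lemma combine_multipliers (g al be lam Cm : R) :
  0 < g -> 0 < al <= 1 -> 0 < be <= 2^-1 -> 0 < lam -> 0 < Cm ->
  exists K1 K2 c C L : R,
    [/\ 0 < K1, 0 < K2, 0 < c, 0 < C & 0 < L] /\
    forall r hl X A V PP Y S z d v0 P0 u0 s mU mm : R,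
    1 <= r -> 0 <= hl -> 0 <= X -> 0 <= A -> 0 <= V -> 0 <= PP -> 0 <= Y -> 0 <= S ->
    0 <= mm <= 2^-1 ->
    v0 ^+ 2 <= 2 * r * X + 2 * (hl / al) * V ->
    P0 ^+ 2 <= 4 * r * Y + 4 * hl * PP + 2 * (g * z) ^+ 2 ->
    u0 ^+ 2 <= 2 * z ^+ 2 + 2 / al * A ->
    A <= 2 * Y + 2 * (g * z) ^+ 2 / al ->
    s ^+ 2 <= X -> mU ^+ 2 <= Cm * (X + A + S + g * z ^+ 2) ->
    (v0 ^+ 2 + P0 ^+ 2) / 2 + mm * (P0 * u0) - be * S
      + K1 * (d * mU - lam * z ^+ 2)
      + K2 * r * (d ^+ 2 - X / 2 - al / 2 * Y + g * d * s) <=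
    - (c * (X + A + S + g * z ^+ 2)) + C * hl * (PP + V) + L * r * d ^+ 2.
Proof.
move=> g0 /andP[al0 al1] /andP[be0 be1] lam0 Cm0.
(* In the application [al = 1 - a], [be = (2 - m) / 4], [r = 1 / h], [hl = h^(1 - a)], [z = u(1)],
   [d = v(1)]. [X] and [A] are the kinetic and potential energies on [(0, 1)], [S] the energy on
   [(-1, 0)], [Y] the shifted potential energy, [V] and [PP] the squared norms of [x^(a / 2) v'] and
   [P'], and [mU] is the static moment. *)
pose ial := al^-1; have ial1 : 1 <= ial by rewrite /ial invf_ge1.
pose cz := 3 / 2 * g ^+ 2 + 1 / 2 + g ^+ 2 * ial ^+ 2.
have cz0 : 0 < cz.
  have : 0 <= g ^+ 2 * ial ^+ 2 by rewrite mulr_ge0// sqr_ge0.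
  by have := sqr_ge0 g; rewrite /cz; lra.
pose cE := 2 * g ^+ 2 * ial + g.
have cE0 : 0 < cE.
  by rewrite /cE ltr_wpDl// !mulr_ge0 ?sqr_ge0//; lra.
(* [cz] and [cE] are the coefficients of [z^2] in [step1] and [step2]; the choice
   [K1 lam = cz + be cE] cancels both contributions. *)
pose K1 := (cz + be * cE) / lam.
have K10 : 0 < K1 by rewrite divr_gt0// addr_gt0// mulr_gt0.
(* Ensures [K2 / 4 >= 2] and [K2 al / 2 >= 4 + 1 / al], which covers the multiples of [r X] and
   [r Y] coming from [step1] and [step2]. *)
pose K2 := 8 + 8 * ial + 2 * ial ^+ 2.
have K20 : 0 < K2 by rewrite /K2; have := sqr_ge0 ial; lra.
(* Makes [K1 ep Cm = be / 2]: half of the decay rate pays for the cross term [d mU], and the other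
   half is the final [c]. *)
pose ep := be / (2 * K1 * Cm).
have ep0 : 0 < ep.
  by apply: divr_gt0 => //; apply: mulr_gt0 => //; exact: mulr_gt0.
pose L := K1 / (4 * ep) + K2 * (1 + g ^+ 2).
have L0 : 0 < L.
  have q1 : 0 < K1 / (4 * ep) by apply: divr_gt0 => //; exact: mulr_gt0.
  have q2 : 0 < K2 * (1 + g ^+ 2).
    by apply: mulr_gt0 => //; have := sqr_ge0 g; lra.
  by rewrite /L; lra.
exists K1, K2, (be / 2), (3 + ial), L; split; first by split => //; lra.
move=> r hl X A V PP Y S z d v0 P0 u0 s mU mm r1 hl0 X0 A0 V0 PP0 Y0 S0.
move=> /andP[mm0 mm1]; rewrite -/ial => v0b P0b u0b Ab sb mUb.
have r0 : 0 <= r by lra.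
pose Z := z ^+ 2; have Z0 : 0 <= Z by exact: sqr_ge0.
have gz : (g * z) ^+ 2 = g ^+ 2 * Z by rewrite exprMn.
rewrite gz in P0b Ab.
have g20 := sqr_ge0 g.
have Ab' : A <= 2 * Y + 2 * g ^+ 2 * ial * Z by move: Ab; rewrite /ial; lra.
have u0b' : u0 ^+ 2 <= 2 * Z + 4 * ial * Y + 4 * g ^+ 2 * ial ^+ 2 * Z.
  have : 2 * ial * A <= 2 * ial * (2 * Y + 2 * g ^+ 2 * ial * Z).
    by rewrite ler_wpM2l//; lra.
  move: u0b; rewrite -/ial -/Z; lra.
have cross : mm * (P0 * u0) <= (P0 ^+ 2 + u0 ^+ 2) / 4.
  have h1 : P0 * u0 <= (P0 ^+ 2 + u0 ^+ 2) / 2.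
    by have := sqr_ge0 (P0 - u0); lra.
  have h2 := ler_wpM2l mm0 h1.
  have h3 : 0 <= (P0 ^+ 2 + u0 ^+ 2) / 2.
    by have := sqr_ge0 P0; have := sqr_ge0 u0; lra.
  have h := ler_wpM2r h3 mm1; clear - h h2; lra.
have rY : Y <= r * Y by rewrite ler_peMl.
have rX : X <= r * X by rewrite ler_peMl.
have hPP : 0 <= hl * PP by exact: mulr_ge0.
have hV : 0 <= hl * V by exact: mulr_ge0.
have i0 : 0 <= ial by clear - ial1; lra.
have iPP := mulr_ge0 i0 hPP; have iV := mulr_ge0 i0 hV.
have irY := ler_wpM2l i0 rY.
have step1 : (v0 ^+ 2 + P0 ^+ 2) / 2 + mm * (P0 * u0) <=
    r * X + (3 + ial) * (r * Y) + (3 + ial) * hl * (PP + V) + cz * Z.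
  move: v0b; rewrite -/ial /cz; lra.
have step2 : X + A + S + g * z ^+ 2 <= X + 2 * Y + S + cE * Z.
  by rewrite -/Z /cE; clear - Ab'; lra.
have E0 : 0 <= X + A + S + g * z ^+ 2.
  by have := mulr_ge0 (ltW g0) Z0; rewrite -/Z; lra.
have step3 : K1 * (d * mU) <= be / 2 * (X + A + S + g * z ^+ 2)
    + K1 / (4 * ep) * d ^+ 2.
  have h1 : d * mU <= ep * mU ^+ 2 + d ^+ 2 / (4 * ep).
    have ep40 : 0 < 4 * ep by exact: mulr_gt0.
    rewrite -(ler_pM2r ep40).
    rewrite [leRHS](_ : _ = (2 * ep * mU) ^+ 2 + d ^+ 2).
      have h := sqr_ge0 (2 * ep * mU - d); clear - h; lra.
    by field; rewrite gt_eqF.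
  have h2 := ler_wpM2l (ltW ep0) mUb.
  have h3 : d * mU <= ep * (Cm * (X + A + S + g * z ^+ 2)) + d ^+ 2 / (4 * ep).
    by apply: le_trans h1 _; rewrite lerD2r.
  have := ler_wpM2l (ltW K10) h3.
  rewrite mulrDr [X in X + _](_ : _ = be / 2 * (X + A + S + g * z ^+ 2)); last first.
    by rewrite /ep; field; rewrite !gt_eqF.
  have -> : K1 * (d ^+ 2 / (4 * ep)) = K1 / (4 * ep) * d ^+ 2.
    by rewrite mulrA mulrAC.
  by [].
have step4 : d ^+ 2 - X / 2 - al / 2 * Y + g * d * s <=
    (1 + g ^+ 2) * d ^+ 2 - X / 4 - al / 2 * Y.
  have h := sqr_ge0 (2 * g * d - s); clear - h sb; lra.
have K2r0 : 0 <= K2 * r by rewrite mulr_ge0 ?(ltW K20).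
have step4' := ler_wpM2l K2r0 step4.
have K1lam : K1 * lam = cz + be * cE by rewrite /K1 divfK// gt_eqF.
have alial : al * ial = 1 by rewrite /ial mulfV// gt_eqF.
have K2al : K2 * al = 8 * al + 8 + 2 * ial.
  have : K2 * al = 8 * al + 8 * (al * ial) + 2 * ial * (al * ial) by rewrite /K2; ring.
  by rewrite alial; clear; lra.
have K2Y : (4 + ial) * (r * Y) <= K2 * r * (al / 2 * Y).
  have -> : K2 * r * (al / 2 * Y) = K2 * al / 2 * (r * Y) by ring.
  by rewrite K2al ler_wpM2r//; [exact: mulr_ge0|clear - al0; lra].
have K2X : 2 * (r * X) <= K2 * r * (X / 4).
  have -> : K2 * r * (X / 4) = K2 / 4 * (r * X) by ring.
  by rewrite ler_wpM2r//; [exact: mulr_ge0|have h := sqr_ge0 ial; rewrite /K2; clear - h i0; lra].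
have rd : d ^+ 2 <= r * d ^+ 2 by rewrite ler_peMl// sqr_ge0.
have K1ep : 0 <= K1 / (4 * ep) by apply: ltW; apply: divr_gt0 => //; exact: mulr_gt0.
have K1d := ler_wpM2l K1ep rd.
have bX : be * X <= X / 2 by rewrite mulrC ler_wpM2l.
have bY : be * (2 * Y) <= Y by have h := ler_wpM2l Y0 be1; clear - h; lra.
have bstep2 := ler_wpM2l (ltW be0) step2.
have Zlam : K1 * (d * mU - lam * z ^+ 2) = K1 * (d * mU) - (cz + be * cE) * Z.
  by rewrite -K1lam /Z; ring.
rewrite Zlam.
have Lr : L * r * d ^+ 2 = K1 / (4 * ep) * (r * d ^+ 2)
    + K2 * r * ((1 + g ^+ 2) * d ^+ 2).
  by rewrite /L; ring.
rewrite Lr.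
move: step4'; rewrite [in leRHS]mulrBr [in leRHS]mulrBr => step4'.
move: (K1 / (4 * ep)) step3 K1d => q step3 K1d.
move: (K2 * r * (al / 2 * Y)) (K2 * r * (X / 4)) (K2 * r * ((1 + _) * _))
  (K2 * r * (_ - _ + _)) step4' K2Y K2X => k1 k2 k3 k4 step4' K2Y K2X.
move: (K1 * (d * mU)) step3 => k5 step3.
move: (X + A + S + g * z ^+ 2) bstep2 step3 => E bstep2 step3.
move: step1; move: (mm * _) ((_ + _) / 2) ((3 + ial) * hl * _) => k6 k7 k8 step1.
clear - step1 step3 step4' K2Y K2X bstep2 bX bY rX rY K1d X0 Y0 S0 irY; lra.
Qed.

End CombineMultipliers.

(** * Multiplier estimates for the coupled degenerate waves *)

Section Multipliers.
Context {R : realType}.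
Variables (gamma a m : R).
Hypotheses (gamma_gt0 : 0 < gamma) (a01 : 0 <= a < 1) (m02 : 0 <= m < 2).
Implicit Types (u du v dv P dP w dw y dy Q dQ : R -> R).

(* A real (or imaginary) part of an element of the domain, with fluxes
   P = x^a u' and Q = (x + 1)^m w'. *)
Record wave_data u du v dv P dP w dw y dy Q dQ (u0 v0 P0 : R) : Prop := {
  wd_u : primitive 0 1 u du ;
  wd_v : primitive 0 1 v dv ;
  wd_P : primitive 0 1 P dP ;
  wd_w : primitive (-1) 0 w dw ;
  wd_y : primitive (-1) 0 y dy ;
  wd_Q : primitive (-1) 0 Q dQ ;
  wd_v2 : l2 0 1 v ;
  wd_du2 : l2 0 1 (pwM 0 (a / 2) du) ;
  wd_dv2 : l2 0 1 (pwM 0 (a / 2) dv) ;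
  wd_dP2 : l2 0 1 dP ;
  wd_w2 : l2 (-1) 0 w ;
  wd_y2 : l2 (-1) 0 y ;
  wd_dw2 : l2 (-1) 0 (pwM (-1) (m / 2) dw) ;
  wd_dy2 : l2 (-1) 0 (pwM (-1) (m / 2) dy) ;
  wd_dQ2 : l2 (-1) 0 dQ ;
  wd_PE : forall x, 0 < x < 1 -> P x = pwM 0 a du x ;
  wd_QE : forall x, -1 < x < 0 -> Q x = pwM (-1) m dw x ;
  wd_u0 : u x @[x --> 0^'+] --> u0 ;
  wd_v0 : v x @[x --> 0^'+] --> v0 ;
  wd_P0 : P x @[x --> 0^'+] --> P0 ;
  wd_w0 : w 0 = u0 ;
  wd_y0 : y 0 = v0 ;
  wd_Q0 : Q 0 = P0 ;
  wd_1 : gamma * u 1 + P 1 + v 1 = 0 ;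
  wd_wN1 : m < 1 -> w x @[x --> (-1)^'+] --> (0 : R) ;
  wd_yN1 : m < 1 -> y x @[x --> (-1)^'+] --> (0 : R) }.

Let static_combine (A B P0 f u0 z d k : R) :
  A + k * (z - u0) = - (gamma * z + d) * f - P0 -> B + k * u0 = P0 ->
  A + B + f * d = - (gamma * f + k) * z.
Proof. by move=> hA hB; lra. Qed.

Section Identities.
Variables (u du v dv P dP w dw y dy Q dQ : R -> R) (u0 v0 P0 : R).
Hypothesis wd : wave_data u du v dv P dP w dw y dy Q dQ u0 v0 P0.

Notation Du := (pwM 0 (a / 2) du).
Notation Dv := (pwM 0 (a / 2) dv).
Notation Dw := (pwM (-1) (m / 2) dw).
Notation Dy := (pwM (-1) (m / 2) dy).
Notation G := (fun x => P x + gamma * u 1).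
Notation EG := (pwM 0 (- (a / 2)) G).

Let q1 : 1 = 0 + 1 :> R. Proof. by rewrite add0r. Qed.
Let q0 : 0 = -1 + 1 :> R. Proof. by rewrite addNr. Qed.
Let lt01 : 0 < 1 :> R. Proof. exact: ltr01. Qed.
Let ltN10 : -1 < 0 :> R. Proof. by rewrite ltrN10. Qed.
Let a0 : 0 <= a. Proof. by case/andP: a01. Qed.
Let a1 : a < 1. Proof. by case/andP: a01. Qed.
Let m2 : m < 2. Proof. by case/andP: m02. Qed.

Lemma flux_at_1 : P 1 = - (gamma * u 1 + v 1).
Proof. by have := wd_1 wd; lra. Qed.

Let EP_E (x : R) : 0 < x < 1 -> Du x = pwM 0 (- (a / 2)) P x.
Proof.
move=> /[dup] /andP[x0 _] x01; rewrite /pwM (wd_PE wd)// /pwM mulrA -pwD//.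
by congr (pw _ _ _ * _); field.
Qed.

Let EQ_E (x : R) : -1 < x < 0 -> Dw x = pwM (-1) (- (m / 2)) Q x.
Proof.
move=> /[dup] /andP[x0 _] x01; rewrite /pwM (wd_QE wd)// /pwM mulrA -pwD//.
by congr (pw _ _ _ * _); field.
Qed.

Let EP2 : l2 0 1 (pwM 0 (- (a / 2)) P).
Proof. exact: l2_ext EP_E (wd_du2 wd). Qed.

Let EQ2 : l2 (-1) 0 (pwM (-1) (- (m / 2)) Q).
Proof. exact: l2_ext EQ_E (wd_dw2 wd). Qed.

Let pwa2 : l2 0 1 (pw 0 (- (a / 2)) : R -> R).
Proof. by apply: l2_pw => //; have := a1; lra. Qed.

Let EG_E x : pwM 0 (- (a / 2)) P x + gamma * u 1 * pw 0 (- (a / 2)) x = EG x.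
Proof. by rewrite /pwM; ring. Qed.

Let EG2 : l2 0 1 EG.
Proof. by apply: l2_ext (l2D EP2 (l2Z (gamma * u 1) pwa2)) => x _; exact: EG_E. Qed.

Let G_prim : primitive 0 1 G dP.
Proof.
apply: primitive_ext (primitiveD (wd_P wd) (primitive_cst 0 1 (gamma * u 1))) => //.
by move=> x _ /=; rewrite addr0.
Qed.

Let ip_extr (p q : R) (f g g' : R -> R) : (forall x, p < x < q -> g x = g' x) ->
  ip p q f g = ip p q f g'.
Proof. by move=> gg; apply: rint_ext => x /gg ->. Qed.

Let ip_extl (p q : R) (f f' g : R -> R) : (forall x, p < x < q -> f x = f' x) ->
  ip p q f g = ip p q f' g.
Proof. by move=> gg; apply: rint_ext => x /gg ->. Qed.

Let greena (f df : R -> R) (f0 : R) : primitive 0 1 f df -> l2 0 1 f ->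
  l2 0 1 (pwM 0 (a / 2) df) -> f x @[x --> 0^'+] --> f0 ->
  ip 0 1 dP f + ip 0 1 Du (pwM 0 (a / 2) df) = P 1 * f 1 - P0 * f0.
Proof.
move=> fdf f2 df2 ff0; rewrite (ip_extl _ EP_E).
by apply: (@green_traces _ _ _ a) (wd_P wd) fdf (wd_dP2 wd) f2 EP2 df2 (wd_P0 wd) ff0.
Qed.

Let greenb (f df : R -> R) : primitive (-1) 0 f df -> l2 (-1) 0 f ->
  l2 (-1) 0 (pwM (-1) (m / 2) df) -> (m < 1 -> f x @[x --> (-1)^'+] --> (0 : R)) ->
  ip (-1) 0 dQ f + ip (-1) 0 Dw (pwM (-1) (m / 2) df) = P0 * f 0.
Proof.
move=> fdf f2 df2 ff0; rewrite (ip_extl _ EQ_E) -(wd_Q0 wd).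
have [m1|m1] := ltP m 1; last first.
  exact: green_strong ltN10 m1 (wd_Q wd) fdf (wd_dQ2 wd) f2 EQ2 df2.
have Ql := primitive_cvg ltN10 (wd_Q wd) (l2_rintegrable (wd_dQ2 wd)).
rewrite (@green_traces _ _ _ m _ _ _ _ _ _ ltN10 (wd_Q wd) fdf (wd_dQ2 wd) f2 EQ2
  df2 Ql (ff0 m1)).
by rewrite mulr0 subr0.
Qed.

(** The two Green identities are added: the transmission conditions cancel the interface terms
    [P0 v0], and the condition at 1 turns [P 1 v 1 + gamma u 1 v 1] into [- v(1)^2]. *)
Lemma energy_identity :
  ip 0 1 v dP + ip 0 1 Du Dv + ip (-1) 0 y dQ + ip (-1) 0 Dw Dy
    + gamma * u 1 * v 1 = - v 1 ^+ 2.
Proof.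
have ea := greena (wd_v wd) (wd_v2 wd) (wd_dv2 wd) (wd_v0 wd).
have eb := greenb (wd_y wd) (wd_y2 wd) (wd_dy2 wd) (wd_yN1 wd).
rewrite (wd_y0 wd) in eb; rewrite (ipC _ _ v) (ipC _ _ y).
rewrite flux_at_1 in ea; lra.
Qed.

Lemma rellich_a :
  wip 0 1 (1 - a / 2) v Dv + wip 0 1 (1 - a / 2) dP Du =
    (v 1 ^+ 2 + P 1 ^+ 2) / 2 - ip 0 1 v v / 2 - (1 - a) / 2 * ip 0 1 Du Du.
Proof.
have a2 : a <= 2 by have := a1; lra.
rewrite (kinetic_rellich q1 a2 (wd_v wd) (wd_v2 wd) (wd_dv2 wd)).
rewrite [wip _ _ _ dP _](ip_extr _ EP_E).
rewrite [ip _ _ (pwM _ _ dP) _](potential_rellich q1 a2 (wd_P wd) (wd_dP2 wd) EP2).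
rewrite (ip_extl _ EP_E) (ip_extr _ EP_E); lra.
Qed.

(** [G = P + gamma u(1)] has the same derivative as [P] and the value [- v(1)] at 1, so no [u(1)^2]
    is left at the boundary. The price is the extra moment of [dP] against [x^(1 - a)], for which
    [shifted_form] contains the corresponding moment of [v]. *)
Lemma shifted_rellich_a :
  wip 0 1 (1 - a / 2) v Dv + wip 0 1 (1 - a / 2) dP Du
    + gamma * u 1 * ip 0 1 (pw 0 (1 - a)) dP =
    v 1 ^+ 2 - ip 0 1 v v / 2 - (1 - a) / 2 * ip 0 1 EG EG.
Proof.
have a2 : a <= 2 by have := a1; lra.
rewrite (kinetic_rellich q1 a2 (wd_v wd) (wd_v2 wd) (wd_dv2 wd)).
have := potential_rellich q1 a2 G_prim (wd_dP2 wd) EG2.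
have -> : P 1 + gamma * u 1 = - v 1 by rewrite flux_at_1; ring.
have -> : wip 0 1 (1 - a / 2) dP EG = wip 0 1 (1 - a / 2) dP Du
    + gamma * u 1 * ip 0 1 (pw 0 (1 - a)) dP.
  have s0 : 0 <= 1 - a / 2 by lra.
  have d2 := l2_pwM s0 (wd_dP2 wd).
  rewrite /wip (ipC _ _ _ EG) (ipC _ _ _ Du) (ip_extl _ EP_E).
  rewrite -[LHS](ip_extl _ (fun x _ => EG_E x)) ipDl ?ipZl//; last exact: l2Z.
  congr (_ + _ * _); apply: rint_ext => x /andP[x0 _].
  by rewrite /pwM mulrA -pwD//; congr (pw _ _ _ * _); field.
rewrite sqrrN; lra.
Qed.

(** The term with factor [m / 4] equalises the coefficients: [- 1/2 + m/4] for the kinetic and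
    [- (1 - m)/2 - m/4] for the potential energy both equal [- (2 - m)/4], negative up to [m < 2],
    whereas [- (1 - m)/2] alone changes sign at 1. *)
Lemma rellich_b :
  wip (-1) 0 (1 - m / 2) y Dy + wip (-1) 0 (1 - m / 2) dQ Dw
    + m / 4 * (ip (-1) 0 y y + ip (-1) 0 dQ w) =
    (v0 ^+ 2 + P0 ^+ 2) / 2 + m / 4 * (P0 * u0)
      - (2 - m) / 4 * (ip (-1) 0 y y + ip (-1) 0 Dw Dw).
Proof.
have m2' := ltW m2.
rewrite (kinetic_rellich q0 m2' (wd_y wd) (wd_y2 wd) (wd_dy2 wd)).
rewrite [wip _ _ _ dQ _](ip_extr _ EQ_E).
rewrite [ip _ _ (pwM _ _ dQ) _](potential_rellich q0 m2' (wd_Q wd) (wd_dQ2 wd) EQ2).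
have := greenb (wd_w wd) (wd_w2 wd) (wd_dw2 wd) (wd_wN1 wd).
rewrite (wd_w0 wd) => /(canRL (addrK _)) ->.
rewrite -(ip_extr _ EQ_E) -(ip_extl _ EQ_E) (wd_y0 wd) (wd_Q0 wd); lra.
Qed.

(** For [m < 1] the profile [psi = (x + 1)^(1 - m)] vanishes at -1, in accordance with the Dirichlet
    condition there. For [1 <= m] the flux is 0 and both profiles are the constant 1. *)
Definition kap : R := if m < 1 then 1 - m else 0.
Definition phi x : R := 1 + kap / (1 - a) * pw 0 (1 - a) x.
Definition psi : R -> R := pw (-1) kap.

Let kap_ge0 : 0 <= kap.
Proof. by rewrite /kap; case: ltP => // m1; rewrite subr_ge0 ltW. Qed.

(* phi and psi solve (x^a phi')' = 0 and ((x + 1)^m psi')' = 0 with a common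
   flux kap, so that only boundary terms remain. *)
Lemma static_moment :
  ip 0 1 phi dP + ip (-1) 0 psi dQ + phi 1 * v 1 = - (gamma * phi 1 + kap) * u 1.
Proof.
have phi_prim : primitive 0 1 phi (fun x => kap * pw 0 (- a) x).
  have := primitiveD (primitive_cst 0 1 1)
    (primitiveZ (kap / (1 - a)) (primitive_pw 0 1 (1 - a))).
  apply: primitive_ext => // x _; rewrite add0r mulrA divfK ?subr_eq0 ?gt_eqF//.
  by congr (_ * pw _ _ _); ring.
have phi2 : l2 0 1 phi.
  by apply: l2D (l2_cst 0 1 1) (l2Z _ (l2_pw _ _)) => //; have := a1; lra.
have Dphi_E x : 0 < x < 1 -> kap * pw 0 (- (a / 2)) x =
    pwM 0 (a / 2) (fun x => kap * pw 0 (- a) x) x.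
  by move=> /andP[x0 _]; rewrite /pwM mulrCA -pwD//; congr (_ * pw _ _ _); field.
have Dphi2 := l2_ext Dphi_E (l2Z kap pwa2).
have phi0 : phi x @[x --> 0^'+] --> (1 : R).
  have := weak_cvg lt01 a1 phi_prim Dphi2.
  rewrite rintZ; last by apply: rintegrable_pw => //; have := a1; lra.
  rewrite rint_pw//; last by have := a1; lra.
  by rewrite (addrC (- a)) /phi mulrA mulrAC addrK.
have psi_prim : primitive (-1) 0 psi (fun x => kap * pw (-1) (kap - 1) x).
  exact: primitive_pw.
have psi2 : l2 (-1) 0 psi by apply: l2_pw => //; have k0 := kap_ge0; lra.
have Dpsi_E x : -1 < x < 0 -> kap * pw (-1) (- (m / 2)) x =
    pwM (-1) (m / 2) (fun x => kap * pw (-1) (kap - 1) x) x.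
  move=> /andP[x0 _]; rewrite /pwM mulrCA -pwD// /kap.
  case: ifPn => // _; last by rewrite !mul0r.
  by congr (_ * pw _ _ _); field.
have Dpsi2 : l2 (-1) 0 (pwM (-1) (m / 2) (fun x => kap * pw (-1) (kap - 1) x)).
  apply: (l2_ext Dpsi_E); rewrite /kap; case: ltP => m1.
    by apply: l2Z; apply: l2_pw => //; lra.
  by apply: l2_ext (l2_cst (-1) 0 0) => x _; rewrite mul0r.
have psi0 : m < 1 -> psi x @[x --> (-1)^'+] --> (0 : R).
  move=> m1; have k0 : 0 < kap by rewrite /kap m1 subr_gt0.
  have := weak_cvg ltN10 m1 psi_prim Dpsi2.
  have k1 : -1 < kap - 1 by lra.
  rewrite rintZ; last exact: rintegrable_pw.
  by rewrite rint_pw// subrK mulrC divfK ?gt_eqF// subrr.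
have psi_0 : psi 0 = 1 by rewrite /psi /pw sub0r opprK powR1.
have iu : ip 0 1 Du (pwM 0 (a / 2) (fun x => kap * pw 0 (- a) x)) = kap * (u 1 - u0).
  rewrite -(ip_extr _ Dphi_E) ipC ipZl//; last exact: wd_du2 wd.
  rewrite (weak_rint lt01 a1 (wd_u wd) (wd_du2 wd) (wd_u0 wd))//.
  congr (_ * _); apply: rint_ext => x /andP[x0 _].
  by rewrite /pwM mulrA -pwD// addNr pw0 mul1r.
have iw : ip (-1) 0 Dw (pwM (-1) (m / 2) (fun x => kap * pw (-1) (kap - 1) x))
    = kap * u0.
  rewrite -(ip_extr _ Dpsi_E) /kap; case: ltP => m1; last first.
    rewrite mul0r /ip (rint_ext (g := fun=> 0)) ?rint_cst ?mul0r// ?ltW//.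
    by move=> x _; rewrite mul0r mulr0.
  rewrite ipC ipZl//; [|by apply: l2_pw => //; lra|exact: wd_dw2 wd].
  have := weak_rint ltN10 m1 (wd_w wd) (wd_dw2 wd) (wd_wN1 wd m1) ltN10 (lexx 0).
  rewrite subr0 (wd_w0 wd) => ->.
  congr (_ * _); apply: rint_ext => x /andP[x0 _].
  by rewrite /pwM mulrA -pwD// addNr pw0 mul1r.
rewrite (ipC _ _ phi) (ipC _ _ psi).
apply: (@static_combine _ _ P0 (phi 1) u0).
  rewrite -flux_at_1 -iu.
  by rewrite (greena phi_prim phi2 Dphi2 phi0) mulr1.
by rewrite -iw (greenb psi_prim psi2 Dpsi2 psi0) psi_0 mulr1.
Qed.

Lemma trace_v h : 0 < h <= 1 ->
  v0 ^+ 2 <= 2 / h * ip 0 1 v v + 2 * (h `^ (1 - a) / (1 - a)) * ip 0 1 Dv Dv.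
Proof.
move=> h01; exact: trace_bound q1 a01 h01 (wd_v wd) (wd_v2 wd) (wd_dv2 wd) (wd_v0 wd).
Qed.

Let G2 : l2 0 1 G.
Proof. apply: l2D (l2_cst 0 1 _); apply: l2_pwM_inv lt01 _ EP2; by rewrite divr_ge0. Qed.

Let ip_G_EG : ip 0 1 G G <= ip 0 1 EG EG.
Proof.
apply: le_rint; [exact: l2_ip|exact: l2_ip|move=> x /andP[x0 x1]].
have r1 : 1 <= pw 0 (- (a / 2)) x.
  rewrite pwN// invf_ge1 ?pw_gt0// /pw subr0.
  have : x `^ (a / 2) <= 1 `^ (a / 2).
    by apply: ge0_ler_powR; rewrite ?nnegrE ?divr_ge0// ltW.
  by rewrite powR1.
by rewrite /pwM mulrACA ler_peMl ?mulr_ege1// -expr2 sqr_ge0.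
Qed.

(** The flux has an unweighted L^2 derivative, so [trace_bound] is used with [m = 0], and
    [h <= h^(1 - a)]. It is applied to [G] rather than to [P] because the norm of [EG], which
    dominates that of [G], is what [shifted_rellich_a] dissipates. *)
Lemma trace_P h : 0 < h <= 1 -> P0 ^+ 2 <=
  4 / h * ip 0 1 EG EG + 4 * h `^ (1 - a) * ip 0 1 dP dP + 2 * (gamma * u 1) ^+ 2.
Proof.
move=> /[dup] h01 /andP[h0 h1].
have GG0 : G x @[x --> 0^'+] --> P0 + gamma * u 1.
  by apply: cvgD; [exact: wd_P0 wd|exact: cvg_cst].
have dPE : pwM 0 (0 / 2) dP = dP by rewrite mul0r pwM0.
have dP2 : l2 0 1 (pwM 0 (0 / 2) dP) by rewrite dPE; exact: wd_dP2 wd.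
have zz : 0 <= (0 : R) < 1 by rewrite lexx.
have := trace_bound q1 zz h01 G_prim G2 dP2 GG0.
rewrite dPE subr0 divr1 => le1.
have hh : h `^ 1 <= h `^ (1 - a).
  by apply: ger_powR; rewrite ?h0// gerBl.
have le2 := ler_wpM2r (ip_ge0 0 1 dP) hh.
have r0 : 0 <= 2 / h by rewrite divr_ge0// ltW.
have le3 := ler_wpM2l r0 ip_G_EG.
move: le1 le2 le3; move: (h `^ _) (h `^ _) (ip 0 1 _ _) (ip 0 1 _ _) (ip 0 1 _ _).
move=> h2 h3 A B C le1 le2 le3.
(* Equivalent to [P0^2 <= 2 (P0 + gamma u(1))^2 + 2 (gamma u(1))^2]. *)
have := sqr_ge0 (P0 + 2 * (gamma * u 1)).
lra.
Qed.

Lemma trace_u : u0 ^+ 2 <= 2 * u 1 ^+ 2 + 2 / (1 - a) * ip 0 1 Du Du.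
Proof.
have := weighted_increment q1 a01 (wd_u wd) (wd_du2 wd) (wd_u0 wd) lt01 (lexx 1).
have -> : pw 0 (1 - a) 1 = 1 :> R by rewrite /pw subr0 powR1.
move: (ip _ _ _ _) => A; rewrite div1r.
have := sqr_ge0 (2 * u 1 - u0); lra.
Qed.

(** Recovers the true potential energy from the shifted one; [1 / (1 - a)] is the integral of
    [x^(- a)]. *)
Lemma flux_shift :
  ip 0 1 Du Du <= 2 * ip 0 1 EG EG + 2 * (gamma * u 1) ^+ 2 / (1 - a).
Proof.
have pwi : rintegrable 0 1 (pw 0 (- a) : R -> R).
  by apply: rintegrable_pw => //; have := a1; lra.
have -> : 2 * (gamma * u 1) ^+ 2 / (1 - a) =
    rint 0 1 (fun x => 2 * (gamma * u 1) ^+ 2 * pw 0 (- a) x).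
  rewrite rintZ// rint_pw//; last by have := a1; lra.
  rewrite (_ : - a + 1 = 1 - a); last by ring.
  by rewrite /pw subr0 powR1 div1r.
have EGi := l2_ip EG2 EG2; rewrite [X in 2 * X]/ip -rintZ// -rintD//; last 2 first.
- exact: rintegrableZ.
- exact: rintegrableZ.
apply: le_rint; [exact: l2_ip (wd_du2 wd) (wd_du2 wd)|
  by apply: rintegrableD; exact: rintegrableZ|].
move=> x /[dup] x01 /andP[x0 _]; rewrite EP_E//.
have -> : pw 0 (- a) x = pw 0 (- (a / 2)) x * pw 0 (- (a / 2)) x.
  by rewrite -pwD//; congr pw; field.
rewrite /pwM; move: (pw _ _ _) (P x) (gamma * u 1) => r p z.
have := sqr_ge0 (r * p + 2 * r * z); lra.
Qed.

End Identities.
End Multipliers.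

(** * The two multiplier inequalities *)

Section MultiplierInequalities.
Context {R : realType}.
Variables (gamma a m : R).
Hypotheses (gamma_gt0 : 0 < gamma) (a01 : 0 <= a < 1) (m02 : 0 <= m < 2).

Let kap_ge0 : 0 <= kap m.
Proof. by rewrite /kap; case: ltP => // m1; rewrite subr_ge0 ltW. Qed.

Let alpha_gt0 : 0 < 1 - a. Proof. by rewrite subr_gt0; case/andP: a01. Qed.

Let phi_1 : phi a m 1 = 1 + kap m / (1 - a).
Proof. by rewrite /phi /pw subr0 powR1 mulr1. Qed.

Let phi_1_gt0 : 0 < phi a m 1.
Proof. by rewrite phi_1 ltr_wpDr// divr_ge0// ltW. Qed.

Lemma l2_phi : l2 0 1 (phi a m).
Proof.
apply: l2D (l2_cst 0 1 1) (l2Z _ (l2_pw _ _)) => //.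
by have := alpha_gt0; lra.
Qed.

Lemma l2_psi : l2 (-1) 0 (psi m : R -> R).
Proof.
apply: l2_pw; first by rewrite ltrN10.
by have := kap_ge0; lra.
Qed.

Let Cm : R := 3 * (ip 0 1 (phi a m) (phi a m) + ip (-1) 0 (psi m) (psi m)
  + phi a m 1 ^+ 2 / gamma) + 1.

Let sum3_sqr (x y z : R) : (x + y + z) ^+ 2 <= 3 * (x ^+ 2 + y ^+ 2 + z ^+ 2).
Proof.
by have := sqr_ge0 (x - y); have := sqr_ge0 (y - z); have := sqr_ge0 (x - z); lra.
Qed.

Let moment_combine (A B f i1 i2 fz X' Y' Z X Y E : R) :
  0 <= A -> 0 <= B -> 0 <= f -> 0 <= X -> 0 <= Y -> 0 <= X' -> 0 <= Y' -> 0 <= Z ->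
  i1 <= A * X' -> i2 <= B * Y' -> fz = f * Z -> E = X' + X + (Y' + Y) + Z ->
  3 * (i1 + i2 + fz) <= (3 * (A + B + f) + 1) * E.
Proof.
move=> A0 B0 f0 X0 Y0 X'0 Y'0 Z0 h1 h2 -> EE.
have E0 : 0 <= E by rewrite EE !addr_ge0.
have h3 : A * X' <= A * E by rewrite ler_wpM2l// EE; lra.
have h4 : B * Y' <= B * E by rewrite ler_wpM2l// EE; lra.
have h5 : f * Z <= f * E by rewrite ler_wpM2l// EE; lra.
lra.
Qed.

Let moment_bound (v y : R -> R) (z X Y : R) : l2 0 1 v -> l2 (-1) 0 y ->
  0 <= X -> 0 <= Y ->
  (ip 0 1 (phi a m) v + ip (-1) 0 (psi m) y + phi a m 1 * z) ^+ 2 <=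
    Cm * (ip 0 1 v v + X + (ip (-1) 0 y y + Y) + gamma * z ^+ 2).
Proof.
move=> v2 y2 X0 Y0; apply: le_trans (sum3_sqr _ _ _) _.
have c1 := ip_cauchy_schwarz l2_phi v2; have c2 := ip_cauchy_schwarz l2_psi y2.
apply: (@moment_combine _ _ _ _ _ _ _ _ (gamma * z ^+ 2) X Y) c1 c2 _ _ => //;
  do ?exact: ip_ge0.
- by rewrite divr_ge0 ?sqr_ge0// ltW.
- by rewrite mulr_ge0 ?sqr_ge0// ltW.
- by rewrite exprMn mulrA divfK// gt_eqF.
Qed.

Let weight_ip_bound (v : R -> R) : l2 0 1 v ->
  ip 0 1 (pw 0 (1 - a)) v ^+ 2 <= ip 0 1 v v.
Proof.
move=> v2; have al0 := ltW alpha_gt0.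
have p2 : l2 0 1 (pw 0 (1 - a) : R -> R).
  by apply: l2_pw => //; have := alpha_gt0; lra.
apply: le_trans (ip_cauchy_schwarz p2 v2) _.
rewrite ler_piMl ?ip_ge0//.
have := le_rint (l2_ip p2 p2) (rintegrable_cst 0 1 (1 : R)).
rewrite rint_cst// subr0 mulr1; apply=> x x01.
have := pw_bounded al0 x01; rewrite {2}/pw subr0 powR1.
have /andP[x0 _] := x01; rewrite gtr0_norm ?pw_gt0// => h.
by rewrite mulr_ile1// ltW// pw_gt0.
Qed.

Local Notation Da := (pwM 0 (a / 2)).
Local Notation Dm := (pwM (-1) (m / 2)).

(** The left side is the derivative of the first Lyapunov form before a multiple of the energy is
    added to it. [rellich_b] leaves interface traces; [trace_v], [trace_P] and [trace_u] bound them,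
    and [K2 / h] times [shifted_rellich_a] pays for the resulting [1 / h]. The terms in [u(1)^2] are
    paid by [static_moment]. *)
Lemma first_multiplier : exists K1 K2 c C L : R,
  [/\ 0 < K1, 0 < K2, 0 < c, 0 < C & 0 < L] /\
  forall (u du v dv P dP w dw y dy Q dQ : R -> R) (u0 v0 P0 h : R),
  wave_data gamma a m u du v dv P dP w dw y dy Q dQ u0 v0 P0 -> 0 < h <= 1 ->
  wip (-1) 0 (1 - m / 2) y (Dm dy) + wip (-1) 0 (1 - m / 2) dQ (Dm dw)
    + m / 4 * (ip (-1) 0 y y + ip (-1) 0 dQ w)
  + K1 * (v 1 * (ip 0 1 (phi a m) v + ip (-1) 0 (psi m) y + phi a m 1 * u 1)
    + u 1 * (ip 0 1 (phi a m) dP + ip (-1) 0 (psi m) dQ + phi a m 1 * v 1))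
  + K2 / h * (wip 0 1 (1 - a / 2) v (Da dv) + wip 0 1 (1 - a / 2) dP (Da du)
    + gamma * (v 1 * ip 0 1 (pw 0 (1 - a)) v + u 1 * ip 0 1 (pw 0 (1 - a)) dP)) <=
  - (c * (ip 0 1 v v + ip 0 1 (Da du) (Da du) + (ip (-1) 0 y y + ip (-1) 0 (Dm dw) (Dm dw))
      + gamma * u 1 ^+ 2))
  + C * h `^ (1 - a) * (ip 0 1 dP dP + ip 0 1 (Da dv) (Da dv)) + L / h * v 1 ^+ 2.
Proof.
have al1 : 0 < 1 - a <= 1 by rewrite alpha_gt0 gerBl; case/andP: a01.
have be1 : 0 < (2 - m) / 4 <= 2^-1 by case/andP: m02 => ? ?; apply/andP; split; lra.
have lam0 : 0 < gamma * phi a m 1 + kap m.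
  by rewrite ltr_wpDr// mulr_gt0.
have Cm0 : 0 < Cm.
  rewrite ltr_wpDl// mulr_ge0// !addr_ge0 ?ip_ge0//.
  by rewrite divr_ge0 ?sqr_ge0// ltW.
have [K1 [K2 [c [C [L [pos H]]]]]] := combine_multipliers gamma_gt0 al1 be1 lam0 Cm0.
exists K1, K2, c, C, L; split => //.
move=> u du v dv P dP w dw y dy Q dQ u0 v0 P0 h wd /[dup] h01 /andP[h0 h1].
have r1 : 1 <= h^-1 by rewrite invf_ge1.
have hl0 : 0 <= h `^ (1 - a) by exact: powR_ge0.
pose EG := pwM 0 (- (a / 2)) (fun x => P x + gamma * u 1).
have m4 : 0 <= m / 4 <= 2^-1 by case/andP: m02 => ? ?; apply/andP; split; lra.
have := H h^-1 (h `^ (1 - a)) (ip 0 1 v v) (ip 0 1 (Da du) (Da du)) (ip 0 1 (Da dv) (Da dv))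
  (ip 0 1 dP dP) (ip 0 1 EG EG) (ip (-1) 0 y y + ip (-1) 0 (Dm dw) (Dm dw)) (u 1) (v 1)
  v0 P0 u0 (ip 0 1 (pw 0 (1 - a)) v)
  (ip 0 1 (phi a m) v + ip (-1) 0 (psi m) y + phi a m 1 * u 1) (m / 4)
  r1 hl0 (ip_ge0 _ _ _) (ip_ge0 _ _ _) (ip_ge0 _ _ _) (ip_ge0 _ _ _) (ip_ge0 _ _ _)
  (addr_ge0 (ip_ge0 _ _ _) (ip_ge0 _ _ _)) m4.
move=> /(_ (trace_v a01 wd h01)) /(_ (trace_P a01 wd h01)) /(_ (trace_u a01 wd)).
move=> /(_ (flux_shift a01 wd)) /(_ (weight_ip_bound (wd_v2 wd))).
move=> /(_ (moment_bound _ (wd_v2 wd) (wd_y2 wd) (ip_ge0 _ _ _) (ip_ge0 _ _ _))).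
have eb := rellich_b m02 wd; have ea := shifted_rellich_a a01 wd.
have es := static_moment a01 wd.
rewrite -/EG in ea.
move=> fin; rewrite eb es.
have -> : wip 0 1 (1 - a / 2) v (Da dv) + wip 0 1 (1 - a / 2) dP (Da du) + gamma *
    (v 1 * ip 0 1 (pw 0 (1 - a)) v + u 1 * ip 0 1 (pw 0 (1 - a)) dP) =
    v 1 ^+ 2 - ip 0 1 v v / 2 - (1 - a) / 2 * ip 0 1 EG EG
    + gamma * v 1 * ip 0 1 (pw 0 (1 - a)) v by rewrite -ea; ring.
apply: le_trans _ fin; rewrite le_eqVlt; apply/orP; left; apply/eqP.
by congr (_ + _ * _ + _); ring.
Qed.

(** Here [P(1)^2 / 2 <= gamma^2 u(1)^2 + v(1)^2]. The term in [u(1)^2] is left as it is, since the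
    remainder form can carry it. *)
Lemma second_multiplier (u du v dv P dP w dw y dy Q dQ : R -> R) (u0 v0 P0 : R) :
  wave_data gamma a m u du v dv P dP w dw y dy Q dQ u0 v0 P0 ->
  wip 0 1 (1 - a / 2) v (Da dv) + wip 0 1 (1 - a / 2) dP (Da du) <=
    - (ip 0 1 v v / 2 + (1 - a) / 2 * ip 0 1 (Da du) (Da du))
    + gamma ^+ 2 * u 1 ^+ 2 + 3 / 2 * v 1 ^+ 2.
Proof.
move=> wd; rewrite (rellich_a a01 wd) (flux_at_1 wd) sqrrN.
have := sqr_ge0 (gamma * u 1 - v 1).
move: (ip _ _ _ _) (ip _ _ _ _) => X A; lra.
Qed.

End MultiplierInequalities.

(** * Bilinear forms built from square-integrable coordinates *)

Section CoordinateForms.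
Local Open Scope complex_scope.
Context {R : realType} {X : lmodType R[i]}.
Notation mu := (@lebesgue_measure R).
Variables (H : set X) (N : X -> R).
Implicit Types (U V W : X) (k : X -> R -> R) (z : X -> R) (B : X -> X -> R).

(** Linearity holds almost everywhere only: the pointwise derivative takes default values where a
    function is not differentiable, and such points depend on the function. *)
Definition l2_coordinate (p q : R) k : Prop :=
  [/\ forall U, H U -> l2 p q (k U),
      forall (c : R) U V, H U -> H V -> {ae mu, forall x, p < x < q ->
        k (c%:C *: U + V) x = c * k U x + k V x} &
      exists2 M, 0 <= M & forall U, H U -> ip p q (k U) (k U) <= M * N U ^+ 2].

Definition scalar_coordinate z : Prop :=
  (forall (c : R) U V, H U -> H V -> z (c%:C *: U + V) = c * z U + z V) /\
  exists2 M, 0 <= M & forall U, H U -> `|z U| <= M * N U.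

Let norm_le_of_sqr (x y : R) : 0 <= y -> x ^+ 2 <= y ^+ 2 -> `|x| <= y.
Proof.
move=> y0; rewrite -(real_normK (num_real x)) ler_sqr//.
Qed.

(** [M + M'] replaces the geometric mean of [M] and [M'], so that no square root enters the
    bounds. *)
Let geo_le (M M' s : R) : 0 <= M -> 0 <= M' -> 0 <= s ->
  M * M' * s ^+ 2 <= ((M + M') * s) ^+ 2.
Proof.
move=> M0 M'0 s0; rewrite exprMn ler_wpM2r ?sqr_ge0//.
have := sqr_ge0 M; have := sqr_ge0 M'; have := mulr_ge0 M0 M'0; lra.
Qed.

Lemma ip_linearl p q k (g : R -> R) (c : R) U V : l2 p q g ->
  (forall U, H U -> l2 p q (k U)) ->
  {ae mu, forall x, p < x < q -> k (c%:C *: U + V) x = c * k U x + k V x} ->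
  H U -> H V -> H (c%:C *: U + V) ->
  ip p q (k (c%:C *: U + V)) g = c * ip p q (k U) g + ip p q (k V) g.
Proof.
move=> g2 k2 kl HU HV HUV; have [mg _] := g2.
have [kU _] := k2 _ HU; have [kV _] := k2 _ HV.
rewrite -ipZl//; last exact: k2.
rewrite -ipDl//; [|by apply: l2Z; exact: k2|exact: k2].
apply: ip_ae; [exact: k2|exact: g2| |exact: mg|exact: kl|exact: aeW].
by apply: mfunD => //; apply: mfunM => //; exact: mfun_cst.
Qed.

Hypothesis Hsn : seminormed_module H N.

Lemma bounded_form_ip p q k k' : l2_coordinate p q k -> l2_coordinate p q k' ->
  bounded_form H N (fun U V => ip p q (k U) (k' V)).
Proof.
move=> [k2 kl [M M0 kM]] [k'2 k'l [M' M'0 k'M]]; split.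
- exists (M + M'); first exact: addr_ge0.
  move=> U V HU HV; have N0 := mulr_ge0 (seminorm_ge0 Hsn U) (seminorm_ge0 Hsn V).
  apply: norm_le_of_sqr; first by rewrite mulr_ge0// addr_ge0.
  apply: le_trans (ip_cauchy_schwarz (k2 _ HU) (k'2 _ HV)) _.
  apply: le_trans (geo_le M0 M'0 N0).
  apply: (@le_trans _ _ ((M * N U ^+ 2) * (M' * N V ^+ 2))).
    by apply: ler_pM; rewrite ?ip_ge0 ?kM ?k'M.
  by rewrite le_eqVlt; apply/orP; left; apply/eqP; ring.
- move=> c U V W HU HV HW; have HUV := seminorm_closed Hsn c%:C HU HV.
  by rewrite (ip_linearl (k'2 _ HW) k2)//; exact: kl.
- move=> c U V W HU HV HW; have HUV := seminorm_closed Hsn c%:C HU HV.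
  by rewrite !(ipC _ _ (k W)) (ip_linearl (k2 _ HW) k'2)//; exact: k'l.
Qed.

Lemma bounded_form_mul z z' : scalar_coordinate z -> scalar_coordinate z' ->
  bounded_form H N (fun U V => z U * z' V).
Proof.
move=> [zl [M M0 zM]] [z'l [M' M'0 z'M]]; split.
- exists (M * M'); first exact: mulr_ge0.
  move=> U V HU HV; rewrite normrM mulrACA.
  by apply: ler_pM; rewrite ?normr_ge0 ?zM ?z'M.
- by move=> c U V W HU HV HW; rewrite zl//; ring.
- by move=> c U V W HU HV HW; rewrite z'l//; ring.
Qed.

Lemma bounded_formD B B' : bounded_form H N B -> bounded_form H N B' ->
  bounded_form H N (fun U V => B U V + B' U V).
Proof.
move=> [[M M0 BM] Bl Br] [[M' M'0 B'M] B'l B'r]; split.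
- exists (M + M'); first exact: addr_ge0.
  move=> U V HU HV; rewrite mulrDl (le_trans (ler_normD _ _))//.
  by rewrite lerD ?BM ?B'M.
- by move=> c U V W HU HV HW; rewrite Bl// B'l//; ring.
- by move=> c U V W HU HV HW; rewrite Br// B'r//; ring.
Qed.

Lemma bounded_formZ (c : R) B : bounded_form H N B ->
  bounded_form H N (fun U V => c * B U V).
Proof.
move=> [[M M0 BM] Bl Br]; split.
- exists (`|c| * M); first exact: mulr_ge0.
  by move=> U V HU HV; rewrite normrM -mulrA ler_wpM2l ?BM.
- by move=> d U V W HU HV HW; rewrite Bl//; ring.
- by move=> d U V W HU HV HW; rewrite Br//; ring.
Qed.

Lemma l2_coordinate_pwM p q s k : q = p + 1 -> 0 <= s -> l2_coordinate p q k ->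
  l2_coordinate p q (fun U => pwM p s (k U)).
Proof.
move=> qE s0 [k2 kl [M M0 kM]]; split.
- by move=> U HU; apply: l2_pwM => //; exact: k2.
- move=> c U V HU HV.
  apply: (@filterS _ _ (ae_filter_ringOfSetsType mu)) (kl c U V HU HV) => x E /E.
  by rewrite /pwM => ->; ring.
- exists M => // U HU; apply: le_trans (kM _ HU); have kU := k2 _ HU.
  apply: le_rint; [by apply: l2_ip; exact: l2_pwM|exact: l2_ip|].
  move=> x /[dup] xpq /andP[px _]; have := pw_bounded s0 xpq.
  rewrite {2}/pw (_ : q - p = 1) ?powR1; last by rewrite qE; ring.
  rewrite gtr0_norm ?pw_gt0// => le1.
  rewrite /pwM mulrACA ler_piMl -?expr2 ?sqr_ge0// expr_le1// ltW// pw_gt0//.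
Qed.

Lemma scalar_coordinate_ip p q g k : l2 p q g -> l2_coordinate p q k ->
  scalar_coordinate (fun U => ip p q g (k U)).
Proof.
move=> g2 [k2 kl [M M0 kM]]; split.
- move=> c U V HU HV; have HUV := seminorm_closed Hsn c%:C HU HV.
  by rewrite !(ipC _ _ g) (ip_linearl g2 k2)//; exact: kl.
- exists (ip p q g g + M); first by rewrite addr_ge0 ?ip_ge0.
  move=> U HU; have N0 := seminorm_ge0 Hsn U.
  apply: norm_le_of_sqr; first by rewrite mulr_ge0// addr_ge0 ?ip_ge0.
  apply: le_trans (ip_cauchy_schwarz g2 (k2 _ HU)) _.
  apply: le_trans (geo_le (ip_ge0 _ _ _) M0 N0).
  by rewrite -mulrA ler_wpM2l ?ip_ge0 ?kM.
Qed.

Lemma scalar_coordinateD z z' : scalar_coordinate z -> scalar_coordinate z' ->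
  scalar_coordinate (fun U => z U + z' U).
Proof.
move=> [zl [M M0 zM]] [z'l [M' M'0 z'M]]; split.
  by move=> c U V HU HV; rewrite zl// z'l//; ring.
exists (M + M'); first exact: addr_ge0.
move=> U HU; rewrite mulrDl (le_trans (ler_normD _ _))//.
by rewrite lerD ?zM ?z'M.
Qed.

Lemma scalar_coordinateZ (c : R) z : scalar_coordinate z ->
  scalar_coordinate (fun U => c * z U).
Proof.
move=> [zl [M M0 zM]]; split.
  by move=> d U V HU HV; rewrite zl//; ring.
exists (`|c| * M); first exact: mulr_ge0.
by move=> U HU; rewrite normrM -mulrA ler_wpM2l ?zM.
Qed.

End CoordinateForms.

(** * Real and imaginary parts *)

Section Parts.
Local Open Scope complex_scope.
Context {R : realType}.
Notation mu := (@lebesgue_measure R).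
Implicit Types (f g u : R -> R[i]^o) (p q s : R) (b : bool).

(** The system has real coefficients, so both parts satisfy the same real estimates; the boolean
    states them once. *)
Definition part b (z : R[i]) : R := if b then complex.Re z else complex.Im z.

Lemma partD b (z w : R[i]) : part b (z + w) = part b z + part b w.
Proof. by case: b; case: z => ? ?; case: w. Qed.

Lemma partN b (z : R[i]) : part b (- z) = - part b z.
Proof. by case: b; case: z. Qed.

Lemma partB b (z w : R[i]) : part b (z - w) = part b z - part b w.
Proof. by rewrite partD partN. Qed.

Lemma part0 b : part b 0 = 0.
Proof. by case: b. Qed.

Lemma partZ b (c : R) (z : R[i]) : part b (c%:C * z) = c * part b z.
Proof. by case: b; case: z => x y /=; rewrite !mul0r ?subr0 ?addr0. Qed.

Lemma part_inj (z w : R[i]) : (forall b, part b z = part b w) -> z = w.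
Proof.
move=> H; have := H true; have := H false.
by case: z {H} => ? ?; case: w => ? ? /= -> ->.
Qed.

Lemma partM b (c z : R[i]) : part b (c * z) =
  complex.Re c * part b z + (if b then - complex.Im c else complex.Im c) * part (~~ b) z.
Proof. by case: b; case: c => ? ?; case: z => ? ? /=; ring. Qed.

Lemma normc_sqr (z : R[i]) : normc z ^+ 2 = part true z ^+ 2 + part false z ^+ 2.
Proof.
case: z => x y; rewrite /normc normc_def /= sqr_sqrtr//.
by rewrite addr_ge0// sqr_ge0.
Qed.

Lemma normc_ge0 (z : R[i]) : 0 <= normc z.
Proof. by case: z => x y; rewrite /normc normc_def /= sqrtr_ge0. Qed.

Lemma normcE (z : R[i]) : (normc z)%:C = `|z|.
Proof. by case: z => x y; rewrite /normc normc_def. Qed.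

Lemma normcD (z w : R[i]) : normc (z + w) <= normc z + normc w.
Proof. by rewrite -lecR rmorphD/= !normcE ler_normD. Qed.

Lemma normcM (z w : R[i]) : normc (z * w) = normc z * normc w.
Proof. by apply: complexI; rewrite rmorphM/= !normcE normrM. Qed.

Lemma normc_part b (z : R[i]) : `|part b z| <= normc z.
Proof.
rewrite -ler_sqr ?nnegrE ?normc_ge0// normc_sqr real_normK ?num_real//.
by case: b; rewrite ?lerDl ?lerDr sqr_ge0.
Qed.

Lemma normc_le_parts (z : R[i]) : normc z <= `|part true z| + `|part false z|.
Proof.
rewrite -ler_sqr ?nnegrE ?normc_ge0 ?addr_ge0// normc_sqr sqrrD !real_normK ?num_real//.
have := mulr_ge0 (normr_ge0 (part true z)) (normr_ge0 (part false z)); lra.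
Qed.

Lemma cvg_parts (F : set_system R) {FF : Filter F} f (l : R[i]^o) :
  (forall b, part b (f x) @[x --> F] --> part b l) -> f x @[x --> F] --> l.
Proof.
move=> H; apply/cvgrPdist_lt => e e0.
have er : e = (complex.Re e)%:C.
  by case: e e0 => x y; rewrite ltcE/= => /andP[/eqP yE _]; rewrite yE.
have e0' : 0 < complex.Re e by move: e0; rewrite {1}er ltcR.
have e20 : 0 < complex.Re e / 2 by exact: divr_gt0.
have Ht := H true; move/cvgrPdist_lt: Ht => /(_ _ e20) Ht.
have Hf := H false; move/cvgrPdist_lt: Hf => /(_ _ e20) Hf.
near=> x; rewrite -normcE er ltcR.
apply: le_lt_trans (normc_le_parts _) _; rewrite !partB [ltRHS]splitr.
by apply: ltrD; near: x.
Unshelve. all: by end_near. Qed.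

Lemma cvg_part (F : set_system R) {FF : Filter F} b f (l : R[i]^o) :
  f x @[x --> F] --> l -> part b (f x) @[x --> F] --> part b l.
Proof.
move=> /cvgrPdist_lt fl; apply/cvgrPdist_lt => e e0.
have e0' : 0 < (e%:C : R[i]) by rewrite ltcR.
apply: filterS (fl _ e0') => x; rewrite -normcE ltcR -partB.
exact: le_lt_trans (normc_part _ _).
Qed.

Lemma part_cderive b f x : part b (cderive f x) = derive1 (fun y => part b (f y)) x.
Proof. by case: b. Qed.

Lemma L2P p q f : L2 p q f <-> forall b, l2 p q (fun x => part b (f x)).
Proof.
split=> [[mr mi fi] b|f2].
  have fi' : rintegrable p q (fun x => normc (f x) ^+ 2).
    apply/integrableP; split.
      apply/measurable_EFinP; apply: mfun_ext (mfunD (mfunM mr mr) (mfunM mi mi)).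
      by move=> x _; rewrite normc_sqr !expr2.
    apply: le_lt_trans fi; rewrite le_eqVlt; apply/orP; left; apply/eqP.
    by apply: eq_integral => x _ /=; rewrite ger0_norm ?sqr_ge0.
  have mpb : mfun p q (fun x => part b (f x)) by case: (b).
  split=> //; apply: rintegrable_le fi'; first exact: (mfunM mpb mpb).
  move=> x _; rewrite ger0_norm ?sqr_ge0// -(real_normK (num_real (part _ _))).
  by rewrite lerXn2r ?nnegrE ?normc_ge0 ?normc_part.
have [mr ri] := f2 true; have [mi ii] := f2 false; split=> //.
have /integrableP[_] := rintegrableD ri ii; apply: le_lt_trans.
rewrite le_eqVlt; apply/orP; left; apply/eqP; apply: eq_integral => x _ /=.
by rewrite normc_sqr ger0_norm// addr_ge0 ?sqr_ge0.
Qed.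

Lemma sqnormL2_parts p q f : L2 p q f -> sqnormL2 p q f =
  ip p q (fun x => part true (f x)) (fun x => part true (f x)) +
  ip p q (fun x => part false (f x)) (fun x => part false (f x)).
Proof.
move=> /L2P f2; rewrite /ip -rintD; [|exact: l2_ip|exact: l2_ip].
by apply: rint_ext => x _; rewrite normc_sqr !expr2.
Qed.

Lemma L2_lin p q (c : R[i]) f g : L2 p q f -> L2 p q g ->
  L2 p q (fun x => c * f x + g x).
Proof.
move=> /L2P f2 /L2P g2; apply/L2P => b.
apply: l2_ext (l2D (l2D (l2Z (complex.Re c) (f2 b))
  (l2Z (if b then - complex.Im c else complex.Im c) (f2 (~~ b)))) (g2 b)).
by move=> x _; rewrite partD partM.
Qed.

Lemma real_ac_part p q f b : abs_continuous p q f ->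
  real_ac p q (fun x => part b (f x)).
Proof.
move=> fac e /fac[d d0 H]; exists d => // I s t [st tI] std.
have := H #|I| (s \o enum_val) (t \o enum_val) => /=.
have sumE (F : I -> R) : \sum_(i < #|I|) F (enum_val i) = \sum_i F i.
  by rewrite -big_enum_val.
rewrite (sumE (fun i => t i - s i)) => H'.
apply: le_lt_trans (H' _ _ std).
- rewrite (sumE (fun i => normc (f (t i) - f (s i)))).
  by apply: ler_sum => i _; rewrite -partB normc_part.
- by move=> i; exact: st.
- by move=> i j _ _ /(tI _ _ Logic.I Logic.I)/enum_val_inj.
Qed.

Lemma abs_continuous_lin p q (c : R[i]) f g :
  abs_continuous p q f -> abs_continuous p q g ->
  abs_continuous p q (fun x => c * f x + g x).
Proof.
move=> fac gac e e0; pose k := normc c + 1.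
have k0 : 0 < k by rewrite ltr_wpDl ?normc_ge0.
have [d d0 Hd] := fac _ (divr_gt0 (divr_gt0 e0 (ltr0Sn _ 1)) k0).
have [d' d'0 Hd'] := gac _ (divr_gt0 e0 (ltr0Sn _ 1)).
exists (Num.min d d'); first by rewrite lt_min d0.
move=> n s t st tI; rewrite lt_min => /andP[sd sd'].
have h1 := Hd _ _ _ st tI sd; have h2 := Hd' _ _ _ st tI sd'.
move: h1; rewrite ltr_pdivlMr// => h1.
rewrite [e]splitr; apply: le_lt_trans (ltrD h1 h2).
rewrite mulr_suml -big_split/=; apply: ler_sum => i _.
rewrite opprD addrACA -mulrBr (le_trans (normcD _ _))// lerD// normcM mulrC.
by rewrite ler_wpM2l ?normc_ge0// /k lerDl.
Qed.

(** The exceptional null sets on []c n, q[] are united along a sequence [c n] decreasing to [p];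
    measurability of the pointwise derivative is [mfun_derive1]. *)
Lemma loc_ac_primitive p q (f : R -> R) : p < q ->
  (forall c, p < c -> c <= q -> real_ac c q f) -> primitive p q f (derive1 f).
Proof.
move=> pq fac.
have fc x : p < x < q -> {for x, continuous f}.
  move=> /andP[px xq]; pose c := (p + x) / 2.
  have pc : p < c by rewrite /c; lra.
  have cx : c < x by rewrite /c; lra.
  have cq : c < q by lra.
  have [h [mh _ _ dh]] := real_ac_density cq (fac c pc (ltW cq)).
  apply: (@primitive_continuous _ c q f h) => //; split => //.
    exact: measurable_funTS.
  by move=> d cd dq; apply: fac => //; exact: lt_trans cd.
split => //; first exact: mfun_derive1.
(* The divisor starts at 2, so that [c n < q] already for [n = 0]. *)
pose c (n : nat) := p + (q - p) / n.+2%:R.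
have qp0 : 0 < q - p by rewrite subr_gt0.
have pc n : p < c n by rewrite ltrDl divr_gt0.
have cq n : c n < q.
  by rewrite /c -ltrBrDl ltr_pdivrMr// ltr_pMr// ltr1n.
have dn n : {ae mu, forall x, c n < x < q -> is_derive x 1 f (derive1 f x)}.
  have [h [_ _ _ dh]] := real_ac_density (cq n) (fac _ (pc n) (ltW (cq n))).
  apply: (@filterS _ _ (ae_filter_ringOfSetsType mu)) dh => x H /H{}H.
  by rewrite derive1E (@derive_val _ _ _ _ _ _ _ H).
have : mu.-negligible (\bigcup_n ~` [set x | c n < x < q -> is_derive x 1 f (derive1 f x)]).
  by apply: negligible_bigcup => n; exact: dn.
apply: negligibleS => x /= nx; apply: contrapT => H; apply: nx => /andP[px xq].
have [n cn] : exists n, c n < x.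
  have xp0 : 0 < x - p by rewrite subr_gt0.
  exists (Num.bound ((q - p) / (x - p))); rewrite /c -ltrBrDl.
  rewrite ltr_pdivrMr// mulrC -ltr_pdivrMr//.
  apply: lt_trans (archi_boundP _) _; first by rewrite divr_ge0// ltW.
  by rewrite ltr_nat.
by apply: contrapT => nd; apply: H; exists n => //= /(_ _)/nd; apply; rewrite cn.
Qed.

Lemma part_primitive p q b f : p < q -> loc_abs_continuous p q f ->
  primitive p q (fun x => part b (f x)) (derive1 (fun x => part b (f x))).
Proof.
move=> pq fac; apply: loc_ac_primitive => // c pc cq.
by apply: real_ac_part; apply: fac; rewrite pc.
Qed.

Lemma derive1_part_lin p q b (c : R[i]) f g : p < q ->
  loc_abs_continuous p q f -> loc_abs_continuous p q g ->
  {ae mu, forall x, p < x < q ->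
    derive1 (fun x => part b (c * f x + g x)) x =
    complex.Re c * derive1 (fun x => part b (f x)) x
    + (if b then - complex.Im c else complex.Im c) * derive1 (fun x => part (~~ b) (f x)) x
    + derive1 (fun x => part b (g x)) x}.
Proof.
move=> pq fac gac.
have [_ _ df] := primitiveD (primitiveD
  (primitiveZ (complex.Re c) (part_primitive b pq fac))
  (primitiveZ (if b then - complex.Im c else complex.Im c) (part_primitive (~~ b) pq fac)))
  (part_primitive b pq gac).
apply: (@filterS _ _ (ae_filter_ringOfSetsType mu)) df => x H /H{}H.
rewrite [LHS]derive1E -(@derive_val _ _ _ _ _ _ _ H).
by congr ('D_1 _ x); apply/funext => y; rewrite partD partM.
Qed.

Section WeightedSpaces.
Variables (alpha : R -> R) (p q s : R).
Hypotheses (pq : p < q)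
  (alphaE : forall x, p < x < q -> Num.sqrt (alpha x) = pw p s x).

Lemma V1P u : V1 alpha p q u <-> [/\ L2 p q u, loc_abs_continuous p q u &
  forall b, l2 p q (pwM p s (derive1 (fun x => part b (u x))))].
Proof.
have E b x : p < x < q -> pwM p s (derive1 (fun x => part b (u x))) x =
    part b (wmul (fun x => Num.sqrt (alpha x)) (cderive u) x).
  by move=> xpq; rewrite /wmul partZ alphaE// part_cderive.
split=> -[u2 uac du2]; split => //.
  move=> b; have /L2P/(_ b) := du2; apply: l2_ext => x xpq; exact/esym/E.
by apply/L2P => b; apply: l2_ext (du2 b) => x; exact: E.
Qed.

Lemma V1_lin (c : R[i]) u v : V1 alpha p q u -> V1 alpha p q v ->
  V1 alpha p q (fun x => c * u x + v x).
Proof.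
move=> /V1P[u2 uac du2] /V1P[v2 vac dv2]; apply/V1P.
have wac : loc_abs_continuous p q (fun x => c * u x + v x).
  by move=> d dpq; apply: abs_continuous_lin; [exact: uac|exact: vac].
split => //; first exact: L2_lin.
move=> b; have [mw _ dw] := part_primitive b pq wac.
apply: (l2_ae _ _ (l2D (l2D (l2Z (complex.Re c) (du2 b))
  (l2Z (if b then - complex.Im c else complex.Im c) (du2 (~~ b)))) (dv2 b))).
  by apply: mfunM => //; exact: mfun_pw.
apply: (@filterS _ _ (ae_filter_ringOfSetsType mu))
  (derive1_part_lin b c pq uac vac) => x H /H{}H.
by rewrite /pwM H; ring.
Qed.

Lemma weighted_sqnorm u : V1 alpha p q u ->
  sqnormL2 p q (wmul (fun x => Num.sqrt (alpha x)) (cderive u)) =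
  ip p q (pwM p s (derive1 (fun x => part true (u x))))
     (pwM p s (derive1 (fun x => part true (u x)))) +
  ip p q (pwM p s (derive1 (fun x => part false (u x))))
     (pwM p s (derive1 (fun x => part false (u x)))).
Proof.
move=> [u2 uac du2]; rewrite sqnormL2_parts//.
by congr (_ + _); apply: rint_ext => x xpq;
  rewrite /wmul !partZ alphaE// part_cderive.
Qed.

End WeightedSpaces.

End Parts.

(** * The energy space *)

Section QuadraticSeminorms.
Local Open Scope complex_scope.

Context {R : realType} {X : lmodType R[i]}.
Variables (H : set X) (N : X -> R) (B : X -> X -> R).

(** Real scalars suffice, [B] being in the application the real part of the inner product. The
    triangle inequality follows from Cauchy-Schwarz, obtained from the positivity of [N (t U + V)^2]
    in [t]. *)
Lemma quadratic_seminorm :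
  (forall (c : R[i]) U V, H U -> H V -> H (c *: U + V)) ->
  (forall U, 0 <= N U) -> (forall U, H U -> N U ^+ 2 = B U U) ->
  (forall U V, B U V = B V U) ->
  (forall (c : R) U V W, H U -> H V -> H W ->
    B (c%:C *: U + V) W = c * B U W + B V W) ->
  seminormed_module H N.
Proof.
move=> Hlin N0 NE BC Bl.
have H0 U : H U -> H 0 by move=> HU; have := Hlin (-1) _ _ HU HU; rewrite scaleN1r addNr.
have N2 c U V : H U -> H V ->
    N (c%:C *: U + V) ^+ 2 = c ^+ 2 * N U ^+ 2 + 2 * c * B U V + N V ^+ 2.
  move=> HU HV; have HUV := Hlin c%:C _ _ HU HV.
  by rewrite !NE// Bl// !(BC _ (_ + _)) !Bl// (BC V U); ring.
split => //.
- move=> U V HU HV; have := N2 1 U V HU HV; rewrite rmorph1 scale1r => NUV.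
  have CS : B U V ^+ 2 <= N U ^+ 2 * N V ^+ 2.
    rewrite mulrC; apply: nonneg_quadratic; rewrite ?sqr_ge0// => t.
    by have := N2 t U V HU HV; have := sqr_ge0 (N (t%:C *: U + V)); lra.
  have BN : B U V <= N U * N V.
    apply: le_trans (ler_norm _) _; rewrite -ler_sqr ?nnegrE ?mulr_ge0//.
    by rewrite real_normK ?num_real// exprMn.
  rewrite -ler_sqr ?nnegrE ?addr_ge0// NUV; lra.
- move=> c U HU; apply/eqP; rewrite -(eqrXn2 (n := 2))// ?mulr_ge0//.
  have := N2 c U 0 HU (H0 _ HU); rewrite addr0 => ->.
  have B0 : B U 0 = 0.
    have := Bl 1 0 0 U (H0 _ HU) (H0 _ HU) HU.
    by rewrite rmorph1 scale1r addr0 BC; lra.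
  have N00 : N 0 ^+ 2 = 0.
    rewrite NE; last exact: H0 HU.
    have := Bl 1 0 0 0 (H0 _ HU) (H0 _ HU) (H0 _ HU).
    by rewrite rmorph1 scale1r addr0; lra.
  by rewrite B0 N00 exprMn real_normK ?num_real// mulr0 !addr0.
Qed.

End QuadraticSeminorms.

Section EnergySpace.
Local Open Scope complex_scope.
Context {R : realType}.
Notation mu := (@lebesgue_measure R).
Variables (gamma mua mub : R).
Hypotheses (gamma_gt0 : 0 < gamma) (mua01 : 0 <= mua < 1) (mub02 : 0 <= mub < 2).
Notation H := (energy_space mua mub).
Notation N := (energy_norm gamma mua mub).
Implicit Types (U V W : state (R := R)) (b : bool).

Let lt01 : 0 < 1 :> R. Proof. exact: ltr01. Qed.
Let ltN10 : -1 < 0 :> R. Proof. by rewrite ltrN10. Qed.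

Lemma sqrt_pw p s (x : R) : p < x -> Num.sqrt (pw p s x) = pw p (s / 2) x.
Proof.
move=> px; have {1}-> : s = s / 2 * 2 by field.
by rewrite -pw_sqr// sqrtr_sqr gtr0_norm ?pw_gt0.
Qed.

Lemma waE (x : R) : wa mua x = pw 0 mua x.
Proof. by rewrite /wa /pw subr0. Qed.

Lemma wbE (x : R) : wb mub x = pw (-1) mub x.
Proof. by rewrite /wb /pw opprK. Qed.

Lemma sqrt_wa (x : R) : 0 < x < 1 -> Num.sqrt (wa mua x) = pw 0 (mua / 2) x.
Proof. by case/andP=> x0 _; rewrite waE sqrt_pw. Qed.

Lemma sqrt_wb (x : R) : -1 < x < 0 -> Num.sqrt (wb mub x) = pw (-1) (mub / 2) x.
Proof. by case/andP=> x0 _; rewrite wbE sqrt_pw. Qed.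

(** Under weak degeneracy [rlim] is a genuine limit and not a default value. *)
Lemma V1_rlim (alpha : R -> R) (p q m : R) (u : R -> R[i]^o) : p < q -> m < 1 ->
  (forall x, p < x < q -> Num.sqrt (alpha x) = pw p (m / 2) x) ->
  V1 alpha p q u -> u x @[x --> p^'+] --> rlim u p.
Proof.
move=> pq m1 alphaE /(V1P alphaE)[_ uac du2].
pose l b := part b (u q) - rint p q (derive1 (fun x => part b (u x))).
have ul : u x @[x --> p^'+] --> ((l true +i* l false) : R[i]^o).
  apply: cvg_parts => b; have -> : part b (l true +i* l false) = l b by case: b.
  exact: weak_cvg m1 (part_primitive _ pq uac) (du2 _).
exact: (cvgP _ ul).
Qed.

Lemma rlimE (f : R -> R[i]^o) (p : R) (l : R[i]^o) :
  f x @[x --> p^'+] --> l -> rlim f p = l.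
Proof.
by move=> fl; apply: (@cvg_lim R[i]^o _ _ _ _ _ _ fl); exact: norm_hausdorff.
Qed.

Lemma rlim_lin (p : R) (c : R[i]) (u v : R -> R[i]^o) :
  u x @[x --> p^'+] --> rlim u p -> v x @[x --> p^'+] --> rlim v p ->
  rlim (fun x => c * u x + v x) p = c * rlim u p + rlim v p.
Proof.
move=> ul vl; apply: rlimE; apply: cvg_parts => b.
rewrite partD partM; under eq_fun do rewrite partD partM.
have uc b' : part b' (u x) @[x --> p^'+] --> part b' (rlim u p).
  exact: (@cvg_part _ _ _ b' u _ ul).
have vc : part b (v x) @[x --> p^'+] --> part b (rlim v p).
  exact: (@cvg_part _ _ _ b v _ vl).
exact: (cvgD (cvgD (cvgM (cvg_cst (complex.Re c)) (uc b))
  (cvgM (cvg_cst _) (uc (~~ b)))) vc).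
Qed.

(** The two energy spaces differ only in the condition at -1, so a guarded implication treats both
    ranges of [mub] at once. *)
Lemma energy_spaceP U : H U <->
  [/\ Va1 mua U.1.1.1, L2 0 1 U.1.1.2, Vb1 mub U.1.2, L2 (-1) 0 U.2 &
      rlim U.1.1.1 0 = U.1.2 0] /\ (mub < 1 -> rlim U.1.2 (-1) = 0).
Proof.
case: U => [[[u v] w] y]; rewrite /energy_space; case: ltP => m1 /=; last first.
  by split=> [?|[]//]; split.
rewrite /energy_space1 /Wb1 m1 /=; split=> [[? ? [? ?] ? ?]|[[? ? ? ? ?] /(_ isT)?]] //.
Qed.

Lemma state_lin (c : R[i]) U V : c *: U + V =
  (fun x => c * U.1.1.1 x + V.1.1.1 x, fun x => c * U.1.1.2 x + V.1.1.2 x,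
   fun x => c * U.1.2 x + V.1.2 x, fun x => c * U.2 x + V.2 x).
Proof. by case: U => [[[? ?] ?] ?]; case: V => [[[? ?] ?] ?]. Qed.

Lemma energy_space_lin (c : R[i]) U V : H U -> H V -> H (c *: U + V).
Proof.
move=> /energy_spaceP[[u1 v1 w1 y1 uw1] w01] /energy_spaceP[[u2 v2 w2 y2 uw2] w02].
have a1 : mua < 1 by case/andP: mua01.
rewrite state_lin; apply/energy_spaceP => /=; split => [|m1]; first split.
- exact: V1_lin lt01 sqrt_wa _ _ _ u1 u2.
- exact: L2_lin.
- exact: V1_lin ltN10 sqrt_wb _ _ _ w1 w2.
- exact: L2_lin.
- rewrite (rlim_lin c (V1_rlim lt01 a1 sqrt_wa u1) (V1_rlim lt01 a1 sqrt_wa u2)).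
  by rewrite uw1 uw2.
- rewrite (rlim_lin c (V1_rlim ltN10 m1 sqrt_wb w1) (V1_rlim ltN10 m1 sqrt_wb w2)).
  by rewrite w01 ?w02// mulr0 addr0.
Qed.

Definition u_slope b U : R -> R :=
  pwM 0 (mua / 2) (derive1 (fun x => part b (U.1.1.1 x))).
Definition w_slope b U : R -> R :=
  pwM (-1) (mub / 2) (derive1 (fun x => part b (U.1.2 x))).
Definition v_part b U (x : R) : R := part b (U.1.1.2 x).
Definition w_part b U (x : R) : R := part b (U.1.2 x).
Definition y_part b U (x : R) : R := part b (U.2 x).
Definition u_end b U : R := part b (U.1.1.1 1).

Definition energy_form b U V : R :=
  ip 0 1 (v_part b U) (v_part b V) + ip 0 1 (u_slope b U) (u_slope b V)
  + (ip (-1) 0 (y_part b U) (y_part b V) + ip (-1) 0 (w_slope b U) (w_slope b V))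
  + gamma * (u_end b U * u_end b V).

Lemma l2_v_part b U : H U -> l2 0 1 (v_part b U).
Proof. by move=> /energy_spaceP[[_ /L2P + _ _ _] _]; apply. Qed.

Lemma l2_y_part b U : H U -> l2 (-1) 0 (y_part b U).
Proof. by move=> /energy_spaceP[[_ _ _ /L2P + _] _]; apply. Qed.

Lemma l2_w_part b U : H U -> l2 (-1) 0 (w_part b U).
Proof. by move=> /energy_spaceP[[_ _ [/L2P + _ _] _ _] _]; apply. Qed.

Lemma l2_u_slope b U : H U -> l2 0 1 (u_slope b U).
Proof. by move=> /energy_spaceP[[/(V1P sqrt_wa)[_ _ +] _ _ _ _] _]; apply. Qed.

Lemma l2_w_slope b U : H U -> l2 (-1) 0 (w_slope b U).
Proof. by move=> /energy_spaceP[[_ _ /(V1P sqrt_wb)[_ _ +] _ _] _]; apply. Qed.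

Lemma v_part_lin b (c : R) U V :
  v_part b (c%:C *: U + V) = fun x => c * v_part b U x + v_part b V x.
Proof. by rewrite state_lin; apply/funext => x; rewrite /v_part/= partD partZ. Qed.

Lemma y_part_lin b (c : R) U V :
  y_part b (c%:C *: U + V) = fun x => c * y_part b U x + y_part b V x.
Proof. by rewrite state_lin; apply/funext => x; rewrite /y_part/= partD partZ. Qed.

Lemma w_part_lin b (c : R) U V :
  w_part b (c%:C *: U + V) = fun x => c * w_part b U x + w_part b V x.
Proof. by rewrite state_lin; apply/funext => x; rewrite /w_part/= partD partZ. Qed.

Lemma u_end_lin b (c : R) U V : u_end b (c%:C *: U + V) = c * u_end b U + u_end b V.
Proof. by rewrite state_lin /u_end/= partD partZ. Qed.

Lemma u_slope_lin b (c : R) U V : H U -> H V -> {ae mu, forall x, 0 < x < 1 ->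
  u_slope b (c%:C *: U + V) x = c * u_slope b U x + u_slope b V x}.
Proof.
move=> /energy_spaceP[[[_ u1 _] _ _ _ _] _] /energy_spaceP[[[_ u2 _] _ _ _ _] _].
apply: (@filterS _ _ (ae_filter_ringOfSetsType mu))
  (derive1_part_lin b c%:C lt01 u1 u2) => x D x01.
rewrite state_lin /u_slope /pwM/= (D x01) /=.
by case: b {D}; ring.
Qed.

Lemma w_slope_lin b (c : R) U V : H U -> H V -> {ae mu, forall x, -1 < x < 0 ->
  w_slope b (c%:C *: U + V) x = c * w_slope b U x + w_slope b V x}.
Proof.
move=> /energy_spaceP[[_ _ [_ w1 _] _ _] _] /energy_spaceP[[_ _ [_ w2 _] _ _] _].
apply: (@filterS _ _ (ae_filter_ringOfSetsType mu))
  (derive1_part_lin b c%:C ltN10 w1 w2) => x D x01.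
rewrite state_lin /w_slope /pwM/= (D x01) /=.
by case: b {D}; ring.
Qed.

Let energy_regroup (v1 v2 y1 y2 u1 u2 w1 w2 g x y : R) :
  v1 + v2 + (y1 + y2) + (u1 + u2) + (w1 + w2) + g * 1 * (x ^+ 2 + y ^+ 2) =
  v1 + u1 + (y1 + w1) + g * (x * x) + (v2 + u2 + (y2 + w2) + g * (y * y)).
Proof. by ring. Qed.

Lemma energy_normE U : H U ->
  N U ^+ 2 = energy_form true U U + energy_form false U U.
Proof.
move=> /energy_spaceP[]; case: U => [[[u v] w] y] /= [u1 v2 w1 y2 _] _.
have g0 : 0 <= gamma by exact: ltW.
have wa1 : wa mua 1 = 1 by rewrite /wa powR1.
rewrite /energy_norm wa1 (sqnormL2_parts v2) (sqnormL2_parts y2).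
rewrite (weighted_sqnorm sqrt_wa u1) (weighted_sqnorm sqrt_wb w1) normc_sqr.
rewrite sqr_sqrtr; last by rewrite ?addr_ge0 ?ip_ge0// !mulr_ge0// addr_ge0 ?sqr_ge0.
exact: energy_regroup.
Qed.

Let linear_regroup (c g v1 v2 u1 u2 y1 y2 w1 w2 x1 x2 x : R) :
  c * v1 + v2 + (c * u1 + u2) + (c * y1 + y2 + (c * w1 + w2)) + g * ((c * x1 + x2) * x) =
  c * (v1 + u1 + (y1 + w1) + g * (x1 * x)) + (v2 + u2 + (y2 + w2) + g * (x2 * x)).
Proof. by ring. Qed.

Lemma energy_form_linearl b (c : R) U V W : H U -> H V -> H W ->
  energy_form b (c%:C *: U + V) W = c * energy_form b U W + energy_form b V W.
Proof.
move=> HU HV HW; have HUV := energy_space_lin c%:C HU HV; rewrite /energy_form.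
rewrite (ip_linearl (H := H) (l2_v_part b HW) (@l2_v_part b) _ HU HV HUV); last first.
  by rewrite v_part_lin; exact: aeW.
rewrite (ip_linearl (H := H) (l2_y_part b HW) (@l2_y_part b) _ HU HV HUV); last first.
  by rewrite y_part_lin; exact: aeW.
rewrite (ip_linearl (l2_u_slope b HW) (@l2_u_slope b) (u_slope_lin b c HU HV) HU HV HUV).
rewrite (ip_linearl (l2_w_slope b HW) (@l2_w_slope b) (w_slope_lin b c HU HV) HU HV HUV).
by rewrite u_end_lin; exact: linear_regroup.
Qed.

Lemma energy_formC b U V : energy_form b U V = energy_form b V U.
Proof.
rewrite /energy_form (ipC _ _ (v_part b U)) (ipC _ _ (u_slope b U)).
rewrite (ipC _ _ (y_part b U)) (ipC _ _ (w_slope b U)).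
by rewrite (mulrC (u_end b U)).
Qed.

Lemma energy_seminorm : seminormed_module H N.
Proof.
apply: (@quadratic_seminorm _ _ _ _
  (fun U V => energy_form true U V + energy_form false U V)).
- by move=> c U V; exact: energy_space_lin.
- by case=> [[[u v] w] y]; exact: sqrtr_ge0.
- exact: energy_normE.
- by move=> U V; rewrite !(energy_formC _ U).
- by move=> c U V W HU HV HW; rewrite !energy_form_linearl// addrACA -mulrDr.
Qed.

Lemma energy_form_ge0 b U : 0 <= energy_form b U U.
Proof. by rewrite !addr_ge0 ?ip_ge0// mulr_ge0 ?(ltW gamma_gt0)// -expr2 sqr_ge0. Qed.

Lemma energy_form_le b U : H U -> energy_form b U U <= N U ^+ 2.
Proof.
move=> HU; rewrite energy_normE//.
by case: b; rewrite ?lerDl ?lerDr energy_form_ge0.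
Qed.

End EnergySpace.

(** * Coordinates of a state controlled by the energy *)

Section EnergyCoordinates.
Local Open Scope complex_scope.
Context {R : realType}.
Notation mu := (@lebesgue_measure R).
Variables (gamma mua mub : R).
Hypotheses (gamma_gt0 : 0 < gamma) (mua01 : 0 <= mua < 1) (mub02 : 0 <= mub < 2).
Notation H := (energy_space mua mub).
Notation N := (energy_norm gamma mua mub).
Implicit Types (U V W : state (R := R)) (b : bool).

Let lt01 : 0 < 1 :> R. Proof. exact: ltr01. Qed.
Let ltN10 : -1 < 0 :> R. Proof. by rewrite ltrN10. Qed.

Let five_le (v u y w z e : R) : 0 <= v -> 0 <= u -> 0 <= y -> 0 <= w -> 0 <= z ->
  v + u + (y + w) + z <= e -> [/\ v <= e, u <= e, y <= e, w <= e & z <= e].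
Proof. by move=> *; split; lra. Qed.

Lemma energy_coordinates_le b U : H U ->
  [/\ ip 0 1 (v_part b U) (v_part b U) <= N U ^+ 2,
      ip 0 1 (u_slope mua b U) (u_slope mua b U) <= N U ^+ 2,
      ip (-1) 0 (y_part b U) (y_part b U) <= N U ^+ 2,
      ip (-1) 0 (w_slope mub b U) (w_slope mub b U) <= N U ^+ 2 &
      gamma * u_end b U ^+ 2 <= N U ^+ 2].
Proof.
move=> HU; have := energy_form_le gamma_gt0 b HU.
rewrite /energy_form -expr2; apply: five_le; rewrite ?ip_ge0//.
by rewrite mulr_ge0 ?sqr_ge0// ltW.
Qed.

Lemma coordinate_v b : l2_coordinate H N 0 1 (v_part b).
Proof.
split; first exact: l2_v_part.
- by move=> c U V _ _; apply: aeW => x _; rewrite v_part_lin.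
- by exists 1 => // U /(energy_coordinates_le b)[]; rewrite mul1r.
Qed.

Lemma coordinate_y b : l2_coordinate H N (-1) 0 (y_part b).
Proof.
split; first exact: l2_y_part.
- by move=> c U V _ _; apply: aeW => x _; rewrite y_part_lin.
- by exists 1 => // U /(energy_coordinates_le b)[]; rewrite mul1r.
Qed.

Lemma coordinate_u_slope b : l2_coordinate H N 0 1 (u_slope mua b).
Proof.
split; first exact: l2_u_slope.
- exact: u_slope_lin.
- by exists 1 => // U /(energy_coordinates_le b)[]; rewrite mul1r.
Qed.

Lemma coordinate_w_slope b : l2_coordinate H N (-1) 0 (w_slope mub b).
Proof.
split; first exact: l2_w_slope.
- exact: w_slope_lin.
- by exists 1 => // U /(energy_coordinates_le b)[]; rewrite mul1r.
Qed.

Lemma coordinate_u_end b : scalar_coordinate H N (u_end b).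
Proof.
split; first by move=> c U V _ _; rewrite u_end_lin.
exists (Num.sqrt gamma^-1) => // U HU.
have [_ _ _ _] := energy_coordinates_le b HU; rewrite mulrC -ler_pdivlMr// => zN.
have N0 : 0 <= N U := seminorm_ge0 (energy_seminorm mub gamma_gt0 mua01) U.
rewrite -ler_sqr ?nnegrE ?mulr_ge0 ?sqrtr_ge0// real_normK ?num_real//.
by rewrite exprMn sqr_sqrtr ?invr_ge0 ?(ltW gamma_gt0)// mulrC.
Qed.

Let trace_combine (k g z uz s e w ip1 D : R) : 0 < g -> 0 <= k -> 0 <= D ->
  (z - uz) ^+ 2 <= k * s -> s <= e -> g * z ^+ 2 <= e -> ip1 <= 2 * uz ^+ 2 + D * w ->
  w <= e -> ip1 <= (4 / g + 4 * k + D) * e.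
Proof.
move=> g0 k0 D0 h1 h2 h3 h4 h5.
have h6 : k * s <= k * e by rewrite ler_wpM2l.
have h7 : D * w <= D * e by rewrite ler_wpM2l.
have h8 : z ^+ 2 <= e / g by rewrite ler_pdivlMr// mulrC.
have h9 : uz ^+ 2 <= 2 * z ^+ 2 + 2 * (z - uz) ^+ 2 by have := sqr_ge0 (2 * z - uz); lra.
have -> : (4 / g + 4 * k + D) * e = 4 * (e / g) + 4 * (k * e) + D * e by ring.
lra.
Qed.

(** The energy contains no norm of [w]. The bound passes from [gamma u(1)^2] to [u(0)] by
    [weighted_increment], to [w(0)] by continuity at the interface, and to [w] by
    [degenerate_l2_bound]; it rests on [gamma > 0]. *)
Lemma coordinate_w b : l2_coordinate H N (-1) 0 (w_part b).
Proof.
split; first exact: l2_w_part.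
- by move=> c U V _ _; apply: aeW => x _; rewrite w_part_lin.
pose k := pw 0 (1 - mua) 1 / (1 - mua); pose D := 2 / (1 - mub / 2) ^+ 2.
have k0 : 0 <= k.
  by rewrite divr_ge0 ?powR_ge0// subr_ge0 ltW//; case/andP: mua01.
have D0 : 0 <= D by rewrite divr_ge0// sqr_ge0.
exists (4 / gamma + 4 * k + D) => [|U HU].
  have g4 : 0 <= 4 / gamma by rewrite divr_ge0// ltW.
  by rewrite addr_ge0// addr_ge0// mulr_ge0.
have [_ us _ ws ue] := energy_coordinates_le b HU.
have [[u1 _ w1 _ uw] _] := (energy_spaceP mua mub U).1 HU.
have [_ uac _] := u1; have [_ wac _] := w1.
have a1 : mua < 1 by case/andP: mua01.
have u0 := V1_rlim lt01 a1 (@sqrt_wa _ mua) u1.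
have ucv : part b (U.1.1.1 x) @[x --> 0^'+] --> part b (rlim U.1.1.1 0).
  by exact: (@cvg_part _ _ _ b U.1.1.1 _ u0).
have q1 : 1 = 0 + 1 :> R by rewrite add0r.
have q0 : 0 = -1 + 1 :> R by rewrite addNr.
have h1 := weighted_increment q1 mua01 (part_primitive b lt01 uac)
  (l2_u_slope b HU) ucv lt01 (lexx 1).
have h2 := degenerate_l2_bound q0 mub02 (part_primitive b ltN10 wac)
  (l2_w_part b HU) (l2_w_slope b HU).
apply: trace_combine gamma_gt0 k0 D0 h1 us ue _ ws.
by rewrite uw.
Qed.

End EnergyCoordinates.

(** * Regularity of elements of the domain *)

Section Regularity.
Local Open Scope complex_scope.
Context {R : realType}.
Notation mu := (@lebesgue_measure R).
Implicit Types (p q : R).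

Lemma real_ac_cvg_right p q (f : R -> R) : p < q -> real_ac p q f ->
  f x @[x --> p^'+] --> f p.
Proof.
move=> pq fac; apply/cvgrPdist_lt => e e0.
have [d d0 fd] := real_ac_modulus fac e0.
near=> x; rewrite distrC.
have px : p < x by near: x; exact: nbhs_right_gt.
have xq : x < q by near: x; exact: nbhs_right_lt.
have xd : x < p + d by near: x; apply: nbhs_right_lt; rewrite ltrDl.
by apply: fd; rewrite ?(ltW px) ?(ltW xq)// ltrBlDl.
Unshelve. all: by end_near. Qed.

Lemma real_ac_cvg_left p q (f : R -> R) : p < q -> real_ac p q f ->
  f x @[x --> q^'-] --> f q.
Proof.
move=> pq fac; apply/cvgrPdist_lt => e e0.
have [d d0 fd] := real_ac_modulus fac e0.
near=> x.
have px : p < x by near: x; exact: nbhs_left_gt.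
have xq : x < q by near: x; exact: nbhs_left_lt.
have xd : q - d < x by near: x; apply: nbhs_left_gt; rewrite ltrBlDr ltrDl.
by apply: fd; rewrite ?(ltW px) ?(ltW xq)// ltrBlDr -ltrBlDl.
Unshelve. all: by end_near. Qed.

Lemma real_ac_continuous p q (f : R -> R) x : p < x < q -> real_ac p q f ->
  {for x, continuous f}.
Proof.
move=> /andP[px xq] fac.
have pq := lt_trans px xq.
have [h [mh ih _ dh]] := real_ac_density pq fac.
apply: (@primitive_continuous _ p q f h) => //; split => //.
- exact: measurable_funTS.
- by move=> c pc cq; apply: real_acS fac; rewrite ?(ltW pc).
Qed.

(** A density that is almost everywhere equal to a continuous function is a derivative at every
    point, by the fundamental theorem of calculus. *)
Lemma primitive_continuous_density p q (f g h : R -> R) x : primitive p q f g ->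
  {ae mu, forall x, p < x < q -> g x = h x} ->
  (forall x, p < x < q -> {for x, continuous h}) -> p < x < q ->
  is_derive x 1 f (h x).
Proof.
move=> fg gh hc /andP[px xq].
pose c := (p + x) / 2; pose d := (x + q) / 2; pose d' := (d + q) / 2.
have pc : p < c by rewrite /c; lra.
have cx : c < x by rewrite /c; lra.
have xd : x < d by rewrite /d; lra.
have dd' : d < d' by rewrite /d' /d; lra.
have d'q : d' < q by rewrite /d' /d; lra.
have cd' : c < d' by lra.
have mh : mfun p q h by apply: mfun_continuous.
have fh : primitive p q f h by apply: primitive_ae fg.
have [hi _] := primitive_incr fh pc cd' (ltW d'q).
have hi' : mu.-integrable `]c, d] (EFin \o h).
  apply: integrableS hi => //; apply: subset_itvl.
  by rewrite bnd_simp.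
have [] := @continuous_FTC1 _ h (BRight c) x d xd hi'; first exact: cx.
  by apply: hc; rewrite px.
set F := fun y => _ => dF F'.
have FE : \forall y \near x, f c + F y = f y.
  near=> y.
  have cy : c < y by near: y; exact: lt_nbhsr.
  have yd : y < d' by near: y; apply: lt_nbhsl; exact: lt_trans dd'.
  rewrite /F -Rintegral_itv_bndo_bndc; last first.
    by apply: rintegrableS hi; rewrite ?(ltW yd).
  have := primitive_rint fh pc (ltW cy) (ltW (lt_trans yd d'q)).
  by rewrite /rint => <-; rewrite addrC subrK.
have dF' : is_derive x 1 F (h x) by split => //; rewrite -derive1E F'.
have dG := is_deriveD (is_derive_cst (f c) x 1) dF'; rewrite add0r in dG.
apply: DeriveDef.
  by apply: near_eq_derivable FE _; case: dG.
by rewrite -(@near_eq_derive _ R R _ _ x 1 FE); case: dG.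
Unshelve. all: by end_near. Qed.

Lemma abs_continuousS p q c (f : R -> R[i]^o) : p <= c ->
  abs_continuous p q f -> abs_continuous c q f.
Proof.
move=> pc fac e /fac[d d0 H]; exists d => // n s t st; apply: H => i.
by have [cs ? ?] := st i; split => //; exact: le_trans cs.
Qed.

(** Membership in [H1] identifies the flux with some [g] only almost everywhere, while [wave_op]
    differentiates the pointwise flux. Since [u'] is almost everywhere the continuous [g / alpha],
    it equals it everywhere inside the interval, and so the pointwise flux is [g]. *)
Lemma V2_flux (alpha : R -> R) p q m (u : R -> R[i]^o) : p < q ->
  (forall x, alpha x = pw p m x) -> V2 alpha p q u ->
  exists g : R -> R[i]^o, [/\ abs_continuous p q g, L2 p q (cderive g),
    forall x, p < x < q -> wmul alpha (cderive u) x = g x &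
    forall x, p < x < q -> cderive (wmul alpha (cderive u)) x = cderive g x].
Proof.
move=> pq alphaE [[_ uac _] [_ [g [gac ug dg2]]]]; exists g.
have gc b x : p < x < q -> {for x, continuous (fun x => part b (g x))}.
  by move=> xpq; apply: real_ac_continuous xpq (real_ac_part b gac).
have Pb b x : part b (wmul alpha (cderive u) x) =
    pw p m x * derive1 (fun x => part b (u x)) x.
  by rewrite partZ part_cderive alphaE.
have slope b x : p < x < q -> derive1 (fun x => part b (u x)) x =
    pw p (- m) x * part b (g x).
  move=> xpq; rewrite derive1E; apply: derive_val.
  apply: (primitive_continuous_density (h := fun x => pw p (- m) x * part b (g x))
    (part_primitive b pq uac)) xpq.
    apply: (@filterS _ _ (ae_filter_ringOfSetsType mu)) ug => y ug /[dup] ypq /andP[py _].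
    by rewrite -(ug ypq) Pb mulrA -pwD// addNr pw0 mul1r.
  by move=> y /[dup] ypq /andP[py _]; apply: cvgM; [exact: pw_continuous|exact: gc].
have ugE x : p < x < q -> wmul alpha (cderive u) x = g x.
  move=> /[dup] xpq /andP[px _]; apply: part_inj => b.
  by rewrite Pb slope// mulrA -pwD// subrr pw0 mul1r.
split => // x /andP[px xq]; apply: part_inj => b; rewrite !part_cderive !derive1E.
apply: near_eq_derive; near=> y; rewrite ugE//; apply/andP; split; near: y.
  exact: lt_nbhsr.
exact: lt_nbhsl.
Unshelve. all: by end_near. Qed.

Lemma cvg_right_ext p q (f g : R -> R) (l : R) : p < q ->
  (forall x, p < x < q -> f x = g x) -> g x @[x --> p^'+] --> l ->
  f x @[x --> p^'+] --> l.
Proof.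
move=> pq fg; apply: cvg_trans; apply: near_eq_cvg; near=> x; rewrite fg//.
by apply/andP; split; near: x; [exact: nbhs_right_gt|exact: nbhs_right_lt].
Unshelve. all: by end_near. Qed.

Lemma cvg_left_ext p q (f g : R -> R) (l : R) : p < q ->
  (forall x, p < x < q -> f x = g x) -> g x @[x --> q^'-] --> l ->
  f x @[x --> q^'-] --> l.
Proof.
move=> pq fg; apply: cvg_trans; apply: near_eq_cvg; near=> x; rewrite fg//.
by apply/andP; split; near: x; [exact: nbhs_left_gt|exact: nbhs_left_lt].
Unshelve. all: by end_near. Qed.

Lemma llimE (f : R -> R[i]^o) (p : R) (l : R[i]^o) :
  f x @[x --> p^'-] --> l -> llim f p = l.
Proof.
by move=> fl; apply: (@cvg_lim R[i]^o _ _ _ _ _ _ fl); exact: norm_hausdorff.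
Qed.

Section FluxTraces.
Variables (p q : R) (f g : R -> R[i]^o).
Hypotheses (pq : p < q) (gac : abs_continuous p q g)
  (fg : forall x, p < x < q -> f x = g x).

Lemma flux_rlim : rlim f p = g p.
Proof.
apply: rlimE; apply: cvg_parts => b.
apply: (@cvg_right_ext p q _ (fun x => part b (g x))) => //.
  by move=> x /fg ->.
exact: real_ac_cvg_right pq (real_ac_part b gac).
Qed.

Lemma flux_llim : llim f q = g q.
Proof.
apply: llimE; apply: cvg_parts => b.
apply: (@cvg_left_ext p q _ (fun x => part b (g x))) => //.
  by move=> x /fg ->.
exact: real_ac_cvg_left pq (real_ac_part b gac).
Qed.

End FluxTraces.

(** [u] stands for a derivative here; the weight is 1 at 1, so the one-sided limit of the derivative
    is the value of the flux. *)
Lemma slope_llim (m : R) (u g : R -> R[i]^o) : abs_continuous 0 1 g ->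
  (forall x, 0 < x < 1 -> wmul (fun x => pw 0 m x) u x = g x) -> llim u 1 = g 1.
Proof.
move=> gac ug; apply: llimE; apply: cvg_parts => b.
apply: (@cvg_left_ext 0 1 _ (fun x => pw 0 (- m) x * part b (g x))) => //.
  move=> x /[dup] x01 /andP[x0 _].
  by rewrite -ug// partZ mulrA -pwD// addNr pw0 mul1r.
have -> : part b (g 1) = pw 0 (- m) 1 * part b (g 1).
  by rewrite /pw subr0 powR1 mul1r.
apply: cvgM; last exact: real_ac_cvg_left ltr01 (real_ac_part b gac).
by apply: cvg_at_left_filter; apply: pw_continuous.
Qed.

End Regularity.

(** * From elements of the domain to wave data *)

Section DomainData.
Local Open Scope complex_scope.
Context {R : realType}.
Variables (gamma mua mub : R).
Hypotheses (mua01 : 0 <= mua < 1) (mub02 : 0 <= mub < 2).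
Notation H := (energy_space mua mub).
Implicit Types (U : state (R := R)) (b : bool).

Let lt01 : 0 < 1 :> R. Proof. exact: ltr01. Qed.
Let ltN10 : -1 < 0 :> R. Proof. by rewrite ltrN10. Qed.

Lemma domainP U : domain gamma mua mub U ->
  [/\ H U, [/\ Va2 mua U.1.1.1, Va1 mua U.1.1.2, Vb2 mub U.1.2 & Vb1 mub U.2],
      boundary_conditions gamma mua mub U & mub < 1 -> rlim U.2 (-1) = 0].
Proof.
case: U => [[[u v] w] y]; rewrite /domain /energy_space; case: ltP => m1 /=; last first.
  by move=> -[? ? ?]; split.
rewrite /Wb2 /Wb1 m1 => -[? [? ? [? ?] [? ?]] ?]; split => //.
Qed.

(** The image under the operator lies in the energy space because [v(0) = y(0)], and [y(-1) = 0] for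
    [mub < 1], are precisely the constraints on its first and third components. *)
Lemma domain_wave_data U : domain gamma mua mub U ->
  H (wave_op mua mub U) /\ forall b, exists P Q (u0 v0 P0 : R),
    wave_data gamma mua mub
      (fun x => part b (U.1.1.1 x)) (derive1 (fun x => part b (U.1.1.1 x)))
      (v_part b U) (derive1 (v_part b U)) P (v_part b (wave_op mua mub U))
      (w_part b U) (derive1 (w_part b U)) (y_part b U) (derive1 (y_part b U))
      Q (y_part b (wave_op mua mub U)) u0 v0 P0.
Proof.
move=> /domainP[HU [u2 v1 w2 y1] bc yN].
have [_ wN] := (energy_spaceP mua mub U).1 HU.
move: HU u2 v1 w2 y1 bc yN wN; case: U => [[[u v] w] y] /=.
move=> HU u2 v1 w2 y1 [vy bc1 bc0] yN wN.
have a1 : mua < 1 by case/andP: mua01.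
have [u1 _] := u2; have [w1 _] := w2.
have [gP [Pac dP2 uP PP]] := V2_flux lt01 (@waE _ mua) u2.
have [gQ [Qac dQ2 wQ QQ]] := V2_flux ltN10 (@wbE _ mub) w2.
have [[_ v2 _ y2 uw] _] := (energy_spaceP mua mub (u, v, w, y)).1 HU.
have [_ uac _] := u1; have [_ wac _] := w1.
have [_ vac _] := v1; have [_ yac _] := y1.
have PP2 : L2 0 1 (cderive (wmul (wa mua) (cderive u))).
  by apply/L2P => b; move/L2P/(_ b): dP2; apply: l2_ext => x /PP ->.
have QQ2 : L2 (-1) 0 (cderive (wmul (wb mub) (cderive w))).
  by apply/L2P => b; move/L2P/(_ b): dQ2; apply: l2_ext => x /QQ ->.
have cu := V1_rlim lt01 a1 (@sqrt_wa _ mua) u1.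
have cv := V1_rlim lt01 a1 (@sqrt_wa _ mua) v1.
split.
  apply: (energy_spaceP mua mub (wave_op mua mub (u, v, w, y))).2.
  exact: (conj (And5 v1 PP2 y1 QQ2 vy) yN).
have PQ0 : gP 0 = gQ 0.
  by rewrite -(flux_rlim lt01 Pac uP) bc0 (flux_llim ltN10 Qac wQ).
have P1 : llim (cderive u) 1 = gP 1.
  apply: (@slope_llim R mua (cderive u) gP Pac) => x x01.
  by rewrite -(uP _ x01) /wmul waE.
rewrite P1 in bc1 => b.
exists (fun x => part b (gP x)), (fun x => part b (gQ x)), (part b (rlim u 0)),
  (part b (rlim v 0)), (part b (gP 0)).
have primP : primitive 0 1 (fun x => part b (gP x)) (derive1 (fun x => part b (gP x))).
  by apply: part_primitive => // c /andP[c0 _]; exact: abs_continuousS (ltW c0) Pac.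
have primQ : primitive (-1) 0 (fun x => part b (gQ x)) (derive1 (fun x => part b (gQ x))).
  by apply: part_primitive => // c /andP[c0 _]; exact: abs_continuousS (ltW c0) Qac.
split.
- exact: part_primitive.
- exact: part_primitive.
- by apply: primitive_ext primP => // x /PP E; rewrite /v_part/= E part_cderive.
- exact: part_primitive.
- exact: part_primitive.
- by apply: primitive_ext primQ => // x /QQ E; rewrite /y_part/= E part_cderive.
- by move/L2P: v2; apply.
- by have [_ _ +] := (V1P (@sqrt_wa _ mua) u).1 u1; apply.
- by have [_ _ +] := (V1P (@sqrt_wa _ mua) v).1 v1; apply.
- by move/L2P: PP2; apply.
- by have [/L2P + _ _] := w1; apply.
- by move/L2P: y2; apply.
- by have [_ _ +] := (V1P (@sqrt_wb _ mub) w).1 w1; apply.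
- by have [_ _ +] := (V1P (@sqrt_wb _ mub) y).1 y1; apply.
- by move/L2P: QQ2; apply.
- by move=> x /uP <-; rewrite partZ waE part_cderive.
- by move=> x /wQ <-; rewrite partZ wbE part_cderive.
- exact: (@cvg_part _ _ _ b u _ cu).
- exact: (@cvg_part _ _ _ b v _ cv).
- exact: real_ac_cvg_right lt01 (real_ac_part b Pac).
- by rewrite uw.
- by rewrite vy.
- by rewrite PQ0.
- by rewrite /v_part/= -partZ -!partD bc1 part0.
- move=> m1; rewrite -(part0 b) -(wN m1).
  exact: (@cvg_part _ _ _ b w _ (V1_rlim ltN10 m1 (@sqrt_wb _ mub) w1)).
- move=> m1; rewrite -(part0 b) -(yN m1).
  exact: (@cvg_part _ _ _ b y _ (V1_rlim ltN10 m1 (@sqrt_wb _ mub) y1)).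
Qed.

End DomainData.

(** * Lyapunov forms of the coupled system *)

Section LyapunovForms.
Local Open Scope complex_scope.
Context {R : realType}.
Variables (gamma mua mub : R).
Hypotheses (gamma_gt0 : 0 < gamma) (mua01 : 0 <= mua < 1) (mub02 : 0 <= mub < 2).
Notation H := (energy_space mua mub).
Notation N := (energy_norm gamma mua mub).
Notation A := (wave_op mua mub).
Implicit Types (U V : state (R := R)) (b : bool).

Let q1 : 1 = 0 + 1 :> R. Proof. by rewrite add0r. Qed.
Let q0 : 0 = -1 + 1 :> R. Proof. by rewrite addNr. Qed.
Let a_half : 0 <= 1 - mua / 2. Proof. by case/andP: mua01 => ? ?; lra. Qed.
Let m_half : 0 <= 1 - mub / 2. Proof. by case/andP: mub02 => ? ?; lra. Qed.
Let Hsn : seminormed_module H N. Proof. exact: energy_seminorm. Qed.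

Definition moment b V : R := ip 0 1 (phi mua mub) (v_part b V)
  + ip (-1) 0 (psi mub) (y_part b V) + phi mua mub 1 * u_end b V.

(** Not symmetric: the quantity estimated is always [B U (A U) + B (A U) U], the derivative of
    [B U U] along the flow. The term with [mub / 4] produces the equalising correction of
    [rellich_b]. *)
Definition interior_form (K : R) b U V : R :=
  wip (-1) 0 (1 - mub / 2) (y_part b U) (w_slope mub b V)
  + mub / 4 * ip (-1) 0 (y_part b U) (w_part b V)
  + K * (u_end b U * moment b V).

Definition rellich_form b U V : R :=
  wip 0 1 (1 - mua / 2) (v_part b U) (u_slope mua b V).

Definition shifted_form b U V : R := rellich_form b U V
  + gamma * (u_end b U * ip 0 1 (pw 0 (1 - mua)) (v_part b V)).

(** At [A U] its two terms are the squared norms of [P'] and of [x^(mua / 2) v'], which are the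
    remainder left by the interface traces. *)
Definition local_form b U V : R :=
  ip 0 1 (v_part b U) (v_part b V) + ip 0 1 (u_slope mua b U) (u_slope mua b V).

Lemma bounded_local_form b : bounded_form H N (local_form b).
Proof.
apply: bounded_formD; apply: bounded_form_ip => //;
  by [exact: coordinate_v|exact: coordinate_u_slope].
Qed.

Lemma bounded_u_end_form b : bounded_form H N (fun U V => u_end b U * u_end b V).
Proof. by apply: bounded_form_mul; exact: coordinate_u_end. Qed.

Lemma bounded_energy_form b : bounded_form H N (energy_form gamma mua mub b).
Proof.
apply: bounded_formD; last by apply: bounded_formZ; exact: bounded_u_end_form.
apply: bounded_formD; first exact: bounded_local_form.
apply: bounded_formD; apply: bounded_form_ip => //;
  by [exact: coordinate_y|exact: coordinate_w_slope].
Qed.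

Lemma bounded_rellich_form b : bounded_form H N (rellich_form b).
Proof.
have k := l2_coordinate_pwM q1 a_half (coordinate_v mua mub gamma_gt0 b).
exact: (bounded_form_ip Hsn k (coordinate_u_slope mua mub gamma_gt0 b)).
Qed.

Lemma bounded_shifted_form b : bounded_form H N (shifted_form b).
Proof.
apply: bounded_formD; first exact: bounded_rellich_form.
apply: bounded_formZ; apply: bounded_form_mul; first exact: coordinate_u_end.
apply: (scalar_coordinate_ip Hsn _ (coordinate_v mua mub gamma_gt0 b)).
by apply: l2_pw => //; case/andP: mua01 => ? ?; lra.
Qed.

Lemma bounded_interior_form K b : bounded_form H N (interior_form K b).
Proof.
apply: bounded_formD; [apply: bounded_formD|].
- have k := l2_coordinate_pwM q0 m_half (coordinate_y mua mub gamma_gt0 b).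
  exact: (bounded_form_ip Hsn k (coordinate_w_slope mua mub gamma_gt0 b)).
- apply: bounded_formZ.
  exact: (bounded_form_ip Hsn (coordinate_y mua mub gamma_gt0 b)
    (coordinate_w gamma_gt0 mua01 mub02 b)).
- apply: bounded_formZ; apply: bounded_form_mul; first exact: coordinate_u_end.
  apply: scalar_coordinateD; first apply: scalar_coordinateD.
  + exact: (scalar_coordinate_ip Hsn (l2_phi mub mua01) (coordinate_v mua mub gamma_gt0 b)).
  + exact: (scalar_coordinate_ip Hsn (l2_psi mub) (coordinate_y mua mub gamma_gt0 b)).
  + by apply: scalar_coordinateZ; exact: coordinate_u_end.
Qed.

Lemma u_slope_op b U :
  u_slope mua b (A U) = pwM 0 (mua / 2) (derive1 (v_part b U)).
Proof. by case: U => [[[? ?] ?] ?]. Qed.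

Lemma w_slope_op b U :
  w_slope mub b (A U) = pwM (-1) (mub / 2) (derive1 (y_part b U)).
Proof. by case: U => [[[? ?] ?] ?]. Qed.

Lemma w_part_op b U : w_part b (A U) = y_part b U.
Proof. by case: U => [[[? ?] ?] ?]. Qed.

Lemma u_end_op b U : u_end b (A U) = v_part b U 1.
Proof. by case: U => [[[? ?] ?] ?]. Qed.

Let first_regroup (a1 a2 m b1 b2 K z z' M M' k f1 f2 g i i' c e r s : R) :
  a1 + a2 + m * (b1 + b2) + K * (z' * M + z * M')
    + k * (f1 + f2 + g * (z' * i + z * i')) <= - (c * (e + g * z ^+ 2)) + r + s ->
  a1 + m * b1 + K * (z * M') + (a2 + m * b2 + K * (z' * M))
    + k * (f1 + g * (z * i') + (f2 + g * (z' * i))) <= - (c * (e + g * (z * z))) + (r + s).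
Proof.
by move=> h; lra.
Qed.

Lemma interior_dissipation : exists K1 K2 c C L : R,
  [/\ 0 < K1, 0 < K2, 0 < c, 0 < C & 0 < L] /\
  forall U h b, domain gamma mua mub U -> 0 < h <= 1 ->
    interior_form K1 b U (A U) + interior_form K1 b (A U) U
      + K2 / h * (shifted_form b U (A U) + shifted_form b (A U) U) <=
    - (c * energy_form gamma mua mub b U U)
      + (C * h `^ (1 - mua) * local_form b (A U) (A U) + L / h * u_end b (A U) ^+ 2).
Proof.
have [K1 [K2 [c [C [L [pos H]]]]]] := first_multiplier gamma_gt0 mua01 mub02.
exists K1, K2, c, C, L; split => // U h b DU h01.
have [_ /(_ b)[P [Q [u0 [v0 [P0 wd]]]]]] := domain_wave_data mua01 DU.
have := H _ _ _ _ _ _ _ _ _ _ _ _ _ _ _ _ wd h01.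
rewrite /interior_form /shifted_form /rellich_form /local_form /energy_form /moment.
rewrite u_slope_op w_slope_op w_part_op u_end_op.
exact: first_regroup.
Qed.

Let energy_regroup (x1 x2 x3 x4 g z d : R) :
  x1 + x2 + x3 + x4 + g * z * d = - d ^+ 2 ->
  x1 + x2 + (x3 + x4) + g * (z * d) + (x1 + x2 + (x3 + x4) + g * (z * d)) = - (2 * d ^+ 2).
Proof. by move=> h; lra. Qed.

Lemma energy_dissipation U b : domain gamma mua mub U ->
  energy_form gamma mua mub b U (A U) + energy_form gamma mua mub b (A U) U =
    - (2 * u_end b (A U) ^+ 2).
Proof.
move=> DU; have [_ /(_ b)[P [Q [u0 [v0 [P0 wd]]]]]] := domain_wave_data mua01 DU.
have := energy_identity wd.
rewrite (energy_formC gamma mua mub b (A U)) /energy_form.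
rewrite u_slope_op w_slope_op u_end_op.
exact: energy_regroup.
Qed.

Lemma rellich_dissipation U b : domain gamma mua mub U ->
  rellich_form b U (A U) + rellich_form b (A U) U <=
    - (ip 0 1 (v_part b U) (v_part b U) / 2
       + (1 - mua) / 2 * ip 0 1 (u_slope mua b U) (u_slope mua b U))
    + gamma ^+ 2 * u_end b U ^+ 2 + 3 / 2 * u_end b (A U) ^+ 2.
Proof.
move=> DU; have [_ /(_ b)[P [Q [u0 [v0 [P0 wd]]]]]] := domain_wave_data mua01 DU.
rewrite /rellich_form u_slope_op u_end_op.
exact: (second_multiplier mua01 wd).
Qed.

End LyapunovForms.

(** * Assembly of the Lyapunov forms and decay on the domain *)

Section Decay.
Local Open Scope complex_scope.
Context {R : realType}.
Variables (gamma mua mub : R) (T : R -> state (R := R) -> state (R := R)).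
Hypotheses (gamma_gt0 : 0 < gamma) (mua01 : 0 <= mua < 1) (mub02 : 0 <= mub < 2).
Notation H := (energy_space mua mub).
Notation N := (energy_norm gamma mua mub).
Notation A := (wave_op mua mub).
Hypotheses (HT : C0_contraction_semigroup H N T)
  (AT : generated_by H N (domain gamma mua mub) A T).
Implicit Types (U V F : state (R := R)) (b : bool)
  (f : bool -> state (R := R) -> state (R := R) -> R).

Let Hsn : seminormed_module H N. Proof. exact: energy_seminorm. Qed.

Let both f U V : R := f true U V + f false U V.

Let bounded_both f : (forall b, bounded_form H N (f b)) -> bounded_form H N (both f).
Proof. by move=> fb; apply: bounded_formD. Qed.

Let E := both (energy_form gamma mua mub).

Let EN U : H U -> N U ^+ 2 = E U U. Proof. exact: energy_normE. Qed.

Let E_bounded : bounded_form H N E.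
Proof. by apply: bounded_both => b; exact: bounded_energy_form. Qed.

Let form_le (B : state (R := R) -> state (R := R) -> R) (M : R) U :
  (forall U V, H U -> H V -> `|B U V| <= M * (N U * N V)) ->
  H U -> `|B U U| <= M * N U ^+ 2.
Proof. by move=> BM HU; rewrite expr2; exact: BM. Qed.

Lemma domain_pair U : domain gamma mua mub U -> generator_pair H N T U (A U).
Proof.
move=> DU; have [HAU _] := domain_wave_data mua01 DU; have [HU _ _ _] := domainP DU.
have N0 V : H V -> eqN N V V.
  move=> HV; rewrite /eqN subrr -(scale0r V) -[0 : R[i]](rmorph0 (real_complex R)).
  by rewrite (seminormZ Hsn)// normr0 mul0r.
split => //; apply/(AT HU HAU); exists U; split => //; exact: N0.
Qed.

(** A generator pair is equivalent to some [(U', A U')] with [U'] in the domain, and bounded forms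
    do not distinguish equivalent vectors. *)
Lemma generator_pair_dissipation (B Q S : state (R := R) -> state (R := R) -> R) :
  bounded_form H N B -> bounded_form H N Q -> bounded_form H N S ->
  (forall U, domain gamma mua mub U -> B U (A U) + B (A U) U <= Q U U + S (A U) (A U)) ->
  forall U F, generator_pair H N T U F -> B U F + B F U <= Q U U + S F F.
Proof.
move=> fB fQ fS BD U F [HU HF /(AT HU HF)[U' [DU' UU' FF']]].
have [HAU' _] := domain_wave_data mua01 DU'; have [HU' _ _ _] := domainP DU'.
rewrite (bounded_form_eqN Hsn fB HU HF HU' HAU')//.
rewrite (bounded_form_eqN Hsn fB HF HU HAU' HU')//.
rewrite (bounded_form_eqN Hsn fQ HU HU HU' HU')//.
rewrite (bounded_form_eqN Hsn fS HF HF HAU' HAU')//.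
exact: BD.
Qed.

Let lower_bound (i z n MI MZ M K r : R) : 0 < K -> 1 <= r -> 0 <= n -> 0 <= MI ->
  `|i| <= MI * n -> `|z| <= MZ * n -> K * MZ + MI <= K * M ->
  0 <= i + K * r * (z + M * n) <= (MI + K * (MZ + M)) * r * n.
Proof.
move=> K0 r1 n0 MI0 /ler_normlP[i1 i2] /ler_normlP[z1 z2] KM.
have r0 : 0 <= r by exact: le_trans r1.
have Kr0 : 0 <= K * r by rewrite mulr_ge0// ltW.
have zl : K * r * (- z) <= K * r * (MZ * n) by rewrite ler_wpM2l.
have zu : K * r * z <= K * r * (MZ * n) by rewrite ler_wpM2l.
have in0 : 0 <= MI * n by rewrite mulr_ge0.
have ir : MI * n <= r * (MI * n) by rewrite ler_peMl.
have Mr : (K * MZ + MI) * (r * n) <= K * M * (r * n) by rewrite ler_wpM2r// mulr_ge0.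
by apply/andP; split; lra.
Qed.

Let scaled_bound (g n MG M k : R) : 0 <= k -> `|g| <= MG * n -> MG <= M -> 0 <= n ->
  0 <= k * (g + M * n) <= k * ((MG + M) * n).
Proof.
move=> k0 /ler_normlP[g1 g2] MGM n0.
have MGn : MG * n <= M * n by rewrite ler_wpM2r.
by apply/andP; split; [rewrite mulr_ge0//; lra|rewrite ler_wpM2l//; lra].
Qed.

Let first_total (i1 i2 j1 j2 z1 z2 y1 y2 e1 e2 f1 f2 c n1 n2 : R)
    (K M k l1 l2 L d1 d2 C' : R) :
  0 <= d1 -> 0 <= d2 -> L + C' <= 2 * K * M ->
  i1 + i2 + K * (z1 + z2) <= - (c * n1) + (k * l1 + L * d1) ->
  j1 + j2 + K * (y1 + y2) <= - (c * n2) + (k * l2 + L * d2) ->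
  e1 + e2 = - (2 * d1) -> f1 + f2 = - (2 * d2) ->
  i1 + j1 + K * (z1 + y1 + M * (e1 + f1)) + (i2 + j2 + K * (z2 + y2 + M * (e2 + f2)))
    <= - c * (n1 + n2) + (k * (l1 + l2) + - C' * (d1 + d2)).
Proof.
move=> d10 d20 LC h1 h2 E1 E2.
have -> : e2 = - (2 * d1) - e1 by lra.
have -> : f2 = - (2 * d2) - f1 by lra.
have hd : (L + C') * (d1 + d2) <= 2 * K * M * (d1 + d2) by rewrite ler_wpM2r// addr_ge0.
lra.
Qed.

Let second_total (g1 g2 k1 k2 e1 e2 f1 f2 M al x1 x2 y1 y2 gg z1 z2 d1 d2 K r C : R) :
  0 <= d1 -> 0 <= d2 -> 3 / 4 <= M -> 0 <= K -> 0 <= r -> 0 <= x1 -> 0 <= x2 ->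
  K * al = 2 * C -> al <= 1 ->
  g1 + g2 <= - (x1 / 2 + al / 2 * y1) + gg * z1 + 3 / 2 * d1 ->
  k1 + k2 <= - (x2 / 2 + al / 2 * y2) + gg * z2 + 3 / 2 * d2 ->
  e1 + e2 = - (2 * d1) -> f1 + f2 = - (2 * d2) ->
  K * r * (g1 + k1 + M * (e1 + f1)) + K * r * (g2 + k2 + M * (e2 + f2))
    <= - (C * r * (x1 + y1 + (x2 + y2)) - K * gg * r * (z1 + z2)).
Proof.
move=> d10 d20 M34 K0 r0 x10 x20 KC al1 h1 h2 E1 E2.
have -> : e2 = - (2 * d1) - e1 by lra.
have -> : f2 = - (2 * d2) - f1 by lra.
have Kr0 : 0 <= K * r by rewrite mulr_ge0.
have hM : 3 / 4 * (d1 + d2) <= M * (d1 + d2) by rewrite ler_wpM2r// addr_ge0.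
have hx : al * (x1 + x2) <= x1 + x2 by rewrite ler_piMl// addr_ge0.
have key : g1 + k1 + g2 + k2 - 2 * (M * (d1 + d2)) <=
    - (al * (x1 + x2) + al * (y1 + y2)) / 2 + gg * (z1 + z2) by lra.
have /(ler_wpM2l Kr0) := key.
have -> : K * r * (- (al * (x1 + x2) + al * (y1 + y2)) / 2 + gg * (z1 + z2)) =
    - (K * al * r * (x1 + x2 + (y1 + y2))) / 2 + K * gg * r * (z1 + z2) by field.
rewrite KC; lra.
Qed.

(** The dissipation of [K / h] times [M] energies pays for both occurrences of [v(1)^2]: [L / h]
    from the first multiplier and [C' h^(1 - mua)] from the remainder form. *)
Let absorb (L C' s MI K M X ha : R) : 0 <= L -> 0 <= C' -> 0 <= s -> 0 <= MI ->
  ha <= 1 -> 1 <= X -> K * M = s + MI + L + C' -> L * X + C' * ha <= 2 * (K * X) * M.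
Proof.
move=> L0 C0 s0 MI0 ha1 X1 KM; have X0 : 0 <= X by exact: le_trans X1.
have -> : 2 * (K * X) * M = 2 * (K * M) * X by ring.
rewrite KM; have h1 : C' * ha <= C' * X by rewrite ler_wpM2l// (le_trans ha1).
have h2 : 0 <= s * X by rewrite mulr_ge0.
have h3 : 0 <= MI * X by rewrite mulr_ge0.
have h4 : 0 <= L * X by rewrite mulr_ge0.
have h5 : 0 <= C' * X by rewrite mulr_ge0.
lra.
Qed.

Lemma domain_energy_decay : exists2 B : R, 0 < B &
  forall U F t, generator_pair H N T U F -> 0 < t ->
    N (T t U) ^+ 2 <= B * t `^ (- (2 - mua)) * (N U ^+ 2 + N F ^+ 2).
Proof.
have [K1 [K2 [c [C [L [[K10 K20 c0 C0 L0] H1]]]]]] :=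
  interior_dissipation gamma_gt0 mua01 mub02.
have [a0 a1] := andP mua01; have al0 : 0 < 1 - mua by rewrite subr_gt0.
(* [K3 (1 - mua) / 2 = C] lets the second form dissipate the whole remainder [C h^(1 - mua)] times
   the local form; [C'] is then the coefficient of the [gamma^2 u(1)^2] that it leaves. *)
pose K3 := 2 * C / (1 - mua); pose C' := K3 * gamma ^+ 2.
have K30 : 0 < K3 by rewrite divr_gt0// mulr_gt0.
have C'0 : 0 < C' by rewrite mulr_gt0// exprn_gt0.
pose I := both (interior_form mua mub K1).
pose Z := both (shifted_form gamma mua).
pose G := both (rellich_form mua).
pose Lc := both (local_form mua).
pose D := both (fun b U V => u_end b U * u_end b V).
have fI : bounded_form H N I.
  by apply: bounded_both => b; exact: bounded_interior_form.
have fZ : bounded_form H N Z by apply: bounded_both => b; exact: bounded_shifted_form.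
have fG : bounded_form H N G by apply: bounded_both => b; exact: bounded_rellich_form.
have fL : bounded_form H N Lc by apply: bounded_both => b; exact: bounded_local_form.
have fD : bounded_form H N D by apply: bounded_both => b; exact: bounded_u_end_form.
have [MI MI0 IM] := form_bound fI; have [MZ MZ0 ZM] := form_bound fZ.
have [MG MG0 GM] := form_bound fG.
(* In [M], the part [MZ + MI / K2] gives nonnegativity and [(L + C') / K2] absorbs [v(1)^2]. In
   [M'], [MG] gives nonnegativity and the 1, being at least 3/4, absorbs [3/2 v(1)^2] by the
   dissipation [2 v(1)^2]. *)
pose M := MZ + (MI + L + C') / K2; pose M' := MG + 1.
have KM : K2 * M = K2 * MZ + MI + L + C' by rewrite /M; field; rewrite gt_eqF.
have M0 : 0 <= M.
  by rewrite /M addr_ge0// divr_ge0 ?(ltW K20)// addr_ge0 ?(ltW C'0)// addr_ge0 ?(ltW L0).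
have MZ0' : 0 <= K2 * MZ by rewrite mulr_ge0// ltW.
pose C1 := MI + K2 * (MZ + M); pose C2 := K3 * (MG + M').
have C10 : 0 <= C1 by rewrite addr_ge0// mulr_ge0 ?(ltW K20)// addr_ge0.
have M'34 : 3 / 4 <= M' by rewrite /M'; lra.
have C20 : 0 <= C2 by rewrite mulr_ge0 ?(ltW K30)// addr_ge0//; lra.
have CC0 : 0 < C1 + C2 + 1 by rewrite ltr_wpDl// addr_ge0.
have C1le : C1 <= C1 + C2 + 1 by rewrite -addrA lerDl addr_ge0.
have C2le : C2 <= C1 + C2 + 1 by rewrite addrAC lerDr addr_ge0.
have al1 : 1 - mua <= 1 by rewrite gerBl.
have KC : K3 * (1 - mua) = 2 * C by rewrite /K3 divfK// gt_eqF.
have p1 : 1 <= 2 - mua by lra.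
apply: (semigroup_decay Hsn HT p1 c0 CC0) => h /[dup] h01 /andP[h0 h1].
have r1 : 1 <= h^-1 by rewrite invf_ge1.
have al_p : 2 - mua - 1 = 1 - mua by ring.
rewrite al_p; have ha0 : 0 <= h `^ (1 - mua) by exact: powR_ge0.
have ha1 : h `^ (1 - mua) <= 1.
  by have := ge0_ler_powR (ltW al0) (ltW h0) ler01 h1; rewrite powR1.
(* The third form is indefinite. Its negative term offsets the [u(1)^2] left by the second form; at
   [A U] it is [- C' h^(1 - mua) v(1)^2], and the energy inside the first form restores the
   inequality. *)
exists (fun U V => I U V + K2 * h^-1 * (Z U V + M * E U V)),
  (fun U V => K3 * h `^ (1 - mua) * (G U V + M' * E U V)),
  (fun U V => C * h `^ (1 - mua) * Lc U V + - (C' * h `^ (1 - mua)) * D U V).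
have fB0 : bounded_form H N (fun U V => I U V + K2 * h^-1 * (Z U V + M * E U V)).
  apply: bounded_formD => //; apply: bounded_formZ; apply: bounded_formD => //.
  exact: bounded_formZ.
have fB1 : bounded_form H N (fun U V => K3 * h `^ (1 - mua) * (G U V + M' * E U V)).
  by apply: bounded_formZ; apply: bounded_formD => //; exact: bounded_formZ.
have fS : bounded_form H N (fun U V => C * h `^ (1 - mua) * Lc U V
    + - (C' * h `^ (1 - mua)) * D U V).
  by apply: bounded_formD; exact: bounded_formZ.
split; first by split.
split.
- move=> U HU; have n0 := sqr_ge0 (N U); rewrite -EN//.
  have KM' : K2 * MZ + MI <= K2 * M by rewrite KM; lra.
  have /andP[-> /le_trans->//] := lower_bound K20 r1 n0 MI0 (form_le IM HU) (form_le ZM HU) KM'.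
  by apply: ler_wpM2r => //; apply: ler_wpM2r; [rewrite invr_ge0 ltW|exact: C1le].
- move=> U HU; have n0 := sqr_ge0 (N U); rewrite -EN//.
  have MM' : MG <= M' by rewrite lerDl.
  have k0 : 0 <= K3 * h `^ (1 - mua) by rewrite mulr_ge0// ltW.
  have /andP[-> /le_trans->//] := scaled_bound k0 (form_le GM HU) MM' n0.
  have -> : K3 * h `^ (1 - mua) * ((MG + M') * N U ^+ 2) =
    C2 * (h `^ (1 - mua) * N U ^+ 2) by rewrite /C2; ring.
  by rewrite -mulrA; apply: ler_wpM2r C2le; exact: mulr_ge0.
- move=> U F /[dup] -[HU _ _]; rewrite (EN HU) -mulNr; move: U F {HU}.
  apply: (generator_pair_dissipation fB0 (bounded_formZ (- c) E_bounded) fS) => U DU.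
  have := first_total (sqr_ge0 (u_end true (A U))) (sqr_ge0 (u_end false (A U)))
    (absorb (ltW L0) (ltW C'0) MZ0' MI0 ha1 r1 KM)
    (H1 U h true DU h01) (H1 U h false DU h01)
    (energy_dissipation mua01 true DU) (energy_dissipation mua01 false DU).
  by rewrite /D /both -!expr2.
(* A zero multiple of the energy plays the form evaluated at [F], so that
   [generator_pair_dissipation] applies. *)
- move=> U F; rewrite -[X in _ <= X]addr0 -[X in _ <= - X + _]mul1r -mulNr.
  rewrite -[X in _ <= _ + X](mul0r (E F F)); move: U F.
  apply: (generator_pair_dissipation fB1 (bounded_formZ (-1) fS)
    (bounded_formZ 0 E_bounded)) => U DU.
  rewrite mul0r addr0 mulN1r.
  have := second_total (sqr_ge0 (u_end true (A U))) (sqr_ge0 (u_end false (A U)))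
    M'34 (ltW K30) ha0 (ip_ge0 0 1 (v_part true U)) (ip_ge0 0 1 (v_part false U))
    KC al1 (rellich_dissipation mua01 true DU) (rellich_dissipation mua01 false DU)
    (energy_dissipation mua01 true DU) (energy_dissipation mua01 false DU).
  by rewrite /D /both -!expr2 mulNr.
Qed.

End Decay.

Theorem theorem4p1 (R : realType) (gamma mua mub : R)
    (T : R -> state (R := R) -> state (R := R)) :
  0 < gamma -> 0 <= mua < 1 -> 0 <= mub < 2 ->
  C0_contraction_semigroup (energy_space mua mub)
    (energy_norm gamma mua mub) T ->
  generated_by (energy_space mua mub) (energy_norm gamma mua mub)
    (domain gamma mua mub) (wave_op mua mub) T ->
  exists2 C : R, 0 < C &
    forall (t : R) (U0 : state), 0 < t -> domain gamma mua mub U0 ->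
      energy_norm gamma mua mub (T t U0) <=
        C * t `^ (- ((2 - mua) / 2))
          * graph_norm (energy_norm gamma mua mub) (wave_op mua mub) U0.
Proof.
move=> gamma_gt0 mua01 mub02 HT AT.
have [B B0 decay] := domain_energy_decay gamma_gt0 mua01 mub02 HT AT.
exists (Num.sqrt B) => [|t U t0 DU]; first by rewrite sqrtr_gt0.
have N0 V : 0 <= energy_norm gamma mua mub V.
  exact: seminorm_ge0 (energy_seminorm mub gamma_gt0 mua01) V.
have := decay _ _ _ (domain_pair gamma_gt0 mua01 AT DU) t0.
rewrite /graph_norm; move: (N0 (T t U)) (N0 U) (N0 (wave_op mua mub U)).
move: (energy_norm _ _ _ _) (energy_norm _ _ _ _) (energy_norm _ _ _ _).
move=> n x y n0 x0 y0 h.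
rewrite -ler_sqr ?nnegrE ?mulr_ge0 ?addr_ge0 ?sqrtr_ge0 ?powR_ge0//.
apply: le_trans h _; rewrite !exprMn sqr_sqrtr ?(ltW B0)//.
(* Halving the exponent [2 - mua] undoes the squaring of the norm; what remains is
   [x^2 + y^2 <= (x + y)^2] for the graph norm. *)
rewrite -(powR_mulrn 2 (powR_ge0 _ _)) -powRrM mulNr divfK ?pnatr_eq0//.
apply: ler_wpM2l; first by rewrite mulr_ge0 ?powR_ge0// ltW.
by rewrite sqrrD addrAC lerDl mulrn_wge0// mulr_ge0.
Qed.
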